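(* Let $\mathcal{G}$ be the class of planar subcubic graphs. For every integer $\ell\geq 0$, Chromatic Sum is NP-complete for $\mathcal{G}^{2\ell}$. Consequently, Chromatic Sum is NP-complete under edge subdivision of subcubic graphs.
   Context: All graphs are finite, undirected and simple. A graph is subcubic if every vertex has degree at most $3$. A colouring of a graph $G=(V,E)$ is a function $c:V\to\{1,2,\ldots\}$ with $c(u)\neq c(v)$ for every edge $uv\in E$; its sum is $\sum_{v\in V}c(v)$. The decision problem Chromatic Sum takes a graph $G$ and an integer $k$ and asks whether $G$ admits a colouring with sum at most $k$. A statement about a problem ''for'' a graph class refers to the problem with input graphs restricted to (promised to belong to) that class. The $k$-subdivision of a graph $G$ is the graph obtained from $G$ by subdividing each edge exactly $k$ times (replacing each edge by a path of length $k+1$). For a graph class $\mathcal{G}$ and an integer $k\ge 0$, $\mathcal{G}^k$ is the class of all $k$-subdivisions of graphs in $\mathcal{G}$ (so $\mathcal{G}^0=\mathcal{G}$). A graph problem $\Pi$ is NP-complete under edge subdivision of subcubic graphs (condition C3) if for every integer $j\geq 1$ there exists an integer $\ell\geq j$ such that: if $\Pi$ is NP-complete for the class $\mathcal{C}$ of subcubic graphs, then $\Pi$ is NP-complete for $\mathcal{C}^{\ell}$. *)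

(* Defs.v *)
From HB Require Import structures.
From mathcomp Require Import all_boot all_order all_algebra.
From mathcomp Require Import boolp classical_sets set_interval reals topology normedtype.

Set Implicit Arguments.
Unset Strict Implicit.
Unset Printing Implicit Defensive.

Import Order.TTheory GRing.Theory Num.Theory.
Import numFieldNormedType.Exports.

Local Open Scope nat_scope.

Definition word := seq bool.

Inductive move := MoveLeft | Stay | MoveRight.

(* Deterministic, with one two-way infinite tape. Tape symbols are [None]
   (blank), [Some (inl b)] (the bit [b] of the input and output alphabet) and
   [Some (inr a)] (an auxiliary symbol). *)
Record machine := Machine {
  state : finType;
  aux : finType;
  start : state;
  halting : pred state;
  trans : state -> option (bool + aux) -> state * option (bool + aux) * move
}.

Definition symbol (M : machine) := option (bool + aux M).

(* [left_of] lists the cells left of the head, nearest first; all cells beyond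
   the two lists are blank. *)
Record config (M : machine) := Config {
  current : state M;
  left_of : seq (symbol M);
  scanned : symbol M;
  right_of : seq (symbol M)
}.

Definition step (M : machine) (c : config M) : config M :=
  if halting (current c) then c else
  let: (q, a, d) := trans (current c) (scanned c) in
  match d with
  | MoveLeft =>
      Config q (behead (left_of c)) (head None (left_of c)) (a :: right_of c)
  | Stay => Config q (left_of c) a (right_of c)
  | MoveRight =>
      Config q (a :: left_of c) (head None (right_of c)) (behead (right_of c))
  end.

Definition initial (M : machine) (x : word) : config M :=
  let s : seq (symbol M) := [seq Some (inl b) | b <- x] in
  Config (start M) [::] (head None s) (behead s).

Fixpoint leading_bits (A : Type) (s : seq (option (bool + A))) : word :=
  if s is Some (inl b) :: s' then b :: leading_bits s' else [::].

(* The output is the maximal block of bits that starts at the head. *)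
Definition output (M : machine) (c : config M) : word :=
  leading_bits (scanned c :: right_of c).

(* A halted configuration is a fixed point of [step], so running for exactly
   [p.[size x]] steps amounts to halting within that many steps. *)
Definition polytime (f : word -> word) : Prop :=
  exists (M : machine) (p : {poly nat}), forall x : word,
    let c := iter p.[size x]%R (@step M) (initial M x) in
    halting (current c) /\ output c = f x.

Definition pair_word (x y : word) : word :=
  flatten [seq [:: true; b] | b <- x] ++ false :: y.

(* A problem on words whose inputs are promised to satisfy [promise]; [yes] is
   only relevant on such inputs. *)
Record promise_problem := PromiseProblem {
  promise : word -> Prop;
  yes : word -> Prop
}.

Definition language (L : word -> Prop) : promise_problem :=
  PromiseProblem (fun _ => True) L.

Definition in_NP (P : promise_problem) : Prop :=
  exists (V : word -> bool) (p : {poly nat}),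
    polytime (fun z => [:: V z]) /\
    forall x, promise P x ->
      (yes P x <-> exists w : word, size w <= p.[size x]%R /\ V (pair_word x w)).

Definition reduces_to (L : word -> Prop) (P : promise_problem) : Prop :=
  exists f : word -> word, polytime f /\
    forall x, promise P (f x) /\ (L x <-> yes P (f x)).

Definition NP_hard (P : promise_problem) : Prop :=
  forall L : word -> Prop, in_NP (language L) -> reduces_to L P.

Definition NP_complete (P : promise_problem) : Prop := in_NP P /\ NP_hard P.

Record sgraph := SGraph {
  vertex :> finType;
  adj : rel vertex;
  adj_sym : symmetric adj;
  adj_irrefl : irreflexive adj
}.

Definition graph_class := sgraph -> Prop.

Definition isomorphic (G H : sgraph) : Prop :=
  exists f : G -> H, bijective f /\ forall x y, adj (f x) (f y) = adj x y.

Definition subcubic (G : sgraph) : Prop :=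
  forall v : G, #|adj v| <= 3.

(* A drawing in the plane: vertices are distinct points, the edge [uv] is the
   simple arc [arc u v] parametrised by [0, 1] from [u] to [v] ([arc v u] is the
   same arc reversed), and an interior point of an arc is neither a vertex nor an
   interior point of the arc of another edge. *)
Definition planar (R : realType) (G : sgraph) : Prop :=
  (exists (pos : G -> R * R) (arc : G -> G -> R -> R * R),
  [/\ injective pos,
      forall u v : G, adj u v ->
        [/\ {within `[0, 1], continuous (arc u v)}%classic,
            {in `[0, 1] &, injective (arc u v)},
            arc u v 0 = pos u /\ arc u v 1 = pos v &
            {in `[0, 1], forall t, arc v u t = arc u v (1 - t)}],
      forall u v w : G, adj u v ->
        {in `]0, 1[, forall t, arc u v t <> pos w} &
      forall u v u' v' : G, adj u v -> adj u' v' ->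
        (u', v') <> (u, v) -> (u', v') <> (v, u) ->
        {in `]0, 1[ &, forall s t, arc u v s <> arc u' v' t}])%R.

Definition planar_subcubic (R : realType) : graph_class :=
  fun G => planar R G /\ subcubic G.

Section Subdivision.
Variables (k : nat) (G : sgraph).

(* Each edge of [G], listed once: the orientation comes from the enumeration
   of the vertices. *)
Definition oriented_edge (p : G * G) : bool :=
  adj p.1 p.2 && (enum_rank p.1 < enum_rank p.2).

Definition sub_vertex : finType := (G + {p : G * G | oriented_edge p} * 'I_k)%type.

Definition sub_path (a : {p : G * G | oriented_edge p}) : seq sub_vertex :=
  inl (val a).1 :: rcons [seq inr (a, i) | i <- enum 'I_k] (inl (val a).2).

Definition sub_adj : rel sub_vertex := fun x y =>
  [exists a, infix [:: x; y] (sub_path a) || infix [:: y; x] (sub_path a)].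

Lemma sub_path_uniq a : uniq (sub_path a).
Proof.
have inj_inr : injective (fun i : 'I_k => inr (a, i) : sub_vertex).
  by move=> i j [].
rewrite /sub_path /= rcons_uniq map_inj_uniq // enum_uniq andbT mem_rcons inE.
rewrite negb_or; apply/andP; split; last first.
  by apply/mapP => -[].
apply/andP; split; last by apply/mapP => -[].
case: a {inj_inr} => -[u v] /= /andP[/= _ lt_uv].
by apply: contraL lt_uv => /eqP[->]; rewrite ltnn.
Qed.

Lemma sub_adj_sym : symmetric sub_adj.
Proof. by move=> x y; apply: eq_existsb => a; rewrite orbC. Qed.

Lemma sub_adj_irrefl : irreflexive sub_adj.
Proof.
move=> x; apply/existsP => -[a]; rewrite orbb => xx.
by have := infix_uniq xx (sub_path_uniq a); rewrite /= inE eqxx.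
Qed.

Definition subdivision : sgraph := SGraph sub_adj_sym sub_adj_irrefl.

End Subdivision.

Definition subdivision_class (C : graph_class) (k : nat) : graph_class :=
  fun H => exists G : sgraph, C G /\ isomorphic H (subdivision k G).

Definition graph_problem := sgraph -> int -> Prop.

(* Binary expansion, least significant bit first; empty for [0]. *)
Definition nat_word (n : nat) : word :=
  mkseq (fun i => odd (n %/ 2 ^ i)) (up_log 2 n.+1).

Definition int_word (k : int) : word := (k < 0)%R :: nat_word `|k|%N.

(* The order of [G] in unary, its adjacency matrix, and [k] in binary. *)
Definition instance_word (G : sgraph) (k : int) : word :=
  nseq #|G| true ++ false ::
  [seq adj x y | x <- enum G, y <- enum G] ++ int_word k.

(* [instance_word G k] determines [k], and [G] up to isomorphism. *)
Definition restricted_problem (Pi : graph_problem) (C : graph_class) :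
    promise_problem :=
  PromiseProblem
    (fun w => exists (G : sgraph) (k : int), C G /\ w = instance_word G k)
    (fun w => exists (G : sgraph) (k : int), Pi G k /\ w = instance_word G k).

Definition NP_complete_for (Pi : graph_problem) (C : graph_class) : Prop :=
  NP_complete (restricted_problem Pi C).

Definition NP_complete_under_edge_subdivision (Pi : graph_problem) : Prop :=
  forall j : nat, 1 <= j -> exists l : nat, j <= l /\
    (NP_complete_for Pi subcubic ->
     NP_complete_for Pi (subdivision_class subcubic l)).

Definition colouring (G : sgraph) (c : G -> nat) : Prop :=
  (forall v, 0 < c v) /\ (forall u v, adj u v -> c u <> c v).

Definition chromatic_sum : graph_problem := fun G k =>
  exists c : G -> nat, colouring c /\ ((\sum_(v : G) c v)%N%:Z <= k)%R.

(* Main.v *)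
(* For hardness, a verifier is turned by the Cook-Levin construction into a
   CNF formula, which is laid out as a grid: variables are rows, clauses are
   columns, and a column carries downwards the signal "satisfied so far". At
   every crossing sits the same planar gadget; it lets the two signals cross
   and may add the literal to the column signal. The gadget is partitioned into
   pieces (single vertices, edges, triangles with pendant vertices), and a
   colouring attains the sum of the minimal costs of the pieces exactly if it
   is optimal on each piece; optimal pieces act as constants, wires and
   "exactly one of three" constraints. Planarity is clear because all edges
   join neighbours in a triangular lattice.

   If an edge is subdivided 2l times, its inner vertices cost 3l when the ends
   have different colours, 3l + 2 when both have colour 1, and 3l + 1 when
   both have colour 2. As giving colour 3 to one end of a monochromatic edge
   costs no more than that, the threshold is shifted by 3l per edge, provided
   that the gadget does its work even when neighbours may both have colour 3.

   Polynomial time is established by writing all functions in bounded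
   arithmetic over the bits of the input, whose expressions are compiled to
   register machines with unary counters and these to Turing machines. *)

Require Import Defs.
From HB Require Import structures.
From mathcomp Require Import all_boot all_order all_algebra.
From mathcomp Require Import boolp classical_sets reals topology normedtype.
From mathcomp Require Import zify ring lra.

Set Implicit Arguments.
Unset Strict Implicit.
Unset Printing Implicit Defensive.

Local Open Scope nat_scope.

(** * Register machines and their simulation by Turing machines *)

(** A colouring of the subdivision need not be proper on the old vertices, so hardness of the
    unsubdivided problem does not transfer by itself. Soundness is therefore proved for weak
    colourings of the grid: colours 1 to 3, where only edges with both ends 1 or both ends 2
    ([clash]) are forbidden. Every [l], including 0, passes through this one statement, while
    completeness starts from a proper colouring of the grid that attains the minimum. The even
    number of inner vertices matters: consecutive pairs cost at least 3 each, and 1, 2, 1, 2, ... or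
    2, 1, 2, 1, ... attains this between any two different ends, so the shift per edge is a
    constant. The gadget enforces implications only. A column may lose a true signal on its way down
    but cannot gain one without a true literal, which is all that soundness asks. Counting in unary
    is affordable because every value that an expression takes is polynomial in the input. The
    binary threshold of an instance and the powers of two would break this; they are handled by
    truncation and by logarithms. *)

Inductive op :=
  Inc of nat | Clr of nat | Emit of bool | Lt of nat & nat | Bit of nat | In of nat.

Record store := Store { regs : nat -> nat; inw : word; outw : word }.

Definition upd (r : nat -> nat) (i v j : nat) := if j == i then v else r j.

Definition set_reg s i v := Store (upd (regs s) i v) (inw s) (outw s).

Definition bit_at (x : word) p : option bool := nth None (map Some x) p.

Definition do_op (o : op) (s : store) : store :=
  match o with
  | Inc i => set_reg s i (regs s i).+1
  | Clr i => set_reg s i 0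
  | Emit b => Store (regs s) (inw s) (rcons (outw s) b)
  | _ => s
  end.

Definition test_op (o : op) (s : store) : bool :=
  match o with
  | Lt i j => regs s i < regs s j
  | Bit i => bit_at (inw s) (regs s i) == Some true
  | In i => isSome (bit_at (inw s) (regs s i))
  | _ => false
  end.

(* [next l = (o, yes, no)]: perform [o] and branch on its test; [None] exits. *)
Record flow := Flow {
  label : finType;
  entry : label;
  next : label -> op * option label * option label
}.

Section Machine.
Variables (K : nat) (F : flow).

(* A cell holds one mark per register (register [i] is marked on the first
   [regs s i] cells), the input bit and the output bit at that position. *)
Definition cell : finType := ({ffun 'I_K -> bool} * option bool * option bool)%type.

Definition cell0 : cell := ([ffun=> false], None, None).

Definition mark (c : cell) i :=
  if insub i : option 'I_K is Some j then c.1.1 j else false.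

Definition set_mark i b (c : cell) : cell :=
  ([ffun j : 'I_K => if (j : nat) == i then b else c.1.1 j], c.1.2, c.2).

Lemma mark_set i b c j : j < K -> mark (set_mark i b c) j = if j == i then b else mark c j.
Proof. by move=> lt_jK; rewrite /mark insubT ffunE. Qed.

Lemma mark_cell0 i : mark cell0 i = false.
Proof. by rewrite /mark; case: insub => // j; rewrite ffunE. Qed.

Definition sym := option (bool + (bool * cell)).

(** Cells are converted lazily: an unvisited cell still holds a blank or a raw input bit and reads
    as a cell without marks. Only visited cells are written in the auxiliary alphabet. *)
Definition dec (a : sym) : cell :=
  match a with
  | None => cell0
  | Some (inl b) => (cell0.1.1, Some b, None)
  | Some (inr (_, c)) => c
  end.

Definition home (a : sym) := if a is Some (inr (true, _)) then true else false.

Definition enc h c : sym := Some (inr (h, c)).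

(* Every operation is one sweep: starting from the home cell, move right while
   the cell [passes], rewriting it by [pass]; rewrite the first other cell by
   [hit], read the answer of the test there by [ask], and return home. *)
Definition passes (o : op) (c : cell) : bool :=
  match o with
  | Inc i | Clr i | Lt i _ | Bit i | In i => mark c i
  | Emit _ => isSome c.2
  end.

Definition pass o c := if o is Clr i then set_mark i false c else c.

Definition hit o (c : cell) : cell :=
  match o with
  | Inc i => set_mark i true c
  | Emit b => (c.1, Some b)
  | _ => c
  end.

Definition ask o (c : cell) : bool :=
  match o with
  | Lt i j => mark c j
  | Bit i => c.1.2 == Some true
  | In i => isSome c.1.2
  | _ => false
  end.

(** State [(l, None)] sweeps right for the operation at [l], and [(l, Some t)] carries the answer
    [t] back home. Of the other five, 0 marks the home cell, 1 to 3 turn the output track into plain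
    bits, and 4 halts. The home cell is converted last, since its flag tells where to stop; the
    blank written behind the last bit ends the output. *)
Definition tm_state : finType := (label F * option bool + 'I_5)%type.

Definition st_init : tm_state := inr (inord 0).
Definition st_fin1 : tm_state := inr (inord 1).
Definition st_fin2 : tm_state := inr (inord 2).
Definition st_fin3 : tm_state := inr (inord 3).
Definition st_halt : tm_state := inr (inord 4).

Definition resume (s : option (label F)) : tm_state :=
  if s is Some l then inl (l, None) else st_fin1.

Definition tm_trans (q : tm_state) (a : sym) : tm_state * sym * move :=
  match q with
  | inl (l, None) =>
      let o := (next l).1.1 in
      if passes o (dec a) then (q, enc (home a) (pass o (dec a)), MoveRight)
      else (inl (l, Some (ask o (dec a))), enc (home a) (hit o (dec a)), Stay)
  | inl (l, Some t) =>
      if home a then (resume (if t then (next l).1.2 else (next l).2), a, Stay)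
      else (q, a, MoveLeft)
  | inr i =>
      match val i with
      | 0 => (inl (entry F, None), enc true (dec a), Stay)
      | 1 => (st_fin2, a, MoveRight)
      | 2 => if (dec a).2 is Some b then (st_fin2, Some (inl b), MoveRight)
             else (st_fin3, None, MoveLeft)
      | _ => if home a then
               (st_halt, if (dec a).2 is Some b then Some (inl b) else None, Stay)
             else (st_fin3, a, MoveLeft)
      end
  end.

Definition tm : machine :=
  Machine st_init (pred1 st_halt) tm_trans.

Lemma st_eqE i j : i < 5 -> j < 5 ->
  ((inr (inord i) : tm_state) == inr (inord j)) = (i == j).
Proof.
move=> lt_i lt_j; apply/eqP/eqP => [[]|-> //].
by move/(congr1 val); rewrite /= !inordK.
Qed.

Notation cfg := (@Config tm).
Notation run n := (iter n (@step tm)).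

Lemma step_live (q : tm_state) L a R : q != st_halt ->
  step (cfg q L a R) =
  let: (q', a', d) := tm_trans q a in
  match d with
  | MoveLeft => cfg q' (behead L) (head None L) (a' :: R)
  | Stay => cfg q' L a' R
  | MoveRight => cfg q' (a' :: L) (head None R) (behead R)
  end.
Proof. by move=> nh; rewrite /step /= (negbTE nh). Qed.

(** The effect of one sweep on the tape, listed from the home cell on. Beyond the list there is a
    blank, which no operation passes, so a sweep lengthens the list by at most one cell. *)
Fixpoint scan o (ts : seq sym) : seq sym :=
  if ts is a :: R then
    if passes o (dec a) then enc (home a) (pass o (dec a)) :: scan o R
    else enc (home a) (hit o (dec a)) :: R
  else [:: enc false (hit o cell0)].

Fixpoint scan_len o (ts : seq sym) : nat :=
  if ts is a :: R then if passes o (dec a) then (scan_len o R).+1 else 0 else 0.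

Definition scan_ask o ts := ask o (dec (nth None ts (scan_len o ts))).

Lemma passes0 o : passes o cell0 = false.
Proof. by case: o => // *; rewrite /= mark_cell0. Qed.

Lemma scan_lenP o ts :
  (forall p, p < scan_len o ts -> passes o (dec (nth None ts p))) /\
  passes o (dec (nth None ts (scan_len o ts))) = false.
Proof.
elim: ts => [|a ts [IH1 IH2]] /=; first by rewrite passes0.
by case: ifP => [pa|//]; split=> // -[].
Qed.

Lemma size_scan o ts : size (scan o ts) <= (size ts).+1.
Proof. by elim: ts => //= a ts IH; case: ifP => //= _; rewrite ltnS. Qed.

Lemma nth_scan o ts p :
  dec (nth None (scan o ts) p) =
  let c := dec (nth None ts p) in
  if p < scan_len o ts then pass o c
  else if p == scan_len o ts then hit o c else c.
Proof.
elim: ts p => [|a ts IH] [|p] //=; first by rewrite nth_nil.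
  by case: ifP.
by case: ifP => //= _; rewrite IH ltnS.
Qed.

Lemma run_right l (ts L : seq sym) : let o := (next l).1.1 in
  exists n (L' : seq sym) a' (R' : seq sym),
  [/\ run n (cfg (inl (l, None)) L (head None ts) (behead ts)) =
        cfg (inl (l, Some (scan_ask o ts))) (L' ++ L) a' R',
      rev L' ++ a' :: R' = scan o ts, n = (size L').+1 & size L' <= size ts].
Proof.
move=> o; elim: ts L => [|a ts IH] L.
  exists 1, [::], (enc false (hit o cell0)), [::]; split=> //=.
  by rewrite step_live //= passes0.
have [pa|pa] := boolP (passes o (dec a)).
  have [n [L' [a' [R' [run_n def_scan def_n le_n]]]]] :=
    IH (enc (home a) (pass o (dec a)) :: L).
  exists n.+1, (rcons L' (enc (home a) (pass o (dec a)))), a', R'; rewrite ?iterSr; split.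
  - have -> : step (cfg (inl (l, None)) L a ts) =
        cfg (inl (l, None)) (enc (home a) (pass o (dec a)) :: L) (head None ts) (behead ts).
      by rewrite step_live //= -/o pa.
    by rewrite run_n cat_rcons /scan_ask /= pa.
  - by rewrite rev_rcons /= pa -def_scan.
  - by rewrite size_rcons def_n.
  - by rewrite size_rcons.
exists 1, [::], (enc (home a) (hit o (dec a))), ts; split=> //=.
  by rewrite step_live //= -/o (negbTE pa) /scan_ask /= (negbTE pa).
by rewrite (negbTE pa).
Qed.

Lemma run_left l t (L : seq sym) a (R : seq sym) h (R0 : seq sym) : home h -> all (predC home) R0 ->
  rev L ++ a :: R = h :: R0 ->
  run (size L).+1 (cfg (inl (l, Some t)) L a R) =
  cfg (resume (if t then (next l).1.2 else (next l).2)) [::] h R0.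
Proof.
move=> hh hR0; elim: L a R => [|b L IH] a R.
  by move=> [-> ->]; rewrite /= step_live //= hh.
rewrite rev_cons cat_rcons => def.
have ha : home a = false.
  have: a \in R0.
    move: def; case/lastP: L {IH} => [[_ <-]|L x]; first by rewrite inE eqxx.
    by rewrite rev_rcons /= => -[_ <-]; rewrite mem_cat !inE eqxx !orbT.
  by move/(allP hR0)/negbTE.
have step1 : step (cfg (inl (l, Some t)) (b :: L) a R) = cfg (inl (l, Some t)) L b (a :: R).
  by rewrite step_live //= ha.
by rewrite -[size (b :: L)]/(size L).+1 iterSr step1 IH.
Qed.

Definition represents (s : store) (ts : seq sym) :=
  [/\ home (head None ts), all (predC home) (behead ts) &
      forall p, let c := dec (nth None ts p) in
      [/\ c.1.2 = bit_at (inw s) p, c.2 = bit_at (outw s) p &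
          forall i, i < K -> mark c i = (p < regs s i)]].

Definition op_bound (o : op) :=
  match o with
  | Inc i | Clr i | Bit i | In i => i < K
  | Lt i j => (i < K) && (j < K)
  | Emit _ => true
  end.

Lemma bit_at_size x p : isSome (bit_at x p) = (p < size x).
Proof.
rewrite /bit_at; case: (ltnP p (size x)) => lt_p.
  by rewrite (nth_map false).
by rewrite nth_default // size_map.
Qed.

Lemma bit_at_rcons x b p :
  bit_at (rcons x b) p = if p == size x then Some b else bit_at x p.
Proof. by rewrite /bit_at map_rcons nth_rcons size_map; case: ltngtP => // ?; rewrite nth_default ?size_map 1?ltnW. Qed.

Lemma home_scan o ts : home (head None ts) -> home (head None (scan o ts)).
Proof. by case: ts => //= a ts; case: ifP => _ /=; case: (home a). Qed.

Lemma all_scan o ts : home (head None ts) -> all (predC home) (behead ts) ->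
  all (predC home) (behead (scan o ts)).
Proof.
case: ts => //= a ts _; case: ifP => //= _; elim: ts => //= b ts IH /andP[hb hts].
by case: ifP => /= _; rewrite ?IH // ?hts andbT; case: (home b) hb.
Qed.

(** The marks of a register form an initial segment, so the first cell without a mark of [i] is the
    cell number [regs s i]. Marking it increments the register, its mark of [j] decides the
    comparison with register [j], and its input track holds the addressed bit. *)
Lemma scan_represents o s ts : op_bound o -> represents s ts ->
  represents (do_op o s) (scan o ts) /\ scan_ask o ts = test_op o s.
Proof.
move=> ob [hh hb rep].
have [len1 len2] := scan_lenP o ts.
have len_reg i : i < K -> passes o =1 mark^~ i -> scan_len o ts = regs s i.
  move=> lt_i eq_p; have [_ _ /(_ i lt_i)] := rep (scan_len o ts).
  rewrite -eq_p len2 => /esym/negbT; rewrite -leqNgt => le1.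
  apply/eqP; rewrite eqn_leq le1 andbT leqNgt; apply/negP => lt1.
  have [_ _ /(_ i lt_i)] := rep (regs s i).
  by rewrite -eq_p (len1 _ lt1) ltnn.
have len_out b : o = Emit b -> scan_len o ts = size (outw s).
  move=> def_o; have eq_p c : passes o c = isSome c.2 by rewrite def_o.
  have [_ eq_o _] := rep (scan_len o ts).
  move: len2; rewrite eq_p eq_o bit_at_size => /negbT; rewrite -leqNgt => le1.
  apply/eqP; rewrite eqn_leq le1 andbT leqNgt; apply/negP => lt1.
  have [_ eq_o' _] := rep (size (outw s)).
  by have := len1 _ lt1; rewrite eq_p eq_o' bit_at_size ltnn.
split; last first.
  rewrite /scan_ask; have [ei eo em] := rep (scan_len o ts).
  case: o ob len_reg em {len1 len2 len_out} ei eo => //=.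
  - move=> i j /andP[ltiK ltjK] len_reg em _ _.
    by rewrite em // (len_reg i).
  - by move=> i lt_i len_reg _ -> _; rewrite (len_reg i).
  - by move=> i lt_i len_reg _ -> _; rewrite (len_reg i).
split.
- exact: home_scan.
- exact: all_scan.
move=> p; rewrite nth_scan; have [ei eo em] := rep p.
set c := dec (nth None ts p) in ei eo em *.
case: o ob len_reg len_out {len1 len2}; rewrite /=.
- move=> i lt_i len_reg _; rewrite (len_reg i) //.
  case: ltngtP => cmp; split=> //= j lt_j; rewrite ?mark_set ?em // /upd.
  + by case: (j =P i) => [eq_ji|_] //; rewrite ?eq_ji; lia.
  + by case: (j =P i) => [eq_ji|_] //; rewrite ?eq_ji; lia.
  + by case: (j =P i) => [eq_ji|_] //; rewrite ?eq_ji; lia.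
- move=> i lt_i len_reg _; rewrite (len_reg i) //.
  case: ltngtP => cmp; split=> //= j lt_j; rewrite ?mark_set ?em // /upd.
  + by case: (j =P i) => [eq_ji|_] //; rewrite ?eq_ji; lia.
  + by case: (j =P i) => [eq_ji|_] //; rewrite ?eq_ji; lia.
  + by case: (j =P i) => [eq_ji|_] //; rewrite ?eq_ji; lia.
- move=> b _ _ /(_ b erefl) ->.
  rewrite bit_at_rcons; case: (ltngtP p (size (outw s))) => cmp; split=> //= j lt_j.
- by move=> i j _ _ _; rewrite !if_same.
- by move=> i _ _ _; rewrite !if_same.
- by move=> i _ _ _; rewrite !if_same.
Qed.

Lemma run_op l s (ts : seq sym) : op_bound (next l).1.1 -> represents s ts ->
  exists n (ts' : seq sym),
  [/\ run n (cfg (inl (l, None)) [::] (head None ts) (behead ts)) =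
        cfg (resume (if test_op (next l).1.1 s then (next l).1.2 else (next l).2))
            [::] (head None ts') (behead ts'),
      represents (do_op (next l).1.1 s) ts',
      size ts' <= (size ts).+1 & n <= 2 * (size ts).+1].
Proof.
move=> ob rep; have [rep' def_ask] := scan_represents ob rep.
have [n [L [a [R [run_n def_scan def_n le_n]]]]] := run_right l ts [::].
exists ((size L).+1 + n), (scan (next l).1.1 ts); split=> //.
- rewrite iterD run_n cats0 def_ask.
  have [hh hb _] := rep'.
  apply: run_left => //; rewrite def_scan.
  by case: (scan _ _) hh.
- exact: size_scan.
- by rewrite def_n; lia.
Qed.

Lemma bit_at0 x : bit_at x 0 = if x is b :: _ then Some b else None.
Proof. by case: x. Qed.

Lemma run_fin s (ts : seq sym) : represents s ts ->
  exists n c, [/\ run n (cfg st_fin1 [::] (head None ts) (behead ts)) = c,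
    halting (current c), output c = outw s & n <= 2 * (size ts).+2].
Proof.
have live1 : st_fin1 != st_halt by rewrite st_eqE.
have live2 : st_fin2 != st_halt by rewrite st_eqE.
have live3 : st_fin3 != st_halt by rewrite st_eqE.
case: ts => [[]//|h R] [/= hh hR rep].
have trans1 a : tm_trans st_fin1 a = (st_fin2, a, MoveRight) by rewrite /= inordK.
have trans2 a : tm_trans st_fin2 a =
    if (dec a).2 is Some b then (st_fin2, Some (inl b), MoveRight) else (st_fin3, None, MoveLeft).
  by rewrite /= inordK.
have trans3 a : tm_trans st_fin3 a = if home a then
      (st_halt, if (dec a).2 is Some b then Some (inl b) else None, Stay)
    else (st_fin3, a, MoveLeft).
  by rewrite /= inordK.
pose bits (w : word) : seq sym := [seq Some (inl b) | b <- w].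
have right R0 w L : all (predC home) R0 ->
    (forall p, (dec (nth None R0 p)).2 = bit_at w p) -> size w <= size R0 /\
  exists T, run (size w).+1 (cfg st_fin2 L (head None R0) (behead R0)) =
    cfg st_fin3 (behead (rev (bits w) ++ L)) (head None (rev (bits w) ++ L)) (None :: T).
  elim: R0 w L => [|a R0 IH] w L.
    move=> _ /(_ 0) /=; rewrite bit_at0; case: w => //= _; split=> //.
    by exists [::]; rewrite step_live // trans2.
  move=> /andP[ha hR0] eqw; case: w eqw => [|b w] eqw.
    split=> //; exists R0; rewrite /= step_live // trans2.
    by have := eqw 0; rewrite /= => ->.
  have [|le_w [T run_T]] := IH w (Some (inl b) :: L) hR0.
    by move=> p; have := eqw p.+1.
  split=> //; exists T; rewrite iterSr step_live // trans2.
  have := eqw 0; rewrite /= => -> /=; rewrite /= in run_T; rewrite run_T /=.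
  by rewrite rev_cons cat_rcons.
have left L R0 : all (predC home) L ->
    run (size L).+1 (cfg st_fin3 (behead (L ++ [:: h])) (head None (L ++ [:: h])) R0) =
    cfg st_halt [::] (if (dec h).2 is Some b then Some (inl b) else None) (rev L ++ R0).
  elim: L R0 => [|a L IH] R0 => [_|/andP[ha hL]].
    by rewrite /= step_live // trans3 hh.
  have step1 : step (cfg st_fin3 (L ++ [:: h]) a R0) =
      cfg st_fin3 (behead (L ++ [:: h])) (head None (L ++ [:: h])) (a :: R0).
    by rewrite step_live // trans3 (negbTE ha).
  by rewrite -[X in iter X]/((size L).+1.+1) iterSr step1 IH // rev_cons cat_rcons.
(* The first output bit sits in the home cell, which the sweep to the right skips. *)
have [|le_w [T run_T]] := right R (behead (outw s)) [:: h] hR.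
  by move=> p; have [_ /= -> _] := rep p.+1; case: (outw s) => //=; rewrite /bit_at !nth_nil.
set w := behead (outw s) in le_w run_T *.
have step1 : run 1 (cfg st_fin1 [::] h R) = cfg st_fin2 [:: h] (head None R) (behead R).
  by rewrite /= step_live // trans1.
exists ((size (rev (bits w))).+1 + ((size w).+1 + 1)); eexists; split; first by [].
- rewrite iterD iterD step1 run_T left; first by rewrite /= eqxx.
  by rewrite all_rev all_map; apply/allP.
- rewrite iterD iterD step1 run_T left; last by rewrite all_rev all_map; apply/allP.
  have [_ /= -> _] := rep 0; rewrite /output revK /= bit_at0 /w.
  case: (outw s) => //= b w'; congr cons.
  by elim: w' => //= b' w' ->.
- by rewrite size_rev size_map /=; lia.
Qed.

Inductive flow_run : label F -> store -> nat -> option (label F) -> store -> Prop :=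
| Flow_step l s : flow_run l s 1
    (if test_op (next l).1.1 s then (next l).1.2 else (next l).2) (do_op (next l).1.1 s)
| Flow_trans l s n l' s' m e s'' :
    flow_run l s n (Some l') s' -> flow_run l' s' m e s'' -> flow_run l s (n + m) e s''.

(** An operation crosses the visited tape once in each direction and lengthens it by at most one
    cell, whence the quadratic bound. *)
Lemma run_flow l s n e s' : (forall l : label F, op_bound (next l).1.1) ->
  flow_run l s n e s' -> forall ts : seq sym, represents s ts ->
  exists k (ts' : seq sym),
  [/\ run k (cfg (inl (l, None)) [::] (head None ts) (behead ts)) =
        cfg (resume e) [::] (head None ts') (behead ts'),
      represents s' ts',
      size ts' <= size ts + n & k <= 2 * n * (size ts + n)].
Proof.
move=> ob; elim=> {l s n e s'} [l s|l s n l' s' m e s'' _ IH1 _ IH2] ts rep.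
  have [k [ts' [run1 rep1 le1 le2]]] := run_op (ob l) rep.
  by exists k, ts'; split=> //; lia.
have [k1 [ts1 [run1 rep1 le1 le1']]] := IH1 ts rep.
have [k2 [ts2 [run2 rep2 le2 le2']]] := IH2 ts1 rep1.
exists (k2 + k1), ts2; split=> //; first by rewrite iterD run1.
  by lia.
by nia.
Qed.

Lemma represents_initial x :
  let ts := [seq Some (inl b) | b <- x] : seq sym in
  represents (Store (fun _ => 0) x [::]) (enc true (dec (head None ts)) :: behead ts).
Proof.
split=> //=; first by case: x => //= b x; rewrite all_map; apply/allP.
move=> p.
have -> : dec (nth None (enc true (dec (head None [seq Some (inl b) | b <- x]))
      :: behead [seq Some (inl b) | b <- x]) p) =
    dec (nth None [seq Some (inl b) | b <- x] p).
  by case: x p => [|b x] [|p] //=; rewrite nth_nil.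
have -> : bit_at [::] p = None by case: p.
rewrite /bit_at; have [lt_p|le_p] := ltnP p (size x).
  rewrite !(nth_map false) //=; split=> // i lt_i.
  by rewrite /mark insubT ffunE.
rewrite !(nth_default None) ?size_map //=; split=> // i lt_i.
by rewrite mark_cell0 ltn0.
Qed.

Lemma tm_computes x n s' : (forall l : label F, op_bound (next l).1.1) ->
  flow_run (entry F) (Store (fun _ => 0) x [::]) n None s' ->
  exists k, let c := run k (initial tm x) in
  [/\ halting (current c), output c = outw s' & k <= 4 * (n + size x + 3) * (n + size x + 3)].
Proof.
move=> ob fr; set ts := [seq Some (inl b) | b <- x] : seq sym.
have [k [ts' [run1 rep1 le1 le1']]] := run_flow ob fr (represents_initial x).
have [k2 [c [run2 hc oc le2]]] := run_fin rep1.
exists (k2 + (k + 1)) => /=.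
have -> : run (k2 + (k + 1)) (initial tm x) = c.
  rewrite iterD iterD /= {3}/step /= /initial -/ts.
  rewrite st_eqE //= inordK //=.
  by move: run1; rewrite /= => ->.
split=> //.
have le_size : size (behead ts) <= size x by rewrite size_behead size_map leq_pred.
rewrite /= in le1 le1'; set M := n + size x + 3.
have le_k : k <= 2 * M * M.
  apply: leq_trans le1' _; apply: leq_mul; first by rewrite /M; lia.
  apply: (@leq_trans ((size x).+1 + n)); last by rewrite /M; lia.
  by rewrite leq_add2r ltnS; exact: le_size.
have le_k2 : k2 <= 2 * M.
  apply: (leq_trans le2); rewrite leq_mul2l /=; apply: (@leq_trans ((size x).+1 + n).+2).
    by rewrite !ltnS; apply: leq_trans le1 _; rewrite leq_add2r ltnS; exact: le_size.
  by rewrite /M; lia.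
have : 3 <= M by rewrite /M; lia.
by nia.
Qed.

End Machine.

(** * Structured programs and their flow graphs *)

Inductive cmd :=
  Do of op | Seq of cmd & cmd | If of op & cmd & cmd | While of op & cmd.

Inductive exec : cmd -> store -> nat -> store -> Prop :=
| Exec_do o s : exec (Do o) s 1 (do_op o s)
| Exec_seq c1 c2 s n1 s1 n2 s2 :
    exec c1 s n1 s1 -> exec c2 s1 n2 s2 -> exec (Seq c1 c2) s (n1 + n2) s2
| Exec_if o c1 c2 s n s' :
    exec (if test_op o s then c1 else c2) (do_op o s) n s' ->
    exec (If o c1 c2) s (1 + n) s'
| Exec_while_stop o c s : test_op o s = false -> exec (While o c) s 1 (do_op o s)
| Exec_while_go o c s n s' m s'' : test_op o s ->
    exec c (do_op o s) n s' -> exec (While o c) s' m s'' ->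
    exec (While o c) s (1 + (n + m)) s''.

(** An exit of a subprogram continues at [e], the entry of what follows it; other jumps stay inside
    the copy embedded by [f]. *)
Definition redirect (A B : Type) (f : A -> B) (e : option B) (x : option A) : option B :=
  if x is Some a then Some (f a) else e.

Definition embed_next (F : flow) (B : Type) (f : label F -> B) (e : option B) l :
    op * option B * option B :=
  ((next l).1.1, redirect f e (next l).1.2, redirect f e (next l).2).

Fixpoint flow_of (c : cmd) : flow :=
  match c with
  | Do o => @Flow unit tt (fun _ => (o, None, None))
  | Seq c1 c2 =>
      @Flow (label (flow_of c1) + label (flow_of c2))%type (inl (entry (flow_of c1)))
        (fun l => match l with
         | inl l => embed_next inl (Some (inr (entry (flow_of c2)))) l
         | inr l => embed_next inr None l
         end)
  | If o c1 c2 =>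
      @Flow (unit + (label (flow_of c1) + label (flow_of c2)))%type (inl tt)
        (fun l => match l with
         | inl tt => (o, Some (inr (inl (entry (flow_of c1)))),
                         Some (inr (inr (entry (flow_of c2)))))
         | inr (inl l) => embed_next (inr \o inl) None l
         | inr (inr l) => embed_next (inr \o inr) None l
         end)
  | While o c =>
      @Flow (unit + label (flow_of c))%type (inl tt)
        (fun l => match l with
         | inl tt => (o, Some (inr (entry (flow_of c))), None)
         | inr l => embed_next inr (Some (inl tt)) l
         end)
  end.

Lemma flow_run_embed (F G : flow) (f : label F -> label G) e :
  (forall l, next (f l) = embed_next f e l) ->
  forall l s n x s', flow_run l s n x s' -> flow_run (f l) s n (redirect f e x) s'.
Proof.
move=> nextf l s n x s'; elim=> {l s n x s'} [l s|l s n l' s' m x s'' _ IH1 _ IH2].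
  by have := Flow_step (f l) s; rewrite nextf /=; case: ifP.
exact: Flow_trans IH1 IH2.
Qed.

Lemma exec_flow c s n s' :
  exec c s n s' -> flow_run (entry (flow_of c)) s n None s'.
Proof.
elim=> {c s n s'} [o s|c1 c2 s n1 s1 n2 s2 _ IH1 _ IH2|o c1 c2 s n s' _ IH
  |o c s ntest|o c s n s' m s'' test _ IH1 _ IH2].
- by have := @Flow_step (flow_of (Do o)) tt s; rewrite /= if_same.
- pose G := flow_of (Seq c1 c2).
  have R1 := @flow_run_embed _ G inl (Some (inr (entry (flow_of c2)))) (fun=> erefl) _ _ _ _ _ IH1.
  have R2 := @flow_run_embed _ G inr None (fun=> erefl) _ _ _ _ _ IH2.
  exact: Flow_trans R1 R2.
- pose G := flow_of (If o c1 c2).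
  have := @Flow_step G (inl tt) s; rewrite /=.
  case: (test_op o s) IH => IH R.
    by apply: Flow_trans R _; apply: (@flow_run_embed _ G (inr \o inl) None _ _ _ _ _ _ IH).
  by apply: Flow_trans R _; apply: (@flow_run_embed _ G (inr \o inr) None _ _ _ _ _ _ IH).
- by have := @Flow_step (flow_of (While o c)) (inl tt) s; rewrite /= ntest.
- pose G := flow_of (While o c).
  have := @Flow_step G (inl tt) s; rewrite /= test => R.
  apply: Flow_trans R _; apply: Flow_trans IH2.
  exact: (@flow_run_embed _ G inr (Some (inl tt)) _ _ _ _ _ _ IH1).
Qed.

Definition op_sup (o : op) :=
  match o with
  | Inc i | Clr i | Bit i | In i => i.+1
  | Lt i j => maxn i.+1 j.+1
  | Emit _ => 0
  end.

Fixpoint cmd_sup (c : cmd) :=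
  match c with
  | Do o => op_sup o
  | Seq c1 c2 => maxn (cmd_sup c1) (cmd_sup c2)
  | If o c1 c2 => maxn (op_sup o) (maxn (cmd_sup c1) (cmd_sup c2))
  | While o c => maxn (op_sup o) (cmd_sup c)
  end.

Lemma op_boundP K o : op_sup o <= K -> op_bound K o.
Proof. by case: o => //= i j; rewrite geq_max. Qed.

Lemma flow_of_bound K c : cmd_sup c <= K ->
  forall l : label (flow_of c), op_bound K (next l).1.1.
Proof.
elim: c => [o|c1 IH1 c2 IH2|o c1 IH1 c2 IH2|o c IH] /=.
- by move=> le_o _; apply: op_boundP.
- by rewrite geq_max => /andP[/IH1 b1 /IH2 b2] [l|l] /=.
- rewrite !geq_max => /and3P[/op_boundP bo /IH1 b1 /IH2 b2].
  by case=> [[]|[l|l]] /=.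
- by rewrite geq_max => /andP[/op_boundP bo /IH b] [[]|l] /=.
Qed.

Lemma iter_halted (M : machine) n (c : config M) :
  halting (current c) -> iter n (@step M) c = c.
Proof. by move=> hc; elim: n => //= n ->; rewrite /step hc. Qed.

Definition store0 x := Store (fun _ => 0) x [::].

(** Bounds are powers of a base that is at least 2, so that constants, sums and products are all
    absorbed by the exponent. *)
Lemma polytime_cmd (f : word -> word) c d :
  (forall x, exists n s', [/\ exec c (store0 x) n s', outw s' = f x & n <= (size x + 2) ^ d]) ->
  polytime f.
Proof.
move=> run_c; exists (tm (cmd_sup c) (flow_of c)).
exists (4%:P * (('X + 2%:P) ^+ d + 'X + 3%:P) ^+ 2)%R => x.
have -> : ((4%:P * (('X + 2%:P) ^+ d + 'X + 3%:P) ^+ 2).[size x])%R =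
    4 * ((size x + 2) ^ d + size x + 3) ^ 2.
  rewrite !(hornerM, hornerC, horner_exp, hornerD, hornerX).
  by [].

have [n [s' [run_x <- le_n]]] := run_c x.
have [k [hc oc le_k]] := tm_computes (flow_of_bound (leqnn _)) (exec_flow run_x).
rewrite /= in hc oc.
set N := 4 * _; have le_kN : k <= N.
  by rewrite /N expnS expn1; apply: leq_trans le_k _; rewrite -mulnA leq_mul2l /=; apply: leq_mul; lia.
by rewrite -(subnK le_kN) iterD /= iter_halted.
Qed.

Lemma exec_eq c s n s' s'' : exec c s n s' -> s' = s'' -> exec c s n s''.
Proof. by move=> ? <-. Qed.

Lemma store_eq f g x w : f =1 g -> Store f x w = Store g x w.
Proof. by move=> /funext ->. Qed.

Lemma exec_for o body (I : nat -> store) m N :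
  (forall i, i <= m -> test_op o (I i) = (i < m) /\ do_op o (I i) = I i) ->
  (forall i, i < m -> exists n, exec body (I i) n (I i.+1) /\ n <= N) ->
  exists n, exec (While o body) (I 0) n (I m) /\ n <= m * N.+1 + 1.
Proof.
move=> test_o run_b.
suff: forall k i, i + k = m -> exists n, exec (While o body) (I i) n (I m) /\ n <= k * N.+1 + 1.
  by move=> /(_ m 0); apply.
elim=> [|k IH] i def_m.
  have def_i : i = m by lia.
  have [] := test_o i; first by lia.
  rewrite def_i ltnn => testF doI; exists 1; split=> //.
  by apply: exec_eq doI; apply: Exec_while_stop.
have lt_i : i < m by lia.
have [testT doI] := test_o i (ltnW lt_i).
have [n [run_i le_n]] := run_b i lt_i.
have [n' [run_m le_n']] := IH i.+1 (etrans (addSnnS _ _) def_m).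
exists (1 + (n + n')); split; last by nia.
by apply: Exec_while_go run_m; rewrite ?testT ?doI.
Qed.

(** * Bounded arithmetic runs in polynomial time *)

(* Bounded arithmetic over the input word; [Sum n e] is the sum of [e] over
   all [i < n], where [e] sees [i] as variable 0. *)
Inductive expr :=
  Var of nat | Const of nat | Size | BitE of expr | Add of expr & expr
| Leq of expr & expr | Sum of expr & expr.

Fixpoint eval (x : word) (env : seq nat) (e : expr) : nat :=
  match e with
  | Var k => nth 0 env k
  | Const n => n
  | Size => size x
  | BitE e => nth false x (eval x env e)
  | Add a b => eval x env a + eval x env b
  | Leq a b => eval x env a <= eval x env b
  | Sum a b => \sum_(i < eval x env a) eval x (val i :: env) b
  end.

(** Adds register [b] to register [a]. There is no decrement, so [c] counts up to [b]; both are
    cleared afterwards, to be scratch again. *)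
Definition move_to a b c :=
  Seq (While (Lt c b) (Seq (Do (Inc a)) (Do (Inc c)))) (Seq (Do (Clr b)) (Do (Clr c))).

Fixpoint comp (e : expr) (r : nat) (env : seq nat) : cmd :=
  match e with
  | Var k => if k < size env then While (Lt r (nth 0 env k)) (Do (Inc r)) else Do (Clr r)
  | Const n => iter n (fun c => Seq c (Do (Inc r))) (Do (Clr r))
  | Size => While (In r) (Do (Inc r))
  | BitE e => Seq (comp e r env) (If (Bit r) (Seq (Do (Clr r)) (Do (Inc r))) (Do (Clr r)))
  | Add a b => Seq (comp a r env) (Seq (comp b r.+1 env) (move_to r r.+1 r.+2))
  | Leq a b =>
      Seq (Seq (comp a r.+1 env) (comp b r.+2 env))
        (Seq (If (Lt r.+2 r.+1) (Do (Clr r)) (Do (Inc r)))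
             (Seq (Do (Clr r.+1)) (Do (Clr r.+2))))
  | Sum a b =>
      Seq (comp a r.+1 env)
        (Seq (While (Lt r.+2 r.+1)
                (Seq (comp b r.+3 (r.+2 :: env)) (Seq (move_to r r.+3 r.+4) (Do (Inc r.+2)))))
             (Seq (Do (Clr r.+1)) (Do (Clr r.+2))))
  end.

Ltac upd_cases := rewrite /upd /=;
  repeat match goal with |- context [?a == ?b :> nat] => case: (@eqP _ a b) => ? //= end; try subst; try lia.

Lemma exec_move_to a b c s : a != b -> a != c -> b != c -> regs s c = 0 ->
  exists n, exec (move_to a b c) s n (set_reg (set_reg s a (regs s a + regs s b)) b 0) /\
    n <= regs s b * 3 + 3.
Proof.
move=> /eqP ab /eqP ac /eqP bc c0.
pose I i := set_reg (set_reg s a (regs s a + i)) c i.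
have [||n [run_n le_n]] := @exec_for (Lt c b) (Seq (Do (Inc a)) (Do (Inc c))) I (regs s b) 2.
- by move=> i _; split=> //; rewrite /I /=; upd_cases.
- move=> i _; exists (1 + 1); split=> //.
  apply: exec_eq (Exec_seq (Exec_do _ _) (Exec_do _ _)) _.
  by apply: store_eq => j; rewrite /I /=; upd_cases.
exists (n + (1 + 1)); split; last by lia.
have -> : s = I 0 by rewrite /I /set_reg /=; case: s c0 {I run_n le_n} => f x w /= c0; apply: store_eq => j; upd_cases.
apply: Exec_seq run_n (exec_eq (Exec_seq (Exec_do _ _) (Exec_do _ _)) _).
by apply: store_eq => j; rewrite /I /=; upd_cases.
Qed.

(* [comp e r env] leaves the value of [e] in register [r], the variables of [e]
   being held in the registers [env]; it uses registers from [r] on as scratch. *)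
Definition comp_spec e d := forall M r env s,
  2 <= M -> size (inw s) < M -> all (fun i => i < r) env ->
  {in env, forall i, regs s i < M} -> (forall j, r <= j -> regs s j = 0) ->
  let v := eval (inw s) (map (regs s) env) e in
  exists n, [/\ exec (comp e r env) s n (set_reg s r v), n <= M ^ d & v < M ^ d].

Lemma regs_env (s : store) env r v : all (fun i => i < r) env ->
  map (regs (set_reg s r v)) env = map (regs s) env.
Proof.
move=> /allP env_r; apply/eq_in_map => i /env_r lt_i /=.
by upd_cases.
Qed.

Lemma all_ltnW r env : all (fun i => i < r) env -> all (fun i => i < r.+1) env.
Proof. by move=> /allP env_r; apply/allP => i /env_r /ltnW. Qed.

Lemma leq_expn M d e : 2 <= M -> d <= e -> M ^ d <= M ^ e.
Proof. by move=> lt1M; rewrite leq_exp2l. Qed.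

Lemma lt_expnl M n : 2 <= M -> n < M ^ n.
Proof. by move=> lt1M; apply: leq_trans (ltn_expl n (ltnSn 1)) _; case: n => // n; rewrite leq_exp2r. Qed.

Lemma comp_Var k : exists d, comp_spec (Var k) d.
Proof.
exists 2 => M r env s M2 szM env_r env_M s0 v /=; rewrite /v /=.
case: ltnP => [lt_k|le_k]; last first.
  exists 1; rewrite [nth 0 _ k]nth_default ?size_map //; split; [|by nia|by nia].
  exact: Exec_do.
rewrite (nth_map 0) //; set i := nth 0 env k.
have i_env : i \in env by rewrite mem_nth.
have lt_ir : i < r := allP env_r _ i_env.
have [||n [run_n le_n]] := @exec_for (Lt r i) (Do (Inc r)) (set_reg s r) (regs s i) 1.
- by move=> j _; split=> //=; upd_cases.
- move=> j _; exists 1; split=> //; apply: exec_eq (Exec_do _ _) _.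
  by apply: store_eq => h /=; upd_cases.
have lt_iM := env_M i i_env.
exists n; split; [|by nia|by nia].
apply: exec_eq (_ : exec _ _ _ _) erefl.
have {1}-> : s = set_reg s r 0 by case: s s0 {env_M i lt_iM run_n le_n i_env lt_ir v szM} => f x w /= s0; apply: store_eq => j; upd_cases; rewrite ?s0.
exact: run_n.
Qed.

Lemma comp_Const c : exists d, comp_spec (Const c) d.
Proof.
exists c.+1 => M r env s M2 szM env_r env_M s0 v /=; rewrite /v /=.
have ltc := lt_expnl c.+1 M2.
exists c.+1; split; [|exact: ltnW|exact: ltnW].
have -> : c.+1 = iter c (fun n => n + 1) 1 by elim: {v ltc}c => //= n <-; rewrite addn1.
elim: {v ltc}c => [|c IH] /=; first exact: Exec_do.
apply: exec_eq (Exec_seq IH (Exec_do _ _)) _.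
by apply: store_eq => j /=; upd_cases.
Qed.

Lemma comp_Size : exists d, comp_spec Size d.
Proof.
exists 2 => M r env s M2 szM env_r env_M s0 v /=; rewrite /v /=.
have [||n [run_n le_n]] := @exec_for (In r) (Do (Inc r)) (set_reg s r) (size (inw s)) 1.
- by move=> j _; split=> //=; rewrite bit_at_size; upd_cases.
- move=> j _; exists 1; split=> //; apply: exec_eq (Exec_do _ _) _.
  by apply: store_eq => h /=; upd_cases.
exists n; split; [|by nia|by nia].
have {1}-> : s = set_reg s r 0.
  case: s s0 {env_M run_n le_n v szM} => f x w /= s0; apply: store_eq => j; upd_cases.
  by rewrite s0.
exact: run_n.
Qed.

Lemma bit_atE x p : (bit_at x p == Some true) = nth false x p.
Proof.
rewrite /bit_at; have [lt_p|le_p] := ltnP p (size x).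
  by rewrite (nth_map false) //; case: nth.
by rewrite !nth_default ?size_map.
Qed.

Lemma comp_BitE e : (exists d, comp_spec e d) -> exists d, comp_spec (BitE e) d.
Proof.
move=> [d Hd]; exists (d + 2) => M r env s M2 szM env_r env_M s0 v.
have [n [run_n le_n lt_v]] := Hd M r env s M2 szM env_r env_M s0.
have M_gt0 : 0 < M ^ d by rewrite expn_gt0 (ltnW M2).
have M4 : 4 <= M ^ 2 by rewrite -[4]/(2 ^ 2) leq_exp2r.
set u := eval _ _ _ in run_n lt_v.
have def_v : v = nth false (inw s) u by [].
rewrite def_v.
exists (n + (1 + (if nth false (inw s) u then 1 + 1 else 1))); rewrite expnD.
split; [|by case: nth; nia|by case: nth; nia].
apply: Exec_seq run_n _; apply: Exec_if; rewrite /= bit_atE {1}/upd eqxx -/u.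
case: nth.
  apply: exec_eq (Exec_seq (Exec_do _ _) (Exec_do _ _)) _.
  by apply: store_eq => j /=; upd_cases.
apply: exec_eq (Exec_do _ _) _.
by apply: store_eq => j /=; upd_cases.
Qed.

Lemma comp_Add a b : (exists d, comp_spec a d) -> (exists d, comp_spec b d) ->
  exists d, comp_spec (Add a b) d.
Proof.
move=> [da Ha] [db Hb]; exists (da + db + 3) => M r env s M2 szM env_r env_M s0 v.
have [n [run_n le_n lt_u]] := Ha M r env s M2 szM env_r env_M s0.
set u := eval _ _ _ in run_n lt_u.
have [||n' [run_n' le_n' lt_u']] := Hb M r.+1 env (set_reg s r u) M2 szM (all_ltnW env_r).
- by move=> i i_env /=; have := allP env_r _ i_env; rewrite /=; upd_cases; move=> ?; apply: env_M.
- by move=> j lt_rj /=; upd_cases; rewrite s0; lia.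
rewrite (regs_env s u env_r) /= in run_n' lt_u'.
set u' := eval _ _ b in run_n' lt_u'.
have [||||n2 [run_n2 le_n2]] := @exec_move_to r r.+1 r.+2 (set_reg (set_reg s r u) r.+1 u'); try by lia.
  by rewrite /=; upd_cases; rewrite s0; lia.
exists (n + (n' + n2)); rewrite -[v]/(u + u'); split.
- apply: Exec_seq run_n (exec_eq (Exec_seq run_n' run_n2) _).
  by apply: store_eq => j /=; upd_cases; rewrite ?s0; lia.
- move: le_n2; rewrite /= {1}/upd eqxx => le_n2.
  have M8 : 8 <= M ^ 3 by rewrite -[8]/(2 ^ 3) leq_exp2r.
  rewrite !expnD; move: (M ^ da) (M ^ db) (M ^ 3) M8 le_n lt_u le_n' lt_u' le_n2 => A B C.
  clear; move=> *; apply: (@leq_trans (A * B * 8)); last by rewrite leq_mul2l; lia.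
  by nia.
- have M8 : 8 <= M ^ 3 by rewrite -[8]/(2 ^ 3) leq_exp2r.
  rewrite !expnD; move: (M ^ da) (M ^ db) (M ^ 3) M8 lt_u lt_u' => A B C.
  clear; move=> *; apply: (@leq_trans (A * B * 8)); last by rewrite leq_mul2l; lia.
  by nia.
Qed.

Lemma exec_if_do o a b s : exec (If o (Do a) (Do b)) s (1 + 1)
  (if test_op o s then do_op a (do_op o s) else do_op b (do_op o s)).
Proof. by apply: Exec_if; case: ifP => _; apply: Exec_do. Qed.

Lemma comp_Leq a b : (exists d, comp_spec a d) -> (exists d, comp_spec b d) ->
  exists d, comp_spec (Leq a b) d.
Proof.
move=> [da Ha] [db Hb]; exists (da + db + 3) => M r env s M2 szM env_r env_M s0 v.
have [|n [run_n le_n lt_u]] := Ha M r.+1 env s M2 szM (all_ltnW env_r) env_M.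
  by move=> j lt_rj; apply: s0; lia.
set u := eval _ _ _ in run_n lt_u.
have [||n' [run_n' le_n' lt_u']] := Hb M r.+2 env (set_reg s r.+1 u) M2 szM (all_ltnW (all_ltnW env_r)).
- by move=> i i_env /=; have := allP env_r _ i_env; rewrite /=; upd_cases; move=> ?; apply: env_M.
- by move=> j lt_rj /=; upd_cases; rewrite s0; lia.
rewrite (regs_env s u (all_ltnW env_r)) /= in run_n' lt_u'.
set u' := eval _ _ b in run_n' lt_u'.
have M8 : 8 <= M ^ 3 by rewrite -[8]/(2 ^ 3) leq_exp2r.
exists ((n + n') + ((1 + 1) + (1 + 1))); rewrite -[v]/(u <= u' : nat); split.
- apply: Exec_seq (Exec_seq run_n run_n') _.
  apply: exec_eq (Exec_seq (exec_if_do _ _ _ _) (Exec_seq (Exec_do _ _) (Exec_do _ _))) _.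
  rewrite /=; have -> : upd (upd (regs s) r.+1 u) r.+2 u' r.+2 = u' by upd_cases.
  have -> : upd (upd (regs s) r.+1 u) r.+2 u' r.+1 = u by upd_cases.
  by case: ltnP => _ /=; apply: store_eq => j /=; upd_cases; rewrite ?s0; lia.
- rewrite !expnD; move: (M ^ da) (M ^ db) (M ^ 3) M8 le_n lt_u le_n' lt_u' => A B C.
  clear; move=> *; apply: (@leq_trans (A * B * 8)); last by rewrite leq_mul2l; lia.
  by nia.
- rewrite !expnD; move: (M ^ da) (M ^ db) (M ^ 3) M8 lt_u lt_u' => A B C.
  clear; move=> *; apply: (@leq_trans (A * B * 8)); last by rewrite leq_mul2l; lia.
  by case: leqP; nia.
Qed.

Lemma loop_cost A B C n n2 u : 16 <= C -> 0 < B -> n <= A -> u < A ->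
  n2 <= u * (4 * B + 4).+1 + 1 -> n + (n2 + (1 + 1)) <= A * B * C.
Proof.
move=> leC B_gt0 le_n lt_u le_n2; apply: (@leq_trans (A * B * 16)); last by rewrite leq_mul2l; lia.
by nia.
Qed.

Lemma comp_Sum a b : (exists d, comp_spec a d) -> (exists d, comp_spec b d) ->
  exists d, comp_spec (Sum a b) d.
Proof.
(* There are fewer than [M ^ da] rounds, and the body sees an index of that size, so it is analysed
   with [M ^ da.+1] in place of [M]; the successor keeps this at least [M] even for [da = 0]. The
   final 4 absorbs the overhead of the loop. *)
move=> [da Ha] [db Hb]; exists (da + da.+1 * db + 4) => M r env s M2 szM env_r env_M s0 v.
have [|n [run_n le_n lt_u]] := Ha M r.+1 env s M2 szM (all_ltnW env_r) env_M.
  by move=> j lt_rj; apply: s0; lia.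
set u := eval _ _ _ in run_n lt_u.
pose w i := eval (inw s) (i :: map (regs s) env) b.
have def_v : v = \sum_(i < u) w i by [].
pose I i := set_reg (set_reg (set_reg s r (\sum_(j < i) w j)) r.+1 u) r.+2 i.
pose B := (M ^ da.+1) ^ db.
have le_M : M <= M ^ da.+1 by rewrite -{1}[M]expn1 leq_expn.
have body i : i < u -> exists n', [/\ exec
    (Seq (comp b r.+3 (r.+2 :: env)) (Seq (move_to r r.+3 r.+4) (Do (Inc r.+2))))
    (I i) n' (I i.+1), n' <= 4 * B + 4 & w i < B].
  move=> lt_iu.
  have [|||||n' [run_n' le_n' lt_w]] := Hb (M ^ da.+1) r.+3 (r.+2 :: env) (I i).
  - exact: leq_trans M2 le_M.
  - exact: leq_trans szM le_M.
  - by rewrite /= ltnSn; do 3!apply: all_ltnW.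
  - move=> j; rewrite inE => /orP[/eqP->|j_env].
      rewrite /= {1}/upd eqxx expnS; nia.
    have := allP env_r _ j_env; rewrite /=; upd_cases; move=> _; apply: leq_trans le_M.
    exact: env_M.
  - by move=> j lt_rj /=; upd_cases; rewrite s0; lia.
  have eq_w : eval (inw (I i)) (map (regs (I i)) (r.+2 :: env)) b = w i.
    rewrite /w /= {1}/upd eqxx; congr eval; congr cons.
    apply/eq_in_map => j /(allP env_r); rewrite /=; upd_cases.
  rewrite eq_w in run_n' lt_w.
  have [||||n2 [run_n2 le_n2]] := @exec_move_to r r.+3 r.+4 (set_reg (I i) r.+3 (w i)); try by lia.
    by rewrite /=; upd_cases; rewrite s0; lia.
  exists (n' + (n2 + 1)); split=> //.
    apply: exec_eq (Exec_seq run_n' (Exec_seq run_n2 (Exec_do _ _))) _.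
    by apply: store_eq => j /=; rewrite big_ord_recr /=; upd_cases; rewrite ?s0; lia.
  by move: le_n2; rewrite /= {1}/upd eqxx -/B in le_n' lt_w *; move=> le_n2; lia.
have [|n2 [run_n2 le_n2]] := @exec_for (Lt r.+2 r.+1) _ I u (4 * B + 4) _ (fun i lt_i =>
    let: ex_intro n' (And3 h1 h2 _) := body i lt_i in ex_intro _ n' (conj h1 h2)).
  by move=> i _; split=> //=; rewrite /upd /= eqxx; upd_cases.
have M16 : 16 <= M ^ 4 by rewrite -[16]/(2 ^ 4) leq_exp2r.
have B_gt0 : 0 < B by rewrite !expn_gt0; lia.
have eqMB : M ^ (da + da.+1 * db + 4) = M ^ da * B * M ^ 4 by rewrite /B -expnM -!expnD.
exists (n + (n2 + (1 + 1))); rewrite def_v eqMB; split.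
- have I0 : set_reg s r.+1 u = I 0.
    by apply: store_eq => j; rewrite /I /= big_ord0; upd_cases; rewrite ?s0; lia.
  rewrite I0 in run_n.
  apply: exec_eq (Exec_seq run_n (Exec_seq run_n2 (Exec_seq (Exec_do _ _) (Exec_do _ _)))) _.
  by apply: store_eq => j /=; upd_cases; rewrite ?s0; lia.
- exact: loop_cost le_n2.
- have : \sum_(i < u) w i <= \sum_(i < u) B.
    by apply: leq_sum => i _; have [n' [_ _ /ltnW]] := body i (ltn_ord i).
  rewrite sum_nat_const card_ord => le_sum.
  apply: (leq_ltn_trans le_sum); apply: leq_trans (leq_pmulr _ (ltnW (ltnW _))); last by lia.
  by rewrite ltn_mul2r B_gt0.
Qed.

Lemma comp_ok e : exists d, comp_spec e d.
Proof.
elim: e => [k|c||e IH|a IHa b IHb|a IHa b IHb|a IHa b IHb].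
- exact: comp_Var.
- exact: comp_Const.
- exact: comp_Size.
- exact: comp_BitE.
- exact: comp_Add.
- exact: comp_Leq.
- exact: comp_Sum.
Qed.

(** * Expressions for words *)

Inductive wexpr := WBit of expr | WCat of wexpr & wexpr | WFor of expr & wexpr.

Fixpoint wval (x : word) (env : seq nat) (e : wexpr) : word :=
  match e with
  | WBit e => [:: 0 < eval x env e]
  | WCat a b => wval x env a ++ wval x env b
  | WFor a b => flatten [seq wval x (i :: env) b | i <- iota 0 (eval x env a)]
  end.

Fixpoint wcomp (e : wexpr) (r : nat) (env : seq nat) : cmd :=
  match e with
  | WBit e => Seq (comp e r env) (Seq (If (Lt r.+1 r) (Do (Emit true)) (Do (Emit false))) (Do (Clr r)))
  | WCat a b => Seq (wcomp a r env) (wcomp b r env)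
  | WFor a b =>
      Seq (comp a r env)
        (Seq (While (Lt r.+1 r) (Seq (wcomp b r.+2 (r.+1 :: env)) (Do (Inc r.+1))))
             (Seq (Do (Clr r)) (Do (Clr r.+1))))
  end.

Definition wcomp_spec e d := forall M r env s,
  2 <= M -> size (inw s) < M -> all (fun i => i < r) env ->
  {in env, forall i, regs s i < M} -> (forall j, r <= j -> regs s j = 0) ->
  exists n, exec (wcomp e r env) s n
    (Store (regs s) (inw s) (outw s ++ wval (inw s) (map (regs s) env) e)) /\ n <= M ^ d.

Lemma wcomp_ok e : exists d, wcomp_spec e d.
Proof.
elim: e => [e|a [da Ha] b [db Hb]|a b [db Hb]].
- have [d Hd] := comp_ok e.
  exists (d + 2) => M r env s M2 szM env_r env_M s0.
  have [n [run_n le_n lt_u]] := Hd M r env s M2 szM env_r env_M s0.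
  set u := eval _ _ _ in run_n lt_u.
  exists (n + ((1 + 1) + 1)); split; last first.
    have M4 : 4 <= M ^ 2 by rewrite -[4]/(2 ^ 2) leq_exp2r.
    by rewrite expnD; nia.
  apply: exec_eq (Exec_seq run_n (Exec_seq (exec_if_do _ _ _ _) (Exec_do _ _))) _.
  rewrite /=; have -> : upd (regs s) r u r.+1 = 0 by upd_cases; rewrite ?s0; lia.
  rewrite {1}/upd eqxx -/u; case: ifP => _ /=; rewrite cats1;
    by apply: store_eq => j /=; upd_cases; rewrite ?s0; lia.
- exists (da + db + 1) => M r env s M2 szM env_r env_M s0.
  have [n [run_n le_n]] := Ha M r env s M2 szM env_r env_M s0.
  have [n' [run_n' le_n']] := Hb M r env (Store (regs s) (inw s)
    (outw s ++ wval (inw s) (map (regs s) env) a)) M2 szM env_r env_M s0.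
  exists (n + n'); split.
    by apply: exec_eq (Exec_seq run_n run_n') _; rewrite /= catA.
  have : 0 < M ^ da by rewrite expn_gt0; lia.
  have : 0 < M ^ db by rewrite expn_gt0; lia.
  rewrite !expnD expn1; move: (M ^ da) (M ^ db) le_n le_n' => A B ? ? ? ?.
  by apply: (@leq_trans (A * B * 2)); [nia | rewrite leq_mul2l; lia].
have [da Ha] := comp_ok a.
exists (da + da.+1 * db + 4) => M r env s M2 szM env_r env_M s0.
have [n [run_n le_n lt_u]] := Ha M r env s M2 szM env_r env_M s0.
set u := eval _ _ _ in run_n lt_u.
pose w i := wval (inw s) (i :: map (regs s) env) b.
pose I i := Store (upd (upd (regs s) r u) r.+1 i) (inw s) (outw s ++ flatten [seq w j | j <- iota 0 i]).
pose B := (M ^ da.+1) ^ db.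
have le_M : M <= M ^ da.+1 by rewrite -{1}[M]expn1 leq_expn.
have body i : i < u -> exists n',
    exec (Seq (wcomp b r.+2 (r.+1 :: env)) (Do (Inc r.+1))) (I i) n' (I i.+1) /\ n' <= 4 * B + 4.
  move=> lt_iu.
  have [|||||n' [run_n' le_n']] := Hb (M ^ da.+1) r.+2 (r.+1 :: env) (I i).
  - exact: leq_trans M2 le_M.
  - exact: leq_trans szM le_M.
  - by rewrite /= ltnSn; do 2!apply: all_ltnW.
  - move=> j; rewrite inE => /orP[/eqP->|j_env].
      rewrite /= {1}/upd eqxx expnS; nia.
    have := allP env_r _ j_env; rewrite /=; upd_cases; move=> _; apply: leq_trans le_M.
    exact: env_M.
  - by move=> j lt_rj /=; upd_cases; rewrite s0; lia.
  have eq_w : wval (inw (I i)) (map (regs (I i)) (r.+1 :: env)) b = w i.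
    rewrite /w /= {1}/upd eqxx; congr wval; congr cons.
    apply/eq_in_map => j /(allP env_r); rewrite /=; upd_cases.
  rewrite eq_w in run_n'.
  exists (n' + 1); split; last by rewrite -/B in le_n'; lia.
  apply: exec_eq (Exec_seq run_n' (Exec_do _ _)) _.
  have eq_out : flatten [seq w j | j <- iota 0 i.+1] = flatten [seq w j | j <- iota 0 i] ++ w i.
    by rewrite -[in LHS]addn1 iotaD map_cat flatten_cat /= cats0.
  rewrite /I eq_out catA /set_reg /=.
  by apply: store_eq => j; upd_cases.
have [|n2 [run_n2 le_n2]] := @exec_for (Lt r.+1 r) _ I u (4 * B + 4) _ body.
  by move=> i _; split=> //=; upd_cases.
exists (n + (n2 + (1 + 1))); split.
  have I0 : set_reg s r u = I 0.
    by rewrite /I /set_reg /= cats0; apply: store_eq => j; upd_cases; rewrite ?s0; lia.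
  rewrite I0 in run_n.
  apply: exec_eq (Exec_seq run_n (Exec_seq run_n2 (Exec_seq (Exec_do _ _) (Exec_do _ _)))) _.
  by apply: store_eq => j /=; upd_cases; rewrite ?s0; lia.
have M16 : 16 <= M ^ 4 by rewrite -[16]/(2 ^ 4) leq_exp2r.
have B_gt0 : 0 < B by rewrite !expn_gt0; lia.
have -> : M ^ (da + da.+1 * db + 4) = M ^ da * B * M ^ 4 by rewrite /B -expnM -!expnD.
exact: loop_cost le_n2.
Qed.

Lemma polytime_wval e : polytime (fun x => wval x [::] e).
Proof.
have [d Hd] := wcomp_ok e.
apply: (@polytime_cmd _ (wcomp e 0 [::]) d) => x.
have [|||||n [run_n le_n]] := Hd (size x + 2) 0 [::] (store0 x) => //=; try by lia.
by exists n; eexists; split; [exact: run_n| |].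
Qed.

(* A view extracts the input word and the values of the variables from a
   context [C]; [df v f] says that [f] is given by an expression. *)
Definition view C := C -> word * seq nat.

Definition ext C (v : view C) : view (C * nat) :=
  fun c => ((v c.1).1, c.2 :: (v c.1).2).

Definition df C (v : view C) (f : C -> nat) :=
  exists e, forall c, f c = eval (v c).1 (v c).2 e.

Definition dfb C (v : view C) (p : C -> bool) := df v (fun c => p c : nat).

Fixpoint lift k (e : expr) : expr :=
  match e with
  | Var i => Var (if i < k then i else i.+1)
  | Const n => Const n
  | Size => Size
  | BitE e => BitE (lift k e)
  | Add a b => Add (lift k a) (lift k b)
  | Leq a b => Leq (lift k a) (lift k b)
  | Sum a b => Sum (lift k a) (lift k.+1 b)
  end.

Lemma eval_lift x e1 j e2 e : eval x (e1 ++ j :: e2) (lift (size e1) e) = eval x (e1 ++ e2) e.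
Proof.
elim: e e1 => [i|n||e IH|a IHa b IHb|a IHa b IHb|a IHa b IHb] e1 //=.
- rewrite !nth_cat; case: (ltnP i (size e1)) => [->//|le_i].
  by rewrite ltnNge leqW //= subSn.
- by rewrite IH.
- by rewrite IHa IHb.
- by rewrite IHa IHb.
- by rewrite IHa; apply: eq_bigr => i _; rewrite (IHb (val i :: e1)).
Qed.

(** * Closure properties of definable functions *)

Section Definable.
Variables (C : Type) (v : view C).
Implicit Types f g : C -> nat.

Lemma df_ext f g : f =1 g -> df v f -> df v g.
Proof. by move=> eq_fg [e He]; exists e => c; rewrite -eq_fg. Qed.

Lemma df_const n : df v (fun _ => n).
Proof. by exists (Const n). Qed.

Lemma df_size : df v (fun c => size (v c).1).
Proof. by exists Size. Qed.

Lemma df_bit f : df v f -> dfb v (fun c => nth false (v c).1 (f c)).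
Proof. by move=> [e He]; exists (BitE e) => c; rewrite /= He. Qed.

Lemma df_add f g : df v f -> df v g -> df v (fun c => f c + g c).
Proof. by move=> [e He] [e' He']; exists (Add e e') => c; rewrite /= He He'. Qed.

Lemma df_succ f : df v f -> df v (fun c => (f c).+1).
Proof. by move=> Hf; apply: (@df_ext (fun c => f c + 1)) => [c|]; [rewrite addn1|apply: df_add => //; apply: df_const]. Qed.

Lemma df_leq f g : df v f -> df v g -> dfb v (fun c => f c <= g c).
Proof. by move=> [e He] [e' He']; exists (Leq e e') => c; rewrite /= He He'. Qed.

Lemma df_sum f (g : C -> nat -> nat) : df v f -> df (ext v) (fun c => g c.1 c.2) ->
  df v (fun c => \sum_(0 <= i < f c) g c i).
Proof.
move=> [e He] [e' He']; exists (Sum e e') => c; rewrite /= -He big_mkord.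
by apply: eq_bigr => i _; rewrite (He' (c, val i)).
Qed.

Lemma df_var : df (ext v) (fun c => c.2).
Proof. by exists (Var 0). Qed.

Lemma df_weak f : df v f -> df (ext v) (fun c => f c.1).
Proof. by move=> [e He]; exists (lift 0 e) => c; rewrite (eval_lift _ [::]) /= He. Qed.

End Definable.

Section DefinableOps.
Variables (C : Type) (v : view C).
Implicit Types f g : C -> nat.
Implicit Types p q : C -> bool.

Lemma df_mul f g : df v f -> df v g -> df v (fun c => f c * g c).
Proof.
move=> Hf Hg; apply: (@df_ext _ _ (fun c => \sum_(0 <= i < f c) g c)).
  by move=> c; rewrite big_mkord sum_nat_const card_ord.
by apply: df_sum => //; apply: df_weak.
Qed.

Lemma dfb_const b : dfb v (fun _ => b).
Proof. exact: df_const. Qed.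

Lemma df_ltn f g : df v f -> df v g -> dfb v (fun c => f c < g c).
Proof. by move=> Hf Hg; apply: df_leq => //; apply: df_succ. Qed.

Lemma dfb_and p q : dfb v p -> dfb v q -> dfb v (fun c => p c && q c).
Proof.
move=> Hp Hq; apply: (@df_ext _ _ (fun c => p c * q c)); last exact: df_mul.
by move=> c; rewrite mulnb.
Qed.

Lemma dfb_not p : dfb v p -> dfb v (fun c => ~~ p c).
Proof.
move=> Hp; apply: (@df_ext _ _ (fun c => (p c : nat) <= 0)); last by apply: df_leq => //; apply: df_const.
by move=> c; case: (p c).
Qed.

Lemma dfb_or p q : dfb v p -> dfb v q -> dfb v (fun c => p c || q c).
Proof.
move=> Hp Hq; apply: (@df_ext _ _ (fun c => ~~ (~~ p c && ~~ q c))).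
  by move=> c; rewrite negb_and !negbK.
by apply: dfb_not; apply: dfb_and; apply: dfb_not.
Qed.

Lemma dfb_imp p q : dfb v p -> dfb v q -> dfb v (fun c => p c ==> q c).
Proof.
move=> Hp Hq; apply: (@df_ext _ _ (fun c => ~~ p c || q c)).
  by move=> c; rewrite implybE.
by apply: dfb_or => //; apply: dfb_not.
Qed.

Lemma df_eq f g : df v f -> df v g -> dfb v (fun c => f c == g c).
Proof.
move=> Hf Hg; apply: (@df_ext _ _ (fun c => (f c <= g c) && (g c <= f c))).
  by move=> c; rewrite -eqn_leq.
by apply: dfb_and; apply: df_leq.
Qed.

Lemma df_if p f g : dfb v p -> df v f -> df v g -> df v (fun c => if p c then f c else g c).
Proof.
move=> Hp Hf Hg; apply: (@df_ext _ _ (fun c => p c * f c + ~~ p c * g c)).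
  by move=> c; case: (p c); rewrite ?mul1n ?mul0n ?addn0.
by apply: df_add; apply: df_mul => //; apply: dfb_not.
Qed.

Lemma dfb_if p q1 q2 : dfb v p -> dfb v q1 -> dfb v q2 ->
  dfb v (fun c => if p c then q1 c else q2 c).
Proof.
move=> Hp H1 H2; apply: (@df_ext _ _ (fun c => if p c then q1 c : nat else q2 c)).
  by move=> c; case: (p c).
exact: df_if.
Qed.

Lemma dfb_eqb p q : dfb v p -> dfb v q -> dfb v (fun c => p c == q c).
Proof.
move=> Hp Hq; apply: (@df_ext _ _ (fun c => (p c : nat) == q c)); last exact: df_eq.
by move=> c; case: (p c); case: (q c).
Qed.

Lemma dfb_has f (p : C -> nat -> bool) : df v f -> dfb (ext v) (fun c => p c.1 c.2) ->
  dfb v (fun c => has (p c) (iota 0 (f c))).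
Proof.
move=> Hf Hp; apply: (@df_ext _ _ (fun c => 0 < \sum_(0 <= i < f c) p c i)).
  move=> c; congr nat_of_bool; rewrite big_mkord lt0n sum_nat_eq0.
  apply/forallPn/hasP => [[i]|[i]].
    by rewrite /= eqb0 negbK => pi; exists (val i) => //; rewrite mem_iota /=.
  rewrite mem_iota /= => lt_i pi; exists (Ordinal lt_i).
  by rewrite /= eqb0 negbK.
by apply: df_ltn; [apply: df_const|apply: df_sum].
Qed.

End DefinableOps.

Section DefinableMore.
Variables (C : Type) (v : view C).
Implicit Types f g : C -> nat.

Lemma dfb_all f (p : C -> nat -> bool) : df v f -> dfb (ext v) (fun c => p c.1 c.2) ->
  dfb v (fun c => all (p c) (iota 0 (f c))).
Proof.
move=> Hf Hp; apply: (@df_ext _ _ (fun c => ~~ has (fun i => ~~ p c i) (iota 0 (f c)))).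
  by move=> c; rewrite -all_predC; congr nat_of_bool; apply: eq_all => i; rewrite /= negbK.
by apply: dfb_not; apply: dfb_has => //=; apply: dfb_not.
Qed.

Lemma dfb_has_seq (T : Type) (s : seq T) (p : T -> C -> bool) :
  (forall t, dfb v (p t)) -> dfb v (fun c => has (p^~ c) s).
Proof.
move=> Hp; elim: s => [|t s IH] /=; first exact: dfb_const.
exact: dfb_or.
Qed.

Lemma df_sub f g : df v f -> df v g -> df v (fun c => f c - g c).
Proof.
move=> Hf Hg; apply: (@df_ext _ _ (fun c => \sum_(0 <= i < f c) (g c <= i))).
  move=> c; rewrite big_mkord; elim: (f c) => [|n IH]; first by rewrite big_ord0.
  by rewrite big_ord_recr /= IH; case: leqP; lia.
by apply: df_sum => //; apply: df_leq; [apply: df_weak|apply: df_var].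
Qed.

Lemma sum_lt_id n q : q <= n -> \sum_(i < n) (i < q) = q.
Proof.
elim: n => [|n IH]; first by rewrite leqn0 big_ord0 => /eqP.
move=> le_q; rewrite big_ord_recr /=; case: (ltnP n q) => [lt_nq|le_qn]; last by rewrite IH // addn0.
have -> : q = n.+1 by lia.
have -> : \sum_(i < n) (i < n.+1) = \sum_(i < n) 1.
  by apply: eq_bigr => i _; rewrite ltnS ltnW.
by rewrite sum1_card card_ord addn1.
Qed.

(** The quotient counts the positive multiples of the divisor up to [f c]. For divisor 0 this count
    would be [f c], and the factor [0 < g c] turns it into 0. *)
Lemma df_div f g : df v f -> df v g -> df v (fun c => f c %/ g c).
Proof.
move=> Hf Hg; apply: (@df_ext _ _ (fun c => (0 < g c) * \sum_(0 <= i < f c) (i.+1 * g c <= f c))).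
  move=> c; rewrite big_mkord; case: (posnP (g c)) => [->|g0]; first by rewrite divn0.
  rewrite mul1n; under eq_bigr => i _ do rewrite -leq_divRL //.
  by rewrite sum_lt_id ?leq_div.
apply: df_mul; first by apply: df_ltn => //; apply: df_const.
apply: df_sum => //; apply: df_leq; last exact: df_weak.
by apply: df_mul; [apply: df_succ; apply: df_var|apply: df_weak].
Qed.

Lemma df_mod f g : df v f -> df v g -> df v (fun c => f c %% g c).
Proof.
move=> Hf Hg; apply: (@df_ext _ _ (fun c => f c - f c %/ g c * g c)).
  by move=> c; rewrite {1}(divn_eq (f c) (g c)) addKn.
by apply: df_sub => //; apply: df_mul => //; apply: df_div.
Qed.

Lemma df_odd f : df v f -> dfb v (fun c => odd (f c)).
Proof.
move=> Hf; apply: (@df_ext _ _ (fun c => f c %% 2)); last by apply: df_mod => //; apply: df_const.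
by move=> c; rewrite modn2.
Qed.

Lemma df_horner (p : {poly nat}) f : df v f -> df v (fun c => p.[f c]%R).
Proof.
move=> Hf; rewrite /horner; elim: (polyseq p) => [|a s IH] /=; first exact: df_const.
by apply: df_add; [apply: df_mul|apply: df_const].
Qed.

End DefinableMore.

Definition dfw C (v : view C) (w : C -> word) :=
  exists e, forall c, w c = wval (v c).1 (v c).2 e.

Section DefinableWords.
Variables (C : Type) (v : view C).

Lemma dfw_ext (w w' : C -> word) : w =1 w' -> dfw v w -> dfw v w'.
Proof. by move=> eqw [e He]; exists e => c; rewrite -eqw. Qed.

Lemma dfw_bit p : dfb v p -> dfw v (fun c => [:: p c]).
Proof. by move=> [e He]; exists (WBit e) => c; rewrite /= -He; case: (p c). Qed.

Lemma dfw_cat w w' : dfw v w -> dfw v w' -> dfw v (fun c => w c ++ w' c).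
Proof. by move=> [e He] [e' He']; exists (WCat e e') => c; rewrite /= He He'. Qed.

Lemma dfw_for f (w : C -> nat -> word) : df v f -> dfw (ext v) (fun c => w c.1 c.2) ->
  dfw v (fun c => flatten [seq w c i | i <- iota 0 (f c)]).
Proof.
move=> [e He] [e' He']; exists (WFor e e') => c; rewrite /= -He.
by congr flatten; apply: eq_map => i; rewrite (He' (c, i)).
Qed.

End DefinableWords.

Lemma dfw_map C (v : view C) f (p : C -> nat -> bool) : df v f -> dfb (ext v) (fun c => p c.1 c.2) ->
  dfw v (fun c => [seq p c i | i <- iota 0 (f c)]).
Proof.
move=> Hf Hp; apply: (@dfw_ext _ _ (fun c => flatten [seq [:: p c i] | i <- iota 0 (f c)])).
  by move=> c; elim: (iota _ _) => //= i s ->.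
by apply: dfw_for => //; apply: dfw_bit.
Qed.

Definition input_view : view word := fun x => (x, [::]).

Lemma polytime_dfw f : dfw input_view f -> polytime f.
Proof. by move=> [e He]; have := polytime_wval e; congr polytime; apply: funext => x; rewrite He. Qed.

(* Powers of two in bounded arithmetic, where exponentiation is not available. *)
Definition is_pow2 j := (0 < j) && all (fun d => (1 < d) ==> (j %% d == 0) ==> ~~ odd d) (iota 0 j.+1).

Lemma is_pow2P j : reflect (exists i, j = 2 ^ i) (is_pow2 j).
Proof.
apply: (iffP andP) => [[j_gt0 /allP odd_div]|[i ->]].
  exists (logn 2 j); rewrite -{1}(partnC 2 j_gt0) p_part.
  have m_odd : odd j`_2^' by rewrite odd_2'nat part_pnat.
  have m_dvd : j`_2^' %| j by apply: dvdn_part.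
  have := odd_div j`_2^'; rewrite mem_iota /= add0n ltnS (dvdn_leq j_gt0 m_dvd) => /(_ isT).
  rewrite -/(j`_2^' %| j) m_dvd m_odd /= implybF -leqNgt.
  by move: m_odd; case: (j`_2^') => [|[|m]] // _ _; rewrite muln1.
split; first by rewrite expn_gt0.
apply/allP => d _; apply/implyP => d_gt1; apply/implyP => d_dvd.
have /(dvdn_pfactor _ _ (isT : prime 2))[k _ def_d] : d %| 2 ^ i by [].
by rewrite def_d oddX orbF -lt0n; case: k def_d d_gt1 => // ->.
Qed.

Lemma up_log_leq n i : (up_log 2 n <= i) = (n <= 2 ^ i).
Proof.
apply/idP/idP => [le_i|]; last exact: up_log_min.
by apply: leq_trans (@up_logP 2 n isT) _; rewrite leq_exp2l.
Qed.

Lemma up_log_pow2S k : up_log 2 (2 ^ k).+1 = k.+1.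
Proof.
apply: up_log_eq => //.
by rewrite ltnSn expnS mul2n -addnn -addn1 leq_add2l expn_gt0.
Qed.

(** The rounded logarithm increases by one exactly behind a power of two, so it counts them and
    becomes a bounded sum. *)
Lemma up_log_count j : up_log 2 j.+1 = \sum_(0 <= i < j.+1) is_pow2 i.
Proof.
elim: j => [|j IH]; first by rewrite big_nat1.
rewrite big_nat_recr //= -IH; case: is_pow2P => [[k ->]|npow].
  by rewrite up_expnK // addn1 up_log_pow2S.
rewrite addn0; apply/eqP; rewrite eqn_leq [X in _ && X]leq_up_log // andbT up_log_leq.
rewrite ltn_neqAle -up_log_leq leqnn andbT; apply/eqP => def_j.
by apply: npow; exists (up_log 2 j.+1).
Qed.

Section DefinableDigits.
Variables (C : Type) (v : view C).
Implicit Types f g : C -> nat.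

Lemma dfb_pow2 f : df v f -> dfb v (fun c => is_pow2 (f c)).
Proof.
move=> Hf; apply: dfb_and; first by apply: df_ltn => //; apply: df_const.
apply: (@dfb_all _ _ (fun c => (f c).+1)); first exact: df_succ.
apply: dfb_imp; first by apply: df_ltn; [apply: df_const|apply: df_var].
apply: dfb_imp; last by apply: dfb_not; apply: df_odd; apply: df_var.
apply: df_eq; last exact: df_const.
by apply: df_mod; [apply: df_weak|apply: df_var].
Qed.

End DefinableDigits.

Lemma df_up_log C (v : view C) f : df v f -> df v (fun c => up_log 2 (f c).+1).
Proof.
move=> Hf; apply: (@df_ext _ _ (fun c => \sum_(0 <= i < (f c).+1) is_pow2 i)).
  by move=> c; rewrite up_log_count.
apply: (@df_sum _ _ (fun c => (f c).+1)); first exact: df_succ.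
by apply: dfb_pow2; apply: df_var.
Qed.

(** The power itself may be exponential in the input; only its exponent is compared. *)
Lemma dfb_lt_exp2 C (v : view C) f g : df v f -> df v g -> dfb v (fun c => f c < 2 ^ g c).
Proof.
move=> Hf Hg; apply: (@df_ext _ _ (fun c => up_log 2 (f c).+1 <= g c)).
  by move=> c; rewrite up_log_leq.
by apply: df_leq => //; apply: df_up_log.
Qed.

(** The power [2 ^ g c] is searched among the numbers up to [f c] and recognised by its logarithm.
    If it is larger, the search fails, and the digit is indeed 0. *)
Lemma dfb_digit C (v : view C) f g : df v f -> df v g -> dfb v (fun c => odd (f c %/ 2 ^ g c)).
Proof.
move=> Hf Hg; apply: (@df_ext _ _ (fun c =>
    has (fun q => [&& is_pow2 q, up_log 2 q.+1 == (g c).+1 & odd (f c %/ q)]) (iota 0 (f c).+1))).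
  move=> c; congr nat_of_bool.
  apply/hasP/idP => [[q _ /and3P[/is_pow2P[k ->]]]|odd_fg].
    by rewrite up_log_pow2S => /eqP[->].
  exists (2 ^ g c); last by rewrite up_log_pow2S eqxx odd_fg !andbT; apply/is_pow2P; exists (g c).
  rewrite mem_iota /= add0n ltnS leqNgt; apply/negP => lt_f.
  by rewrite (divn_small lt_f) in odd_fg.
apply: (@dfb_has _ _ (fun c => (f c).+1)); first exact: df_succ.
apply: dfb_and; first by apply: dfb_pow2; apply: df_var.
apply: dfb_and.
  by apply: df_eq; [apply: df_up_log; apply: df_var|apply: df_succ; apply: df_weak].
by apply: df_odd; apply: df_div; [apply: df_weak|apply: df_var].
Qed.


(** * Membership in NP *)

Lemma nth_flatten_const (T S : Type) (d : T) (s : seq S) (F : S -> seq T) N u v x0 :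
  (forall x, size (F x) = N) -> u < size s -> v < N ->
  nth d (flatten [seq F x | x <- s]) (u * N + v) = nth d (F (nth x0 s u)) v.
Proof.
move=> sizeF; elim: s u => //= a s IH [|u] lt_u lt_v; rewrite nth_cat sizeF.
  by rewrite mul0n lt_v.
by rewrite mulSn -addnA ltnNge leq_addr /= addKn IH.
Qed.

(** The length of the leading block of ones: the unary order at the start of an instance. *)
Definition order_bits n (b : nat -> bool) := \sum_(0 <= i < n) all b (iota 0 i.+1).

Lemma order_bits_lead n (b : nat -> bool) N : N <= n -> (forall i, i < N -> b i) -> b N = false ->
  order_bits n b = N.
Proof.
move=> le_N b_true b_false; rewrite -(@sum_lt_id n N) // /order_bits big_mkord.
apply: eq_bigr => i _; congr nat_of_bool; apply/allP/idP => [all_b|lt_i j].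
  rewrite ltnNge; apply/negP => le_Ni; have := all_b N.
  by rewrite b_false mem_iota /= ltnS => /(_ le_Ni).
by rewrite mem_iota /= ltnS => le_j; apply: b_true; apply: leq_ltn_trans lt_i.
Qed.

Lemma leq_order_bits n b : order_bits n b <= n.
Proof.
rewrite /order_bits big_mkord -[leqRHS]card_ord -sum1_card.
by apply: leq_sum => i _; apply: leq_b1.
Qed.

Section Bits.
Variables (n : nat) (b : nat -> bool).
Let N := order_bits n b.

(** The offsets follow the layout of [instance_word]: order and separator take [N.+1] bits, then
    come the matrix, the sign and the digits of the threshold. Digits read beyond the end of the
    word are 0. *)
Definition adj_bits u v := b (N.+1 + (u * N + v)).
Definition sign_bits := b (N.+1 + N * N).
Definition value_bits := \sum_(0 <= i < n) b (N.+2 + N * N + i) * 2 ^ i.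

Definition chromatic_bits (c : nat -> nat) :=
  [/\ forall v, v < N -> 0 < c v,
      forall u v, u < N -> v < N -> adj_bits u v -> c u <> c v &
      ~~ sign_bits && (\sum_(0 <= v < N) c v <= value_bits)].

(* Replace every colour by its rank among the colours used. *)
Lemma compress_colouring c : chromatic_bits c ->
  exists2 c', chromatic_bits c' & forall v, v < N -> c' v <= N.
Proof.
move=> [c_gt0 c_adj /andP[sg le_c]].
pose S m := undup [seq x <- [seq c u | u <- iota 0 N] | x <= m].
have S_uniq m : uniq (S m) by apply: undup_uniq.
have mem_S m v : v < N -> (c v \in S m) = (c v <= m).
  move=> lt_v; rewrite mem_undup mem_filter; case: leqP => //= _.
  by apply/mapP; exists v; rewrite ?mem_iota.
have S_sub m k : m <= k -> {subset S m <= S k}.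
  move=> le_mk x; rewrite !mem_undup !mem_filter => /andP[le_x ->].
  by rewrite (leq_trans le_x le_mk).
have S_lt u v : u < N -> v < N -> c u < c v -> size (S (c u)) < size (S (c v)).
  move=> lt_u lt_v lt_c.
  have : uniq (c v :: S (c u)) by rewrite /= S_uniq mem_S // -ltnNge lt_c.
  move/uniq_leq_size; apply => x; rewrite inE => /orP[/eqP->|]; first by rewrite mem_S.
  by apply: S_sub; apply: ltnW.
(* The rank of a colour does not exceed the colour, because colours are positive; hence the sum does
   not grow. *)
have S_le v : size (S (c v)) <= c v.
  rewrite -[leqRHS](size_iota 1); apply: uniq_leq_size => // x.
  rewrite mem_undup mem_filter mem_iota add1n ltnS => /andP[-> /mapP[u]].
  by rewrite mem_iota /= add0n => /c_gt0 ? ->; rewrite andbT.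
exists (fun v => size (S (c v))) => [|v lt_v]; last first.
  apply: leq_trans (size_undup _) _; rewrite size_filter.
  by apply: leq_trans (count_size _ _) _; rewrite size_map size_iota.
split=> [v lt_v|u v lt_u lt_v /c_adj neq_c eq_S|].
- by rewrite lt0n size_eq0; apply/eqP => S0; have := mem_S (c v) v lt_v; rewrite S0 leqnn.
- case: (ltngtP (c u) (c v)) => [/S_lt|/S_lt|]; last exact: neq_c.
    by rewrite eq_S ltnn => /(_ lt_u lt_v).
  by rewrite eq_S ltnn => /(_ lt_v lt_u).
- rewrite sg; apply: leq_trans le_c; rewrite !big_mkord.
  by apply: leq_sum => v _; apply: S_le.
Qed.

End Bits.

Lemma sum_binary_digits n m : n < 2 ^ m -> \sum_(i < m) odd (n %/ 2 ^ i) * 2 ^ i = n.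
Proof.
elim: m n => [|m IH] n lt_n; first by rewrite big_ord0; move: lt_n; case: n.
rewrite big_ord_recl /= divn1 muln1 -[RHS]odd_double_half; congr addn.
rewrite -[in RHS](IH n./2); last by rewrite expnS mul2n in lt_n; lia.
rewrite -muln2 big_distrl /=; apply: eq_bigr => i _.
by rewrite /bump /= add1n expnS divnMA divn2 mulnA mulnAC.
Qed.

Lemma size_nat_word n : size (nat_word n) = up_log 2 n.+1.
Proof. by rewrite size_mkseq. Qed.

Lemma nth_nat_word n i : nth false (nat_word n) i = odd (n %/ 2 ^ i).
Proof.
have [lt_i|le_i] := ltnP i (up_log 2 n.+1); first by rewrite nth_mkseq.
rewrite nth_default ?size_nat_word // divn_small //.
by rewrite -up_log_leq.
Qed.

Lemma nat_word_value n m : up_log 2 n.+1 <= m ->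
  \sum_(i < m) nth false (nat_word n) i * 2 ^ i = n.
Proof.
rewrite up_log_leq => lt_n; under eq_bigr => i _ do rewrite nth_nat_word.
exact: sum_binary_digits.
Qed.

Definition chromatic_word (w : word) :=
  exists c, chromatic_bits (size w) (nth false w) c.

Section InstanceWord.
Variables (G : sgraph) (k : int).
Let N := #|G|.
Let w := instance_word G k.
Let M := [seq adj x y | x <- enum G, y <- enum G].

Lemma size_adjacency_word : size M = N * N.
Proof. by rewrite size_allpairs -cardE. Qed.

Lemma size_instance_word : size w = N.+1 + (N * N + (size (nat_word `|k|%N)).+1).
Proof. by rewrite /w /instance_word size_cat size_nseq /= size_cat size_adjacency_word /= addnS. Qed.

Lemma nth_instance_word i : nth false w (N.+1 + i) =
  if i < N * N then nth false M i
  else if i == N * N then (k < 0)%R else odd (`|k|%N %/ 2 ^ (i - N * N).-1).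
Proof.
rewrite nth_cat size_nseq -/N.
have -> : (N.+1 + i < N) = false by lia.
have -> : N.+1 + i - N = i.+1 by lia.
rewrite /= nth_cat size_adjacency_word.
case: ltngtP => // [lt_i|->]; last by rewrite subnn.
by have -> : i - N * N = (i - N * N).-1.+1; [lia | rewrite /= nth_nat_word].
Qed.

Lemma order_instance_word : order_bits (size w) (nth false w) = N.
Proof.
apply: order_bits_lead.
- by rewrite size_instance_word; lia.
- by move=> i lt_i; rewrite nth_cat size_nseq lt_i nth_nseq lt_i.
- by rewrite nth_cat size_nseq ltnn subnn.
Qed.

Lemma adj_instance_word x0 u v : u < N -> v < N ->
  adj_bits (size w) (nth false w) u v = adj (nth x0 (enum G) u) (nth x0 (enum G) v).
Proof.
move=> lt_u lt_v; rewrite /adj_bits order_instance_word nth_instance_word.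
have -> : u * N + v < N * N by nia.
rewrite (@nth_flatten_const _ _ false _ _ N _ _ x0) -?cardE //.
  by rewrite (nth_map x0) // -cardE.
by move=> x; rewrite size_map -cardE.
Qed.

Lemma value_instance_word S :
  ~~ sign_bits (size w) (nth false w) && (S <= value_bits (size w) (nth false w)) =
  ((S%:Z <= k)%R).
Proof.
rewrite /sign_bits /value_bits order_instance_word nth_instance_word ltnn eqxx.
have -> : \sum_(0 <= i < size w) nth false w (N.+2 + N * N + i) * 2 ^ i = `|k|%N.
  rewrite big_mkord -[RHS](@nat_word_value _ (size w)); last first.
    by rewrite size_instance_word size_nat_word; lia.
  apply: eq_bigr => i _; congr (nat_of_bool _ * _).
  have -> : N.+2 + N * N + i = N.+1 + (N * N + i.+1) by lia.
  rewrite nth_instance_word nth_nat_word.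
  have -> : (N * N + i.+1 < N * N) = false by lia.
  have -> : (N * N + i.+1 == N * N) = false by lia.
  by rewrite addKn.
by case: k => m //=; rewrite ?lez_nat //; lia.
Qed.

Lemma chromatic_sum_word : chromatic_sum G k <-> chromatic_word w.
Proof.
have size_enum : size (enum G) = N by rewrite -cardE.
split=> [[c [[c_gt0 c_adj] le_c]]|[c [c_gt0 c_adj]]]; last rewrite value_instance_word => le_c.
  exists (nth 0 [seq c v | v <- enum G]); split.
  - move=> v; rewrite order_instance_word => lt_v.
    have x0 : G by rewrite /N cardE in lt_v; case: (enum G) lt_v.
    by rewrite (nth_map x0) -?cardE.
  - move=> u v; rewrite order_instance_word => lt_u lt_v.
    have x0 : G by rewrite /N cardE in lt_v; case: (enum G) lt_v.
    have nth_c i : i < N -> nth 0 [seq c v | v <- enum G] i = c (nth x0 (enum G) i).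
      by move=> lt_i; rewrite (nth_map x0) ?size_enum.
    by rewrite (adj_instance_word x0) // !nth_c //; move/c_adj.
  - rewrite value_instance_word order_instance_word.
    have -> : \sum_(0 <= v < N) nth 0 [seq c v | v <- enum G] v = \sum_(v : G) c v.
      transitivity (\sum_(v <- enum G) c v); last by rewrite big_enum.
      by rewrite -[RHS](big_map c xpredT id) [RHS](big_nth 0) size_map size_enum.
    exact: le_c.
rewrite order_instance_word in c_gt0 c_adj le_c.
have lt_idx x : index x (enum G) < N by rewrite /N cardE index_mem mem_enum.
exists (fun x => c (index x (enum G))); split.
  split=> [x|x y xy]; first exact: c_gt0.
  apply: c_adj => //; rewrite (adj_instance_word x) // !nth_index ?mem_enum //.
have -> : \sum_(x : G) c (index x (enum G)) = \sum_(0 <= v < N) c v; last exact: le_c.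
transitivity (\sum_(x <- enum G) c (index x (enum G))); first by rewrite big_enum.
rewrite -(big_map (index^~ (enum G)) xpredT c).
have -> : [seq index x (enum G) | x <- enum G] = iota 0 N.
  apply: (@eq_from_nth _ 0); first by rewrite size_map size_iota -cardE.
  rewrite size_map -cardE => i lt_i.
  have x0 : G by rewrite cardE in lt_i; case: (enum G) lt_i.
  by rewrite (nth_map x0) -?cardE // index_uniq -?cardE ?enum_uniq // nth_iota.
by rewrite /index_iota subn0.
Qed.

End InstanceWord.

(** The graph that witnesses [yes] may differ from the promised one. [chromatic_word] speaks about
    the bits alone, so the choice of the graph behind a word does not matter. *)
Lemma restricted_yes (C : graph_class) w : promise (restricted_problem chromatic_sum C) w ->
  yes (restricted_problem chromatic_sum C) w <-> chromatic_word w.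
Proof.
move=> [G [k [_ def_w]]]; split=> [[G' [k' [sum_k ->]]]|]; first exact/chromatic_sum_word.
by rewrite def_w => /chromatic_sum_word sum_k; exists G, k.
Qed.

(** [pair_word] puts a one before each bit of its first component and a zero behind the component,
    so the leading ones at even positions give its length. *)
Definition pair_size (z : word) :=
  \sum_(0 <= i < size z) all (fun j => nth false z (2 * j)) (iota 0 i.+1).

Definition fst_bit z i := (i < pair_size z) && nth false z (2 * i).+1.

Definition snd_bit z i := nth false z ((2 * pair_size z).+1 + i).

Lemma nth_pair_even x y i : nth false (pair_word x y) (2 * i) =
  if i < size x then true else if i == size x then false else nth false y (2 * (i - size x)).-1.
Proof.
elim: x i => [|b x IH] [|i] //.
by rewrite mulnS /= -/(pair_word x y) add0n IH ltnS eqSS subSS.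
Qed.

Lemma nth_pair_odd x y i : i < size x -> nth false (pair_word x y) (2 * i).+1 = nth false x i.
Proof.
elim: x i => [|b x IH] [|i] // lt_i.
by rewrite mulnS /= -IH.
Qed.

Lemma size_pair_word x y : size (pair_word x y) = (2 * size x).+1 + size y.
Proof. by rewrite size_cat /=; elim: x => //= b x IH; lia. Qed.

Lemma nth_pair_snd x y i : nth false (pair_word x y) ((2 * size x).+1 + i) = nth false y i.
Proof. by elim: x => [|b x IH] //; rewrite [size _]/= mulnS /= -IH. Qed.

Lemma pair_size_pair x y : pair_size (pair_word x y) = size x.
Proof.
apply: order_bits_lead.
- by rewrite size_pair_word; lia.
- by move=> i lt_i; rewrite nth_pair_even lt_i.
- by rewrite nth_pair_even ltnn eqxx.
Qed.

Lemma fst_bit_pair x y : fst_bit (pair_word x y) =1 nth false x.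
Proof.
move=> i; rewrite /fst_bit pair_size_pair; case: ltnP => [/nth_pair_odd->//|le_i].
by rewrite /= nth_default.
Qed.

Lemma snd_bit_pair x y : snd_bit (pair_word x y) =1 nth false y.
Proof. by move=> i; rewrite /snd_bit pair_size_pair nth_pair_snd. Qed.

(* Row [v] of the certificate holds the colour of vertex [v], minus 1, in unary. *)
Definition cert_colour N (y : nat -> bool) v := (\sum_(0 <= j < N) y (v * N + j)).+1.

(* The inner sum is [minn S (2 ^ i)], which keeps all values polynomial. *)
Definition check_bits n (b y : nat -> bool) :=
  let N := order_bits n b in
  let c := cert_colour N y in
  let S := \sum_(0 <= v < N) c v in
  [&& ~~ sign_bits n b,
      S <= \sum_(0 <= i < n) b (N.+2 + N * N + i) * \sum_(0 <= j < S) (j < 2 ^ i) &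
      all (fun u => all (fun v => adj_bits n b u v ==> (c u != c v)) (iota 0 N)) (iota 0 N)].

Lemma sum_lt_minn n q : \sum_(0 <= i < n) (i < q) = minn n q.
Proof.
rewrite big_mkord; case: (leqP q n) => [le_q|lt_n]; first by rewrite sum_lt_id.
rewrite -[RHS]card_ord -sum1_card; apply: eq_bigr => i _.
by rewrite (ltn_trans (ltn_ord i) lt_n).
Qed.

(** Cutting terms off at [S] does not affect whether the sum reaches [S]: a term that is cut reaches
    it alone. This permits comparing the colour sum with a binary threshold that is too large for
    unary counters. *)
Lemma leq_sum_minn (I : Type) (r : seq I) (F : I -> bool) (E : I -> nat) S :
  (S <= \sum_(i <- r) F i * minn S (E i)) = (S <= \sum_(i <- r) F i * E i).
Proof.
suff le_min : minn S (\sum_(i <- r) F i * E i) <= \sum_(i <- r) F i * minn S (E i).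
  apply/idP/idP => le_S; last by apply: leq_trans le_min; rewrite (minn_idPl le_S).
  apply: leq_trans le_S _; apply: leq_sum => i _.
  by rewrite leq_mul2l geq_minr orbT.
elim: r => [|i r IH]; rewrite ?big_nil ?minn0 // !big_cons.
by case: (F i); rewrite /= ?mul1n ?mul0n ?add0n //; lia.
Qed.

Lemma check_bitsP n b y : check_bits n b y ->
  chromatic_bits n b (cert_colour (order_bits n b) y).
Proof.
case/and3P => sg le_S /allP all_uv; split=> [//|u v lt_u lt_v uv|].
  have := all_uv u; rewrite mem_iota /= => /(_ lt_u) /allP /(_ v).
  by rewrite mem_iota /= => /(_ lt_v); rewrite uv => /eqP.
rewrite sg /= /value_bits -leq_sum_minn; apply: leq_trans le_S _.
by under eq_bigr => i _ do rewrite sum_lt_minn.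
Qed.

Lemma check_bits_complete n b c : chromatic_bits n b c ->
  (forall v, v < order_bits n b -> c v <= order_bits n b) ->
  let N := order_bits n b in
  check_bits n b (nth false [seq j < (c v).-1 | v <- iota 0 N, j <- iota 0 N]).
Proof.
move=> [c_gt0 c_adj /andP[sg le_S]] c_le; cbv zeta; set N := order_bits n b; set y := nth _ _.
have def_c v : v < N -> cert_colour N y v = c v.
  move=> lt_v; rewrite /cert_colour (_ : \sum_(_ <= _ < _) _ = (c v).-1) ?prednK ?c_gt0 //.
  rewrite big_mkord -[RHS](@sum_lt_id N); last by have := c_le v lt_v; lia.
  apply: eq_bigr => j _; congr nat_of_bool.
  rewrite /y (@nth_flatten_const _ _ false _ _ N _ _ 0) ?size_iota //; last first.
    by move=> x; rewrite size_map size_iota.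
  by rewrite (nth_map 0) ?size_iota // !nth_iota.
rewrite /check_bits -/N; apply/and3P; split=> //.
- have -> : \sum_(0 <= v < N) cert_colour N y v = \sum_(0 <= v < N) c v.
    by rewrite !big_mkord; apply: eq_bigr => v _; rewrite def_c.
  move: le_S; rewrite /value_bits -leq_sum_minn => le_S; apply: leq_trans le_S _.
  by apply: leq_sum => i _; rewrite sum_lt_minn.
- apply/allP => u; rewrite mem_iota /= add0n => lt_u; apply/allP => v.
  rewrite mem_iota /= add0n => lt_v; apply/implyP => uv.
  by rewrite !def_c //; apply/eqP; apply: c_adj.
Qed.

Lemma eq_check_bits n b b' y y' : b =1 b' -> y =1 y' -> check_bits n b y = check_bits n b' y'.
Proof. by move=> /funext -> /funext ->. Qed.

Section DefinableVerifier.
Variables (C : Type) (v : view C).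

Lemma df_pair_size : df v (fun c => pair_size (v c).1).
Proof.
apply: (@df_sum _ _ (fun c => size (v c).1)); first exact: df_size.
apply: (@dfb_all _ _ (fun c => c.2.+1)); first by apply: df_succ; apply: df_var.
apply: (@df_bit _ (ext (ext v)) (fun c => 2 * c.2)).
by apply: df_mul; [apply: df_const|apply: df_var].
Qed.

Lemma dfb_fst_bit f : df v f -> dfb v (fun c => fst_bit (v c).1 (f c)).
Proof.
move=> Hf; apply: dfb_and; first by apply: df_ltn => //; apply: df_pair_size.
apply: (@df_bit _ v); apply: df_succ; apply: df_mul => //; exact: df_const.
Qed.

Lemma dfb_snd_bit f : df v f -> dfb v (fun c => snd_bit (v c).1 (f c)).
Proof.
move=> Hf; apply: (@df_bit _ v); apply: df_add => //; apply: df_succ.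
by apply: df_mul; [apply: df_const|apply: df_pair_size].
Qed.

End DefinableVerifier.

Definition verifier (z : word) := check_bits (pair_size z) (fst_bit z) (snd_bit z).

Section DefinableCheck.
Variables (C : Type) (v : view C).
Let order z := order_bits (pair_size z) (fst_bit z).

Lemma df_order : df v (fun c => order (v c).1).
Proof.
apply: (@df_sum _ _ (fun c => pair_size (v c).1)); first exact: df_pair_size.
apply: (@dfb_all _ _ (fun c => c.2.+1)); first by apply: df_succ; apply: df_var.
by apply: (@dfb_fst_bit _ (ext (ext v))); apply: df_var.
Qed.

End DefinableCheck.

Lemma df_colour C (v : view C) f : df v f ->
  df v (fun c => cert_colour (order_bits (pair_size (v c).1) (fst_bit (v c).1)) (snd_bit (v c).1) (f c)).
Proof.
move=> Hf; apply: df_succ.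
apply: (@df_sum _ _ (fun c => order_bits (pair_size (v c).1) (fst_bit (v c).1))); first exact: df_order.
apply: (@dfb_snd_bit _ (ext v)); apply: df_add; last exact: df_var.
by apply: df_mul; [exact: df_weak|exact: (@df_order _ (ext v))].
Qed.

Lemma polytime_verifier : polytime (fun z => [:: verifier z]).
Proof.
apply: polytime_dfw; apply: dfw_bit.
pose v0 := input_view.
have Hsum C (v : view C) : df v (fun c => \sum_(0 <= u < order_bits (pair_size (v c).1) (fst_bit (v c).1))
    cert_colour (order_bits (pair_size (v c).1) (fst_bit (v c).1)) (snd_bit (v c).1) u).
  apply: (@df_sum _ _ (fun c => order_bits (pair_size (v c).1) (fst_bit (v c).1))); first exact: df_order.
  by apply: (@df_colour _ (ext v)); apply: df_var.
apply: dfb_and.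
  apply: dfb_not; apply: (@dfb_fst_bit _ v0); apply: df_add; first by apply: df_succ; apply: (@df_order _ v0).
  by apply: df_mul; apply: (@df_order _ v0).
apply: dfb_and.
  apply: df_leq; first exact: (Hsum _ v0).
  apply: (@df_sum _ v0 (fun z => pair_size z)); first exact: (@df_pair_size _ v0).
  apply: df_mul.
    apply: (@dfb_fst_bit _ (ext v0)); apply: df_add; last exact: df_var.
    apply: df_add; first by do 2!apply: df_succ; apply: (@df_order _ (ext v0)).
    by apply: df_mul; apply: (@df_order _ (ext v0)).
  apply: (@df_sum _ (ext v0)); first exact: (Hsum _ (ext v0)).
  by apply: (@dfb_lt_exp2 _ (ext (ext v0))); [exact: df_var|apply: df_weak; exact: df_var].
apply: (@dfb_all _ v0 (fun z => order_bits (pair_size z) (fst_bit z))); first exact: (@df_order _ v0).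
apply: (@dfb_all _ (ext v0) (fun c => order_bits (pair_size c.1) (fst_bit c.1))).
  exact: (@df_order _ (ext v0)).
set v2 := ext (ext v0); apply: dfb_imp.
  apply: (@dfb_fst_bit _ v2); apply: df_add; first by apply: df_succ; apply: (@df_order _ v2).
  apply: df_add; last exact: df_var.
  by apply: df_mul; [apply: df_weak; exact: df_var|apply: (@df_order _ v2)].
apply: dfb_not; apply: df_eq; apply: (@df_colour _ v2); first by apply: df_weak; exact: df_var.
exact: df_var.
Qed.

Theorem in_NP_restricted (C : graph_class) : in_NP (restricted_problem chromatic_sum C).
Proof.
(* The certificate has a row of [N] bits for each of the [N] vertices, and [N] is at most the length
   of the instance. *)
exists verifier, ('X ^+ 2)%R; split; first exact: polytime_verifier.
move=> w w_inst; have -> : ('X ^+ 2).[size w]%R = size w ^ 2 by rewrite horner_exp hornerX.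
have verE y : verifier (pair_word w y) = check_bits (size w) (nth false w) (nth false y).
  by rewrite /verifier pair_size_pair; apply: eq_check_bits; [apply: fst_bit_pair|apply: snd_bit_pair].
apply: iff_trans (restricted_yes w_inst) _; split=> [[c0 /compress_colouring[c Hc c_le]]|[y [_]]].
  set N := order_bits (size w) (nth false w) in c_le.
  exists [seq j < (c v).-1 | v <- iota 0 N, j <- iota 0 N]; rewrite verE; split; last exact: check_bits_complete.
  by rewrite size_allpairs !size_iota expnS expn1; apply: leq_mul; apply: leq_order_bits.
by rewrite verE => /check_bitsP Hc; exists (cert_colour (order_bits (size w) (nth false w)) (nth false y)).
Qed.

(** * The Cook-Levin theorem *)

Lemma horner_nat_mono (p : {poly nat}) a b : a <= b -> p.[a]%R <= p.[b]%R.
Proof.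
move=> le_ab; rewrite /horner; elim: (polyseq p) => //= c s IH.
by apply: leq_add => //; apply: leq_mul.
Qed.

(** Every function on a fixed finite range is a finite case distinction. In this way the transition
    table of the machine enters the expressions. *)
Lemma df_table C (v : view C) K (h : nat -> nat) f : (forall c, f c < K) -> df v f ->
  df v (fun c => h (f c)).
Proof.
move=> lt_f Hf; apply: (@df_ext _ _ (fun c => (f c < K) * h (f c))).
  by move=> c; rewrite lt_f mul1n.
elim: K {lt_f} => [|K IH]; first exact: df_const.
apply: (@df_ext _ _ (fun c => (f c < K) * h (f c) + (f c == K) * h K)).
  by move=> c; rewrite ltnS; case: ltngtP => [_|_|->]; rewrite /= ?mul0n ?mul1n ?addn0.
by apply: df_add => //; apply: df_mul; [apply: df_eq => //|]; apply: df_const.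
Qed.

Ltac cmp_simp := repeat match goal with
  | |- context [?a <= ?b] => first [have -> : (a <= b) = true by lia | have -> : (a <= b) = false by lia]
  | |- context [?a == ?b :> nat] => first [have -> : (a == b) = true by lia | have -> : (a == b) = false by lia]
  end.

(** * Computations as tables with a local rule *)

Section Tableau.
Variable M : machine.

Definition tcell : finType := (symbol M * option (state M))%type.

(** A configuration stores the tape relative to the head; [h] is the column of the head in a fixed
    frame. *)
Definition cell_at (c : config M) (h p : nat) : tcell :=
  if p < h then (nth None (left_of c) (h.-1 - p), None)
  else if p == h then (scanned c, Some (current c))
  else (nth None (right_of c) (p - h.+1), None).

Definition head_move (c : config M) : move :=
  if halting (current c) then Stay else (trans (current c) (scanned c)).2.

Definition shift_head (d : move) h :=
  match d with MoveLeft => h.-1 | Stay => h | MoveRight => h.+1 end.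

Definition action (a : tcell) : option (state M * symbol M * move) :=
  if a.2 is Some q then
    Some (if halting q then (q, a.1, Stay) else trans q a.1)
  else None.

(* The next content of the middle cell of three adjacent cells. *)
Definition window (a b c : tcell) : tcell :=
  (if action b is Some (_, s, _) then s else b.1,
   match action a, action b, action c with
   | Some (q, _, MoveRight), _, _ => Some q
   | _, Some (q, _, Stay), _ => Some q
   | _, _, Some (q, _, MoveLeft) => Some q
   | _, _, _ => None
   end).

(** The hypothesis makes [h.-1] a genuine move to the left, so the frame does not slip. *)
Lemma cell_at_step c h p : 0 < h ->
  cell_at (step c) (shift_head (head_move c) h) p.+1 =
  window (cell_at c h p) (cell_at c h p.+1) (cell_at c h p.+2).
Proof.
case: h => // h _; case: c => q L s R; rewrite /head_move /step /=.
rewrite /window /cell_at /action /=.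
have cases : p.+2 < h.+1 \/ p.+2 = h.+1 \/ p = h \/ p = h.+1 \/ h.+1 < p by lia.
have [hq|hq] := boolP (halting q); last case def_t : (trans q s) => [[q' s'] []];
  case: cases => [?|[?|[?|[?|?]]]]; try subst; rewrite /= -?nth0; cmp_simp; rewrite /= ?hq ?(negbTE hq) /= ?def_t ?nth_behead ?subnn ?subSnn /=;
  try (by []);
  first [ by have -> : (h.-1 - p.+1).+1 = h - p.+1 by lia
        | by have -> : h - p.+1 = 0 by lia
        | by have -> : p.+1 - h.+1 = (p.+1 - h.+2).+1 by lia
        | by have -> : h.+1 - p.+1 = (h - p.+1).+1 by lia
        | by have -> : p.+1 - h.+2 = (p.+1 - h.+3).+1 by lia ].
Qed.

Fixpoint head_at (c : config M) h n :=
  if n is n'.+1 then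
    shift_head (head_move (iter n' (@step M) c)) (head_at c h n')
  else h.

Lemma head_at_bound c h n : n <= h -> h - n <= head_at c h n <= h + n.
Proof.
elim: n => [|n IH] le_n /=; first by rewrite subn0 addn0 leqnn.
have := IH (ltnW le_n); case: (head_move _) => /= /andP[]; lia.
Qed.

Lemma cell_at_iter c h n p : n < h ->
  cell_at (iter n.+1 (@step M) c) (head_at c h n.+1) p.+1 =
  let cell := cell_at (iter n (@step M) c) (head_at c h n) in
  window (cell p) (cell p.+1) (cell p.+2).
Proof.
move=> lt_n; cbv zeta; rewrite -cell_at_step //.
by have := head_at_bound c (ltnW lt_n); lia.
Qed.

Definition code (a : tcell) : nat := enum_rank a.
Definition ncodes := #|{: tcell}|.

Lemma code_lt a : code a < ncodes.
Proof. exact: ltn_ord. Qed.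

Lemma code_inj : injective code.
Proof. by move=> a b /val_inj /enum_rank_inj. Qed.

Definition triple : finType := (tcell * tcell * tcell)%type.
Definition ntriples := #|{: triple}|.
Definition blank : tcell := (None, None).
Definition triple_of k : triple := nth (blank, blank, blank) (enum {: triple}) k.

Lemma triple_ofP (t : triple) : exists2 k, k < ntriples & triple_of k = t.
Proof.
exists (index t (enum {: triple})); first by rewrite /ntriples cardE index_mem mem_enum.
by rewrite /triple_of nth_index ?mem_enum.
Qed.

End Tableau.

(* Satisfiability of the [m] clauses over [n] variables in which [pos i j]
   (resp. [neg i j]) tells that variable [i] occurs positively (resp.
   negatively) in clause [j], and [free j] that clause [j] holds anyway. *)
Definition msat n m (pos neg : nat -> nat -> bool) (free : nat -> bool) :=
  exists val : nat -> bool, forall j, j < m ->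
    free j || has (fun i => if pos i j then val i else neg i j && ~~ val i) (iota 0 n).

(** Definability in every context, so that the functions can be used below any number of bound
    variables. *)
Definition df0 (n : word -> nat) := forall C (v : view C), df v (fun c => n (v c).1).

Definition dfb1 (p : word -> nat -> bool) := forall C (v : view C) f,
  df v f -> dfb v (fun c => p (v c).1 (f c)).

Definition dfb2 (p : word -> nat -> nat -> bool) := forall C (v : view C) f g,
  df v f -> df v g -> dfb v (fun c => p (v c).1 (f c) (g c)).

Section CookLevin.
Variables (M : machine) (q p : {poly nat}).

Let P (x : word) := p.[size x]%R.
(** Bounds the running time on all pairs of [x] with a certificate of admissible length, by
    monotonicity of [q]. *)
Let T (x : word) := q.[2 * size x + 1 + P x]%R.
(* Row [t] of the tableau is only controlled on the columns [t <= c < W - t],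
   which contain every cell the head can reach. *)
Let W x := 4 * T x + 1.
(** The head starts in the middle column. After [T x] steps it lies between the columns [T x] and
    [3 * T x], which are just those still controlled in the last row. *)
Let O x := 2 * T x.
Let S := ncodes M.
Let K := ntriples M.

Definition vnum x t c a := (t * W x + c) * S + a.
Definition nvars x := (T x).+1 * W x * S.
Definition ncols x := 4 * (T x).+1 * W x * K.

(* Clause [j] codes a family of clauses, a time, a column and a triple of cell
   contents in mixed radix. *)
Definition col_k (x : word) j := j %% K.
Definition col_c x j := (j %/ K) %% W x.
Definition col_t x j := (j %/ (K * W x)) %% (T x).+1.
Definition col_fam x j := j %/ (K * W x * (T x).+1).

Definition fst_code k := code (triple_of M k).1.1.
Definition snd_code k := code (triple_of M k).1.2.
Definition trd_code k := code (triple_of M k).2.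
Definition window_code k :=
  code (window (triple_of M k).1.1 (triple_of M k).1.2 (triple_of M k).2).
(** The output starts at the head, so the verifier accepts exactly if the head ends on the bit 1.
    Any other symbol together with a state is a rejection. *)
Definition rejecting k :=
  let a := (triple_of M k).1.1 in isSome a.2 && (a.1 != Some (inl true)).

Definition guessed x c := 2 * size x + O x < c <= 2 * size x + O x + P x.

(** Spelled out so that for a fixed symbol [s] it is a Boolean combination of constants and the
    definable bit [b]. *)
Definition bit_is (s : symbol M) (b : bool) :=
  b && (s == Some (inl true)) || ~~ b && (s == Some (inl false)).

(** The layout of [pair_word x y] from column [O x] on: the bits of [x] interleaved with ones, a
    zero, and at most [P x] cells for the unknown [y]. *)
Definition allowed_symbol x c (s : symbol M) :=
  if c < O x then s == None
  else if c < 2 * size x + O x then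
    bit_is s (~~ odd (c - O x) || nth false x ((c - O x) %/ 2))
  else if c == 2 * size x + O x then s == Some (inl false)
  else if c <= 2 * size x + O x + P x then
    [|| s == None, s == Some (inl true) | s == Some (inl false)]
  else s == None.

Definition allowed x c (a : tcell M) :=
  ((c == O x) == (a.2 == Some (start M))) && ((c == O x) || (a.2 == None)) &&
  allowed_symbol x c a.1.

(* Families 0 to 3: transitions; initial row; a blank of the certificate is
   followed by blanks; no rejecting state in the last row. All implications
   point forward in time, so a satisfying assignment makes the variables of
   the actual run true and nothing needs to be said about the others. *)
Definition pos_lit x i fam t c k :=
  if fam == 0 then i == vnum x t.+1 c.+1 (window_code k)
  else if fam == 1 then has (fun a => (i == vnum x 0 c (code a)) && allowed x c a) (enum {: tcell M})
  else (fam == 2) && (i == vnum x 0 c.+1 (code (blank M))).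

Definition neg_lit x i fam t c k :=
  if fam == 0 then
    [|| i == vnum x t c (fst_code k), i == vnum x t c.+1 (snd_code k)
      | i == vnum x t c.+2 (trd_code k)]
  else if fam == 1 then false
  else if fam == 2 then i == vnum x 0 c (code (blank M))
  else i == vnum x (T x) c (fst_code k).

Definition free_col x fam t c k :=
  if fam == 0 then ~~ ((t < T x) && (c.+2 < W x))
  else if fam == 1 then false
  else if fam == 2 then ~~ [&& guessed x c, guessed x c.+1 & c.+1 < W x]
  else ~~ rejecting k.

Definition tab_pos x i j := pos_lit x i (col_fam x j) (col_t x j) (col_c x j) (col_k x j).
Definition tab_neg x i j := neg_lit x i (col_fam x j) (col_t x j) (col_c x j) (col_k x j).
Definition tab_free x j := free_col x (col_fam x j) (col_t x j) (col_c x j) (col_k x j).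

Lemma K_gt0 : 0 < K.
Proof. by apply/card_gt0P; exists (blank M, blank M, blank M). Qed.

Lemma W_gt0 x : 0 < W x.
Proof. by rewrite /W addn1. Qed.

Lemma dfP : df0 P.
Proof. by move=> C v; apply: df_horner; apply: df_size. Qed.

Lemma dfT : df0 T.
Proof.
move=> C v; apply: df_horner; apply: df_add; last exact: dfP.
by apply: df_add; [apply: df_mul; [apply: df_const|apply: df_size]|apply: df_const].
Qed.

Lemma dfW : df0 W.
Proof. by move=> C v; apply: df_add; [apply: df_mul; [apply: df_const|apply: dfT]|apply: df_const]. Qed.

Lemma dfO : df0 O.
Proof. by move=> C v; apply: df_mul; [apply: df_const|apply: dfT]. Qed.

Lemma df_nvars : df0 nvars.
Proof.
move=> C v; apply: df_mul; last exact: df_const.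
by apply: df_mul; [apply: df_succ; apply: dfT|apply: dfW].
Qed.

Lemma df_ncols : df0 ncols.
Proof.
move=> C v; apply: df_mul; last exact: df_const.
apply: df_mul; last exact: dfW.
by apply: df_mul; [apply: df_const|apply: df_succ; apply: dfT].
Qed.

Section Fields.
Variables (C : Type) (v : view C).
Implicit Types f g : C -> nat.

Lemma df_vnum t c a : df v t -> df v c -> df v a ->
  df v (fun d => vnum (v d).1 (t d) (c d) (a d)).
Proof.
move=> Ht Hc Ha; apply: df_add => //; apply: df_mul; last exact: df_const.
by apply: df_add => //; apply: df_mul => //; apply: dfW.
Qed.

Lemma df_col_k f : df v f -> df v (fun d => col_k (v d).1 (f d)).
Proof. by move=> Hf; apply: df_mod => //; apply: df_const. Qed.

Lemma df_col_c f : df v f -> df v (fun d => col_c (v d).1 (f d)).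
Proof. by move=> Hf; apply: df_mod; [apply: df_div => //; apply: df_const|apply: dfW]. Qed.

Lemma df_col_t f : df v f -> df v (fun d => col_t (v d).1 (f d)).
Proof.
move=> Hf; apply: df_mod; last by apply: df_succ; apply: dfT.
by apply: df_div => //; apply: df_mul; [apply: df_const|apply: dfW].
Qed.

Lemma df_col_fam f : df v f -> df v (fun d => col_fam (v d).1 (f d)).
Proof.
move=> Hf; apply: df_div => //; apply: df_mul; last by apply: df_succ; apply: dfT.
by apply: df_mul; [apply: df_const|apply: dfW].
Qed.

Lemma df_triple_table (h : nat -> nat) f : df v f -> df v (fun d => h (col_k (v d).1 (f d))).
Proof.
move=> Hf; apply: (@df_table _ _ K h); last exact: df_col_k.
by move=> d; rewrite ltn_pmod // K_gt0.
Qed.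

Lemma dfb_guessed c : df v c -> dfb v (fun d => guessed (v d).1 (c d)).
Proof.
move=> Hc; have H : df v (fun d => 2 * size (v d).1 + O (v d).1).
  by apply: df_add; [apply: df_mul; [apply: df_const|apply: df_size]|apply: dfO].
apply: dfb_and; first exact: df_ltn.
by apply: df_leq => //; apply: df_add => //; apply: dfP.
Qed.

Lemma dfb_allowed c a : df v c -> dfb v (fun d => allowed (v d).1 (c d) a).
Proof.
move=> Hc; have H : df v (fun d => 2 * size (v d).1 + O (v d).1).
  by apply: df_add; [apply: df_mul; [apply: df_const|apply: df_size]|apply: dfO].
have HO := dfO v.
apply: dfb_and.
  apply: dfb_and; first by apply: dfb_eqb; [apply: df_eq|apply: dfb_const].
  by apply: dfb_or; [apply: df_eq|apply: dfb_const].
apply: dfb_if; [exact: df_ltn|exact: dfb_const|].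
apply: dfb_if; [exact: df_ltn| |].
  have Hb : dfb v (fun d => ~~ odd (c d - O (v d).1) || nth false (v d).1 ((c d - O (v d).1) %/ 2)).
    apply: dfb_or; first by apply: dfb_not; apply: df_odd; apply: df_sub.
    by apply: (@df_bit _ v); apply: df_div; [apply: df_sub|apply: df_const].
  apply: dfb_or; first by apply: dfb_and => //; apply: dfb_const.
  by apply: dfb_and; [apply: dfb_not|apply: dfb_const].
apply: dfb_if; [exact: df_eq|exact: dfb_const|].
apply: dfb_if; [|exact: dfb_const|exact: dfb_const].
by apply: df_leq => //; apply: df_add => //; apply: dfP.
Qed.

End Fields.

Lemma dfb_tab_pos : dfb2 tab_pos.
Proof.
move=> C v f g Hf Hg.
have Hc := df_col_c Hg; have Ht := df_col_t Hg; have Hfam := df_col_fam Hg.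
apply: dfb_if; first by apply: df_eq => //; apply: df_const.
  apply: df_eq => //; apply: (@df_vnum _ v); [exact: df_succ|exact: df_succ|].
  exact: (@df_triple_table _ v window_code).
apply: dfb_if; first by apply: df_eq => //; apply: df_const.
  apply: (@dfb_has_seq _ _ _ (enum {: tcell M}) (fun a d =>
    (f d == vnum (v d).1 0 (col_c (v d).1 (g d)) (code a)) && allowed (v d).1 (col_c (v d).1 (g d)) a)) => a.
  apply: dfb_and; last exact: dfb_allowed.
  by apply: df_eq => //; apply: (@df_vnum _ v) => //; apply: df_const.
apply: dfb_and; first by apply: df_eq => //; apply: df_const.
apply: df_eq => //; apply: (@df_vnum _ v); [exact: df_const|exact: df_succ|exact: df_const].
Qed.

Lemma dfb_tab_neg : dfb2 tab_neg.
Proof.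
move=> C v f g Hf Hg.
have Hc := df_col_c Hg; have Ht := df_col_t Hg; have Hfam := df_col_fam Hg.
apply: dfb_if; first by apply: df_eq => //; apply: df_const.
  apply: dfb_or.
    by apply: df_eq => //; apply: (@df_vnum _ v) => //; exact: (@df_triple_table _ v fst_code).
  apply: dfb_or; apply: df_eq => //; apply: (@df_vnum _ v) => //.
  - exact: df_succ.
  - exact: (@df_triple_table _ v snd_code).
  - by do 2!apply: df_succ.
  - exact: (@df_triple_table _ v trd_code).
apply: dfb_if; [by apply: df_eq => //; apply: df_const|exact: dfb_const|].
apply: dfb_if; first by apply: df_eq => //; apply: df_const.
  by apply: df_eq => //; apply: (@df_vnum _ v) => //; exact: df_const.
apply: df_eq => //; apply: (@df_vnum _ v) => //; first exact: dfT.
exact: (@df_triple_table _ v fst_code).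
Qed.

Lemma dfb_tab_free : dfb1 tab_free.
Proof.
move=> C v g Hg.
have Hc := df_col_c Hg; have Ht := df_col_t Hg; have Hfam := df_col_fam Hg.
apply: dfb_if; first by apply: df_eq => //; apply: df_const.
  apply: dfb_not; apply: dfb_and; apply: df_ltn => //; first exact: dfT.
    by do 2!apply: df_succ.
  exact: dfW.
apply: dfb_if; [by apply: df_eq => //; apply: df_const|exact: dfb_const|].
apply: dfb_if; first by apply: df_eq => //; apply: df_const.
  apply: dfb_not; apply: dfb_and; first exact: (@dfb_guessed _ v).
  apply: dfb_and; first by apply: (@dfb_guessed _ v); apply: df_succ.
  by apply: df_ltn; [exact: df_succ|exact: dfW].
apply: dfb_not; exact: (@df_triple_table _ v (fun k => rejecting k : nat)).
Qed.

Lemma col_index x fam t c k : t <= T x -> c < W x -> k < K ->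
  let j := ((fam * (T x).+1 + t) * W x + c) * K + k in
  [/\ col_fam x j = fam, col_t x j = t, col_c x j = c & col_k x j = k].
Proof.
move=> le_t lt_c lt_k j.
have jK : j %/ K = (fam * (T x).+1 + t) * W x + c.
  by rewrite /j divnMDl ?K_gt0 // divn_small ?addn0.
have jKW : j %/ (K * W x) = fam * (T x).+1 + t.
  by rewrite divnMA jK divnMDl ?W_gt0 // divn_small ?addn0.
split.
- by rewrite /col_fam divnMA jKW divnMDl // divn_small ?addn0.
- by rewrite /col_t jKW modnMDl modn_small.
- by rewrite /col_c jK modnMDl modn_small.
- by rewrite /col_k modnMDl modn_small.
Qed.

Lemma nth_symbols z i :
  nth None [seq Some (inl b) | b <- z : seq bool] i =
  (if i < size z then Some (inl (nth false z i)) else None) :> symbol M.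
Proof.
case: ltnP => [lt_i|le_i]; first by rewrite (nth_map false).
by rewrite nth_default ?size_map.
Qed.

Lemma cell_at_initial z h c : cell_at (initial M z) h c =
  (if h <= c then nth None [seq Some (inl b) | b <- z] (c - h) else None,
   if c == h then Some (start M) else None).
Proof.
rewrite /cell_at /initial /=; case: ltngtP => [lt_c|lt_c|->]; first by rewrite nth_nil.
  by rewrite nth_behead -subSn ?subSS.
by rewrite subnn nth0.
Qed.

Section Correct.
Variables (V : word -> bool) (x : word).
Hypothesis halt_M : forall z, let c := iter q.[size z]%R (@step M) (initial M z) in
  halting (current c) /\ output c = [:: V z].

Definition actual z t c := cell_at (iter t (@step M) (initial M z)) (head_at (initial M z) (O x) t) c.

Lemma actual_step z t c : t < T x ->
  actual z t.+1 c.+1 = window (actual z t c) (actual z t c.+1) (actual z t c.+2).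
Proof. by move=> lt_t; apply: cell_at_iter; rewrite /O; lia. Qed.

Lemma size_cert y : size y <= P x -> q.[size (pair_word x y)]%R <= T x.
Proof. by move=> le_y; apply: horner_nat_mono; rewrite size_pair_word; lia. Qed.

Lemma final_scanned y : size y <= P x ->
  scanned (iter (T x) (@step M) (initial M (pair_word x y))) = Some (inl (V (pair_word x y))).
Proof.
move=> /size_cert le_T; have := halt_M (pair_word x y); cbv zeta => -[hc oc].
rewrite -(subnK le_T) iterD iter_halted //.
move: oc; rewrite /output /=; case: (scanned _) => [[b|a]|] //= -[->] //.
Qed.

Lemma bit_isE b b' : bit_is (Some (inl b)) b' = (b == b').
Proof. by rewrite /bit_is; case: b; case: b'. Qed.

Lemma nth_pair y i : i < 2 * size x ->
  nth false (pair_word x y) i = ~~ odd i || nth false x (i %/ 2).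
Proof.
move=> lt_i; rewrite -{1}(odd_double_half i) divn2 -mul2n.
case: (odd i) => /=; rewrite ?add1n ?add0n; first by rewrite nth_pair_odd //; lia.
by rewrite nth_pair_even; have -> : i./2 < size x by lia.
Qed.

Lemma allowed_initial y c : size y <= P x -> allowed x c (actual (pair_word x y) 0 c).
Proof.
move=> le_y; rewrite /actual /= cell_at_initial /allowed /=.
have -> : ((c == O x) == ((if c == O x then Some (start M) else None) == Some (start M))).
  by case: (c == O x); rewrite ?eqxx.
have -> : (c == O x) || ((if c == O x then Some (start M) else None) == None) by case: (c == O x).
rewrite /allowed_symbol; case: (ltnP c (O x)) => //= le_c.
rewrite nth_symbols size_pair_word.
case: (ltnP c (2 * size x + O x)) => [lt_c|ge_c].
  have -> : c - O x < (2 * size x).+1 + size y by lia.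
  by rewrite bit_isE nth_pair //; lia.
case: (c =P 2 * size x + O x) => [->|ne_c].
  by rewrite addnK nth_pair_even ltnn eqxx addSn ltnS leq_addr.
case: (leqP c (2 * size x + O x + P x)) => cmp.
  by case: ifP => // _; case: (nth _ _ _).
by have -> : (c - O x < (2 * size x).+1 + size y) = false by lia.
Qed.

Lemma allowed_unguessed c a b : allowed x c a -> allowed x c b -> ~~ guessed x c -> a = b.
Proof.
case: a b => [s h] [s' h']; rewrite /allowed /guessed /=.
move=> /andP[/andP[/eqP h1 h2] sa] /andP[/andP[/eqP h1' h2'] sb] ng.
have -> : h = h'.
  move: h1 h2 h1' h2'; case: (c == O x) => /= [e1 _ e2 _|_ /eqP-> _ /eqP-> //].
  by rewrite (eqP (esym e1)) (eqP (esym e2)).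
congr pair; move: sa sb; rewrite /allowed_symbol.
case: ltnP => _; first by move=> /eqP-> /eqP->.
case: ltnP => ge_c.
  by rewrite /bit_is; case: (~~ odd _ || _) => /=; rewrite ?orbF => /eqP-> /eqP->.
case: eqP => ne_c; first by move=> /eqP-> /eqP->.
by case: leqP => [|_ /eqP-> /eqP-> //]; lia.
Qed.

Lemma tableau_complete y : size y <= P x -> V (pair_word x y) ->
  msat (nvars x) (ncols x) (tab_pos x) (tab_neg x) (tab_free x).
Proof.
move=> le_y Vy; set z := pair_word x y.
(* The numbering of [vnum] is inverted: a variable is true if the actual run has this content in
   this cell at this time. *)
pose val i := code (actual z ((i %/ S) %/ W x) ((i %/ S) %% W x)) == i %% S.
have valE t c a : c < W x -> a < S -> val (vnum x t c a) = (code (actual z t c) == a).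
  move=> lt_c lt_a; have S_gt0 : 0 < S by apply: leq_ltn_trans lt_a.
  rewrite /val /vnum divnMDl // (divn_small lt_a) addn0 divnMDl ?W_gt0 //.
  by rewrite (divn_small lt_c) addn0 !modnMDl !modn_small.
have vnum_lt t c a : t <= T x -> c < W x -> a < S -> vnum x t c a < nvars x.
  by rewrite /vnum /nvars => *; nia.
exists val => j lt_j; rewrite /tab_free.
have c_lt : col_c x j < W x by rewrite ltn_pmod ?W_gt0.
have t_le : col_t x j <= T x by rewrite -ltnS ltn_pmod.
have k_lt : col_k x j < K by rewrite ltn_pmod ?K_gt0.
have add_lit i : i < nvars x -> (if tab_pos x i j then val i else tab_neg x i j && ~~ val i) ->
    has (fun i => if tab_pos x i j then val i else tab_neg x i j && ~~ val i) (iota 0 (nvars x)).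
  by move=> lt_i Hi; apply/hasP; exists i; rewrite ?mem_iota.
have [//|not_free] /= := boolP (free_col x _ _ _ _).
rewrite /tab_pos /tab_neg in add_lit *; move: not_free add_lit c_lt t_le k_lt.
move: (col_c x j) (col_t x j) (col_k x j) (col_fam x j) => c t k fam.
rewrite /free_col /pos_lit /neg_lit; case: fam => [|[|[|fam]]] /=.
- rewrite negbK => /andP[lt_t lt_c] add_lit _ _ _.
  have [eq1|/negbTE ne1] := boolP (code (actual z t c) == fst_code k); last first.
    apply: (add_lit (vnum x t c (fst_code k))); first by apply: vnum_lt; [lia|lia|apply: code_lt].
    rewrite eqxx valE ?ne1 ?code_lt //; last by lia.
    (* [msat] reads a variable that occurs with both signs as positive. No overlap arises here,
       since the positive literal belongs to the next row of the tableau. *)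
    case: eqP => // eq_v; have := code_lt (window (triple_of M k).1.1 (triple_of M k).1.2 (triple_of M k).2).
    by have := code_lt (triple_of M k).1.1; move: eq_v; rewrite /vnum /fst_code /window_code -/S; nia.
  have [eq2|/negbTE ne2] := boolP (code (actual z t c.+1) == snd_code k); last first.
    apply: (add_lit (vnum x t c.+1 (snd_code k))); first by apply: vnum_lt; [lia|lia|apply: code_lt].
    rewrite eqxx orbT valE ?ne2 ?code_lt //; last by lia.
    case: eqP => // eq_v; have := code_lt (window (triple_of M k).1.1 (triple_of M k).1.2 (triple_of M k).2).
    by have := code_lt (triple_of M k).1.2; move: eq_v; rewrite /vnum /snd_code /window_code -/S; nia.
  have [eq3|/negbTE ne3] := boolP (code (actual z t c.+2) == trd_code k); last first.
    apply: (add_lit (vnum x t c.+2 (trd_code k))); first by apply: vnum_lt; [lia|lia|apply: code_lt].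
    rewrite eqxx !orbT valE ?ne3 ?code_lt //.
    case: eqP => // eq_v; have := code_lt (window (triple_of M k).1.1 (triple_of M k).1.2 (triple_of M k).2).
    by have := code_lt (triple_of M k).2; move: eq_v; rewrite /vnum /trd_code /window_code -/S; nia.
  apply: (add_lit (vnum x t.+1 c.+1 (window_code k))); first by apply: vnum_lt; [lia|lia|apply: code_lt].
  rewrite eqxx valE ?code_lt //; last by lia.
  rewrite actual_step // /window_code.
  by rewrite (code_inj (eqP eq1)) (code_inj (eqP eq2)) (code_inj (eqP eq3)).
- move=> _ add_lit lt_c _ _; apply: (add_lit (vnum x 0 c (code (actual z 0 c)))).
    by apply: vnum_lt => //; apply: code_lt.
  rewrite ifT ?valE ?code_lt //; apply/hasP; exists (actual z 0 c); first by rewrite mem_enum.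
  by rewrite eqxx allowed_initial.
- rewrite negbK => /and3P[g1 g2 lt_c1] add_lit lt_c _ _.
  have [eq1|/negbTE ne1] := boolP (code (actual z 0 c) == code (blank M)); last first.
    apply: (add_lit (vnum x 0 c (code (blank M)))); first by apply: vnum_lt => //; apply: code_lt.
    rewrite eqxx valE ?ne1 ?code_lt //=.
    by case: eqP => //; rewrite /vnum; have := code_lt (blank M); rewrite -/S; nia.
  apply: (add_lit (vnum x 0 c.+1 (code (blank M)))); first by apply: vnum_lt => //; apply: code_lt.
  rewrite eqxx valE ?code_lt //; apply/eqP; congr code.
  move: (code_inj (eqP eq1)); rewrite /actual /= !cell_at_initial /blank !nth_symbols.
  have -> : O x <= c by move: g1; rewrite /guessed; lia.
  have -> : O x <= c.+1 by move: g1; rewrite /guessed; lia.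
  have -> : (c.+1 == O x) = false by move: g1; rewrite /guessed; lia.
  have -> : (c == O x) = false by move: g1; rewrite /guessed; lia.
  case: ltnP => // le1 _; case: ltnP => //.
  by move: g1 le1; rewrite /guessed; lia.
- rewrite negbK => rej add_lit lt_c _ _.
  apply: (add_lit (vnum x (T x) c (fst_code k))); first by apply: vnum_lt => //; apply: code_lt.
  rewrite eqxx valE ?code_lt //=; apply/eqP => /code_inj eq_a.
  move: rej; rewrite /rejecting -eq_a /actual /cell_at.
  case: ltngtP => //= _; rewrite final_scanned // Vy eqxx //.
Qed.

Lemma tableau_sound : msat (nvars x) (ncols x) (tab_pos x) (tab_neg x) (tab_free x) ->
  exists y, size y <= P x /\ V (pair_word x y).
Proof.
move=> [val Hval]; pose X t c (a : tcell M) := val (vnum x t c (code a)).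
have clause fam t c k : fam < 4 -> t <= T x -> c < W x -> k < K -> ~~ free_col x fam t c k ->
    exists i, if pos_lit x i fam t c k then val i else neg_lit x i fam t c k && ~~ val i.
  move=> lt_fam le_t lt_c lt_k nfree.
  have [] := col_index fam le_t lt_c lt_k; cbv zeta; set j := _ + k => e1 e2 e3 e4.
  have lt_j : j < ncols x by rewrite /ncols /j; nia.
  have := Hval j lt_j; rewrite /tab_free /tab_pos /tab_neg e1 e2 e3 e4 (negbTE nfree) /=.
  by case/hasP => i _ Hi; exists i.
have H0 t c a b d : t < T x -> c.+2 < W x -> X t c a -> X t c.+1 b -> X t c.+2 d ->
    X t.+1 c.+1 (window a b d).
  move=> lt_t lt_c Xa Xb Xd; have [k lt_k def_k] := triple_ofP (a, b, d).
  have [|||||i] := clause 0 t c k; rewrite //=; try by lia.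
    by rewrite /free_col /= lt_t lt_c.
  rewrite /pos_lit /neg_lit /= /window_code /fst_code /snd_code /trd_code def_k /=.
  case: eqP => [->//|_] /andP[/or3P[]/eqP->]; by [rewrite -/(X t c a) Xa|rewrite -/(X t c.+1 b) Xb|rewrite -/(X t c.+2 d) Xd].
have H1 c : c < W x -> exists2 a, allowed x c a & X 0 c a.
  move=> lt_c; have [|||||i] := clause 1 0 c 0 => //; first exact: K_gt0.
  by rewrite /pos_lit /neg_lit /=; case: hasP => // -[a _ /andP[/eqP-> al]] va; exists a.
have H2 c : guessed x c -> guessed x c.+1 -> c.+1 < W x -> X 0 c (blank M) -> X 0 c.+1 (blank M).
  move=> g1 g2 lt_c Xb; have [||||| i] := clause 2 0 c 0; rewrite /= ?K_gt0 //; try by lia.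
    by rewrite /free_col /= g1 g2 lt_c.
  rewrite /pos_lit /neg_lit /=; case: eqP => [->//|_ /andP[/eqP->]].
  by rewrite -/(X 0 c (blank M)) Xb.
have H3 c a : c < W x -> isSome a.2 -> a.1 != Some (inl true) -> ~~ X (T x) c a.
  move=> lt_c a2 a1; have [k lt_k def_k] := triple_ofP (a, a, a).
  have [|||||i] := clause 3 0 c k; rewrite //=.
    by rewrite /free_col /= /rejecting def_k /= a2 a1.
  by rewrite /pos_lit /neg_lit /= /fst_code def_k /= => /andP[/eqP->].
pose g0 := (2 * size x + O x).+1.
(* The certificate is read off the first row up to its first blank. If the time bound is small, the
   tableau may be narrower than the input, and only the bits that fit into it are read. *)
pose len := find (fun g => X 0 (g0 + g) (blank M)) (iota 0 (minn (P x) (W x - g0))).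
pose y := mkseq (fun g => X 0 (g0 + g) (Some (inl true), None)) len.
have len_le : len <= minn (P x) (W x - g0) by rewrite -[leqRHS](size_iota 0) find_size.
have y_size : size y <= P x by rewrite size_mkseq; apply: leq_trans len_le (geq_minl _ _).
exists y; split=> //; set z := pair_word x y.
have X_init c : c < W x -> X 0 c (actual z 0 c).
  move=> lt_c; have [a al Xa] := H1 c lt_c.
  have [g|ng] := boolP (guessed x c); last by rewrite (allowed_unguessed (allowed_initial c y_size) al ng).
  have [lt_g0 le_P] := andP g.
  have def_act : actual z 0 c = (if c - g0 < len then Some (inl (nth false y (c - g0))) else None, None).
    rewrite /actual /= cell_at_initial nth_symbols.
    have -> : O x <= c by lia.
    have -> : (c == O x) = false by lia.
    have -> : c - O x = (2 * size x).+1 + (c - g0) by rewrite /g0; lia.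
    by rewrite nth_pair_snd size_pair_word ltn_add2l size_mkseq.
  have def_c : c = g0 + (c - g0) by rewrite /g0; lia.
  have lt_min : c - g0 < minn (P x) (W x - g0) by rewrite /g0; lia.
  rewrite def_act; case: ltnP => [lt_len|le_len]; last first.
    rewrite {1}def_c -/(blank M).
    have Xlen : X 0 (g0 + len) (blank M).
      have := @nth_find _ 0 (fun g => X 0 (g0 + g) (blank M)) (iota 0 (minn (P x) (W x - g0))).
      rewrite has_find size_iota -/len => /(_ (leq_ltn_trans le_len lt_min)).
      by rewrite nth_iota // (leq_ltn_trans le_len lt_min).
    have : len <= c - g0 < minn (P x) (W x - g0) by rewrite le_len.
    elim: (c - g0) => [|g' IH] /andP[le1 lt1]; first by move: Xlen; have -> : len = 0 by lia.
    move: le1; rewrite leq_eqVlt => /orP[/eqP<-//|lt1'].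
    rewrite addnS; apply: H2; rewrite /guessed /=; try by rewrite /g0 in lt1 *; lia.
    by apply: IH; lia.
  have := @before_find _ 0 (fun g => X 0 (g0 + g) (blank M)) (iota 0 (minn (P x) (W x - g0))) (c - g0).
  rewrite -/len nth_iota // add0n -def_c => /(_ lt_len) /negbT nB.
  rewrite nth_mkseq // -def_c; case: (boolP (X 0 c (Some (inl true), None))) => // nX1.
  case: a al Xa => [s h] /andP[/andP[_ h2]]; rewrite /allowed_symbol /=.
  have -> : (c < O x) = false by lia.
  have -> : (c < 2 * size x + O x) = false by lia.
  have -> : (c == 2 * size x + O x) = false by lia.
  rewrite le_P; move: h2; have -> : (c == O x) = false by lia.
  move=> /= /eqP-> /or3P[]/eqP-> Xc; last exact: Xc.
    by rewrite /blank Xc in nB.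
  by rewrite Xc in nX1.
have X_all t c : t <= T x -> t <= c -> c + t < W x -> X t c (actual z t c).
  elim: t c => [|t IH] [|c] //.
    by move=> _ _; rewrite addn0; apply: X_init.
    by move=> _ _; rewrite addn0; apply: X_init.
  move=> lt_t le_c lt_c; rewrite actual_step //.
  by apply: H0 => //; [lia|apply: IH; lia|apply: IH; lia|apply: IH; lia].
set h := head_at (initial M z) (O x) (T x).
have [h1 h2] : O x - T x <= h /\ h <= O x + T x.
  by apply/andP; apply: head_at_bound; rewrite /O; lia.
have XT := X_all (T x) h (leqnn _); rewrite /actual -/h /cell_at ltnn eqxx in XT.
rewrite final_scanned // in XT.
apply: contraT => nV; rewrite (negbTE nV) in XT.
have : X (T x) h (Some (inl false), Some (current (iter (T x) (@step M) (initial M z)))).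
  by apply: XT; rewrite /W; rewrite /O in h1 h2; lia.
by rewrite (negbTE (H3 _ _ _ _ _)) // /W; rewrite /O in h1 h2; lia.
Qed.

End Correct.

End CookLevin.

Theorem NP_msat (L : word -> Prop) : in_NP (language L) ->
  exists n m pos neg free,
    [/\ df0 n, df0 m, dfb2 pos, dfb2 neg & dfb1 free] /\
    forall x, [/\ 0 < n x, 0 < m x & (L x <-> msat (n x) (m x) (pos x) (neg x) (free x))].
Proof.
move=> [V [p [[M [q halt_M]] HL]]].
exists (nvars M q p), (ncols M q p), (tab_pos M q p), (tab_neg M q p), (tab_free M q p).
split.
  split; [exact: df_nvars|exact: df_ncols|exact: dfb_tab_pos|exact: dfb_tab_neg|exact: dfb_tab_free].
move=> x; split.
- rewrite !muln_gt0 addn1 /=; apply/card_gt0P; by exists (blank M).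
- by rewrite !muln_gt0 addn1 /= K_gt0.
- apply: iff_trans (HL x I) _; split=> [[y [le_y Vy]]|/tableau_sound].
    exact: tableau_complete le_y Vy.
  exact.
Qed.

(** * The crossing gadget *)

Inductive piece := Net | Pair | Single.

Definition piece_size k := match k with Net => 6 | Pair => 2 | Single => 1 end.

(* The least sum of a colouring of the piece. *)
Definition piece_cost k := match k with Net => 10 | Pair => 3 | Single => 1 end.

(* [Net] is a triangle (vertices 0, 1, 2) with a pendant vertex (3, 4, 5) at
   each corner. In its optimal colourings exactly one pendant vertex has
   colour 2 and the other two have colour 1. *)
Definition piece_edges k : seq (nat * nat) :=
  match k with
  | Net => [:: (1, 0); (2, 0); (2, 1); (3, 0); (4, 1); (5, 2)]
  | Pair => [:: (1, 0)]
  | Single => [::]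
  end.

Definition optima k : seq (seq nat) :=
  match k with
  | Net => [:: [:: 1; 2; 3; 2; 1; 1]; [:: 1; 3; 2; 2; 1; 1]; [:: 2; 1; 3; 1; 2; 1];
               [:: 3; 1; 2; 1; 2; 1]; [:: 2; 3; 1; 1; 1; 2]; [:: 3; 2; 1; 1; 1; 2]]
  | Pair => [:: [:: 1; 2]; [:: 2; 1]]
  | Single => [:: [:: 1]]
  end.

(** The only conflict that survives subdivision: after normalisation two neighbours may both have
    colour 3, but not both 1 or both 2. *)
Definition clash a b := (a == b) && ((a == 1) || (a == 2)).

(* The gadget placed at every crossing of a row with a column: its vertices
   are numbered piece by piece, and each piece comes with its edges to itself
   and to earlier pieces. *)
Definition gadget : seq (piece * seq (nat * nat)) := [::
  (Pair, [:: (1, 0)]);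
  (Single, [::]);
  (Single, [::]);
  (Pair, [:: (4, 1); (5, 4)]);
  (Pair, [:: (7, 6)]);
  (Pair, [:: (8, 6); (9, 8)]);
  (Pair, [:: (10, 9); (11, 0); (11, 10)]);
  (Pair, [:: (12, 5); (13, 12)]);
  (Pair, [:: (15, 14)]);
  (Net, [:: (17, 16); (18, 16); (18, 17); (19, 6); (19, 16); (20, 14); (20, 17); (21, 18)]);
  (Pair, [:: (22, 21); (23, 22)]);
  (Pair, [:: (24, 23); (25, 24)]);
  (Pair, [:: (26, 25); (27, 26)]);
  (Pair, [:: (29, 28)]);
  (Pair, [:: (30, 27); (31, 28); (31, 30)]);
  (Pair, [:: (32, 15); (33, 32)]);
  (Pair, [:: (35, 34)]);
  (Net, [:: (37, 36); (38, 36); (38, 37); (39, 34); (39, 36); (40, 37); (41, 38)]);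
  (Single, [::]);
  (Pair, [:: (43, 40); (44, 43)]);
  (Pair, [:: (46, 34); (46, 45)]);
  (Pair, [:: (48, 43); (48, 47)]);
  (Pair, [:: (50, 47); (50, 49)]);
  (Pair, [:: (51, 41); (52, 51)]);
  (Pair, [:: (54, 53)]);
  (Pair, [:: (56, 45); (56, 55)]);
  (Net, [:: (58, 57); (59, 57); (59, 58); (60, 49); (60, 57); (61, 58); (62, 53); (62, 59)]);
  (Pair, [:: (63, 54); (64, 63)]);
  (Pair, [:: (66, 61); (66, 65)]);
  (Pair, [:: (67, 64); (68, 67)]);
  (Pair, [:: (70, 65); (70, 69)]);
  (Pair, [:: (72, 69); (72, 71)]);
  (Pair, [:: (73, 71); (74, 73)]);
  (Pair, [:: (75, 60); (76, 75)]);
  (Pair, [:: (78, 77)]);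
  (Net, [:: (80, 79); (81, 79); (81, 80); (82, 75); (82, 79); (83, 73); (83, 77); (83, 80); (84, 81)]);
  (Pair, [:: (85, 78); (86, 85)]);
  (Pair, [:: (88, 84); (88, 87)]);
  (Pair, [:: (90, 87); (90, 89)]);
  (Net, [:: (92, 91); (93, 91); (93, 92); (94, 91); (95, 55); (95, 92); (96, 89); (96, 93)]);
  (Pair, [:: (98, 95); (98, 97)]);
  (Pair, [:: (99, 94); (100, 99)]);
  (Pair, [:: (102, 94); (102, 101)]);
  (Pair, [:: (103, 101); (104, 103)]);
  (Pair, [:: (106, 97); (106, 105)]);
  (Pair, [:: (108, 103); (108, 107)]);
  (Pair, [:: (109, 99); (110, 109)]);
  (Pair, [:: (111, 105); (112, 111)]);
  (Pair, [:: (113, 110); (114, 113)]);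
  (Pair, [:: (116, 115)]);
  (Pair, [:: (117, 116); (118, 117)]);
  (Pair, [:: (119, 118); (120, 119)]);
  (Net, [:: (122, 121); (123, 121); (123, 122); (124, 107); (124, 121); (125, 111); (125, 122); (126, 115); (126, 123)]);
  (Pair, [:: (127, 126); (128, 127)]);
  (Pair, [:: (129, 128); (130, 129)]);
  (Pair, [:: (131, 130); (132, 131)]);
  (Net, [:: (134, 133); (135, 133); (135, 134); (136, 32); (136, 133); (137, 52); (137, 134); (138, 135)]);
  (Net, [:: (140, 139); (141, 139); (141, 140); (142, 85); (142, 139); (143, 114); (143, 140); (144, 141)]);
  (Pair, [:: (145, 144); (146, 145)]);
  (Net, [:: (148, 147); (149, 147); (149, 148); (150, 28); (150, 147); (151, 148); (152, 149)])].

(** [vW] and [vE] lie at the same height on the left and right sides of a 22 by 28 box, [vN] and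
    [vS] in the same column on its first and last rows. Translated copies of the box therefore join
    along lattice edges. *)
Definition positions : seq (nat * nat) := [::
  (11, 25); (10, 25); (9, 1); (7, 26); (10, 26); (9, 26); (12, 21); (13, 22); (12, 22);
  (12, 23); (11, 23); (11, 24); (8, 26); (8, 27); (14, 20); (14, 19); (14, 22); (15, 22);
  (15, 23); (13, 21); (15, 21); (14, 23); (15, 24); (16, 24); (16, 23); (17, 23); (18,
  23); (18, 22); (18, 20); (19, 20); (19, 22); (18, 21); (13, 19); (13, 20); (11, 14);
  (11, 15); (10, 15); (9, 15); (10, 16); (10, 14); (8, 14); (10, 17); (17, 16); (8, 13);
  (9, 14); (11, 12); (11, 13); (7, 11); (8, 12); (6, 9); (7, 10); (9, 17); (8, 17); (5,
  10); (4, 10); (13, 12); (12, 12); (4, 8); (3, 8); (4, 9); (5, 8); (3, 7); (5, 9); (3,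
  9); (2, 8); (4, 6); (3, 6); (1, 8); (0, 8); (6, 6); (5, 6); (8, 7); (7, 7); (9, 7); (9,
  6); (6, 8); (5, 7); (10, 7); (10, 6); (8, 8); (9, 8); (9, 9); (7, 8); (10, 8); (8, 9);
  (9, 5); (10, 5); (10, 10); (9, 10); (12, 10); (11, 10); (14, 10); (14, 11); (13, 10);
  (13, 9); (14, 12); (13, 11); (15, 12); (15, 13); (12, 8); (11, 8); (14, 8); (13, 8);
  (14, 7); (13, 6); (15, 10); (15, 11); (16, 8); (15, 7); (12, 7); (12, 6); (15, 9); (16,
  10); (11, 5); (11, 4); (19, 11); (20, 11); (20, 10); (20, 9); (21, 9); (21, 8); (18, 9);
  (17, 9); (18, 10); (17, 8); (16, 9); (18, 11); (18, 12); (18, 13); (18, 14); (18, 15);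
  (18, 16); (19, 17); (11, 19); (10, 18); (10, 19); (12, 19); (9, 18); (11, 20); (8, 3);
  (9, 3); (8, 2); (8, 4); (10, 4); (9, 2); (8, 1); (8, 0); (19, 19); (19, 18); (18, 18);
  (18, 19); (18, 17); (17, 17)].

(** Row signals pass through [vW] and [vE], column signals through [vN] and [vS]. The vertices
    [vPos], [vNeg], [vZero] are lattice neighbours of [vL], likewise [vTop] of [vN] and [vBot] of
    [vS], so one additional edge configures a cell without spoiling planarity. *)
Definition vW := 68.
Definition vE := 120.
Definition vN := 146.
Definition vS := 13.
Definition vL := 151.
Definition vPos := 131.
Definition vNeg := 132.
Definition vZero := 42.
Definition vTop := 2.
Definition vBot := 3.


Definition gadget_edges := flatten (unzip2 gadget).

Fixpoint sizes (gs : seq (piece * seq (nat * nat))) :=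
  if gs is (k, _) :: gs then piece_size k + sizes gs else 0.

Fixpoint costs (gs : seq (piece * seq (nat * nat))) :=
  if gs is (k, _) :: gs then piece_cost k + costs gs else 0.

Definition nverts := sizes gadget.
Definition gadget_cost := costs gadget.

Definition all_tuples n := iter n (fun ts => [seq c :: t | c <- [:: 1; 2; 3], t <- ts]) [:: [::]].

Lemma all_tuplesP n (s : seq nat) : size s = n -> all (fun c => 0 < c <= 3) s -> s \in all_tuples n.
Proof.
elim: n s => [|n IH] [|c s] // [sz] /andP[c3 s3].
rewrite /all_tuples iterS -/(all_tuples n); apply: allpairs_f; last exact: IH.
by case: c c3 => [|[|[|[|c]]]].
Qed.

Definition no_clash (es : seq (nat * nat)) (f : nat -> nat) :=
  all (fun e => ~~ clash (f e.1) (f e.2)) es.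

Lemma piece_optimal k s : size s = piece_size k -> all (fun c => 0 < c <= 3) s ->
  no_clash (piece_edges k) (nth 0 s) ->
  piece_cost k <= sumn s ?= iff (s \in optima k).
Proof.
move=> sz s3 nc.
have : all (fun s => no_clash (piece_edges k) (nth 0 s) ==>
    (piece_cost k <= sumn s) && ((piece_cost k == sumn s) == (s \in optima k))) (all_tuples (piece_size k)).
  by case: k {sz nc}; vm_compute.
by move/allP => /(_ s (all_tuplesP sz s3)); rewrite nc => /andP[le_s /eqP eq_s]; split.
Qed.

Fixpoint tight (gs : seq (piece * seq (nat * nat))) o (f : nat -> nat) :=
  if gs is (k, _) :: gs then
    (mkseq (fun t => f (o + t)) (piece_size k) \in optima k) && tight gs (o + piece_size k) f
  else true.

Fixpoint has_piece_edges (gs : seq (piece * seq (nat * nat))) o :=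
  if gs is (k, es) :: gs then
    all (fun e => (o + e.1, o + e.2) \in es) (piece_edges k) && has_piece_edges gs (o + piece_size k)
  else true.

Lemma costs_tight gs o f : has_piece_edges gs o ->
  (forall a, 0 < f a <= 3) -> no_clash (flatten (unzip2 gs)) f ->
  costs gs <= sumn (mkseq (fun t => f (o + t)) (sizes gs)) ?= iff tight gs o f.
Proof.
move=> + f3; elim: gs o => [|[k es] gs IH] o /=; first by move=> _ _; split.
move=> /andP[hk hgs]; rewrite /no_clash all_cat => /andP[nc1 nc2].
rewrite /mkseq iotaD map_cat sumn_cat; apply: leqif_add.
  apply: piece_optimal; first by rewrite size_map size_iota.
    by apply/allP => c /mapP[t _ ->].
  apply/allP => e e_k; have := allP nc1 _ (allP hk _ e_k); rewrite /=.
  have bound : all (fun e => (e.1 < piece_size k) && (e.2 < piece_size k)) (piece_edges k) by case: (k).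
  by have /andP[lt1 lt2] := allP bound _ e_k; rewrite !(nth_map 0) ?size_iota // !nth_iota.
have := IH (o + piece_size k) hgs nc2; rewrite add0n /mkseq.
rewrite -[in X in _ -> leqif _ X _](addn0 (piece_size k)) iotaDl -map_comp.
by congr (leqif _ (sumn _) _); apply: eq_map => t /=; rewrite addnA.
Qed.

(** Backtracking over the optima of the pieces. An edge is tested as soon as its later piece is
    coloured, and this early pruning keeps the exhaustive search small enough to compute. *)
Fixpoint search_all (gs : seq (piece * seq (nat * nat))) (acc : seq nat) (Q : pred (seq nat)) : bool :=
  if gs is (k, es) :: gs then
    all (fun s => let acc' := acc ++ s in
      if no_clash es (nth 0 acc') then search_all gs acc' Q else true) (optima k)
  else Q acc.

Lemma search_allP gs o f Q acc : acc = mkseq f o -> search_all gs acc Q -> tight gs o f ->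
  no_clash (flatten (unzip2 gs)) f -> Q (mkseq f (o + sizes gs)).
Proof.
move=> ->; elim: gs o => [|[k es] gs IH] o /=; first by rewrite addn0.
move=> /allP all_k /andP[opt_k tight_gs]; rewrite /no_clash all_cat => /andP[nc1 nc2].
have := all_k _ opt_k.
have -> : mkseq f o ++ mkseq (fun t => f (o + t)) (piece_size k) = mkseq f (o + piece_size k).
  rewrite /mkseq iotaD map_cat; congr cat.
  by rewrite add0n -[in RHS](addn0 o) iotaDl -map_comp.
rewrite ifT => [ok|]; first by rewrite addnA; apply: IH.
apply/allP => e /(allP nc1); set s := mkseq _ _.
(* Vertices that are not coloured yet have the default colour 0, which clashes with nothing. *)
have nthE i : nth 0 s i = if i < o + piece_size k then f i else 0.
  by case: ltnP => [lt_i|le_i]; [rewrite nth_mkseq|rewrite nth_default ?size_mkseq].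
rewrite !nthE; case: ifP; case: ifP => // _ _ _; rewrite /clash; first by case: (f e.1).
by rewrite eq_sym; case: (f e.2).
Qed.

(** Serves to compute the table in [gadget_colouring], with the empty list for failure. It needs no
    correctness proof, because [good_colouring] checks the table. *)
Fixpoint find_first (gs : seq (piece * seq (nat * nat))) (acc : seq nat) (Q : pred (seq nat)) : seq nat :=
  if gs is (k, es) :: gs then
    foldr (fun s r => let acc' := acc ++ s in
      if r is _ :: _ then r else
      if all (fun e => nth 0 acc' e.1 != nth 0 acc' e.2) es then find_first gs acc' Q else [::])
      [::] (optima k)
  else if Q acc then acc else [::].

Definition bit_colour (b : bool) := if b then 2 else 1.

(* [h]: row signal, [v]: column signal from above, [l]: literal. *)
Definition ports h v l (c : nat -> nat) :=
  [&& c vW == bit_colour h, c vE == bit_colour (~~ h), c vN == bit_colour (~~ v),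
      c vS == bit_colour (v || l) &
  [&& c vL == bit_colour (~~ l), c vPos == bit_colour h, c vNeg == bit_colour (~~ h) &
  [&& c vZero == 1, c vTop == 1 & c vBot == 1]]].

Definition gadget_colouring (h v l : bool) := Eval vm_compute in
  let t := [seq [seq [seq find_first gadget [::] (fun c => ports h v l (nth 0 c)) | l <- [:: false; true]]
    | v <- [:: false; true]] | h <- [:: false; true]] in
  nth [::] (nth [::] (nth [::] t h) v) l.

Definition good_colouring (h v l : bool) :=
  let c := gadget_colouring h v l in
  [&& size c == nverts, sumn c == gadget_cost, all (fun a => 0 < a) c,
      all (fun e => nth 0 c e.1 != nth 0 c e.2) gadget_edges & ports h v l (nth 0 c)].

Lemma gadget_colouringP h v l : good_colouring h v l.
Proof. by case: h; case: v; case: l; vm_compute. Qed.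

(** At [vN] and [vL] colour 1 means true, at [vS] colour 2 does. The disjunction says that a true
    signal leaves only if one enters or the literal is true; nothing forces a true signal to
    leave. *)
Definition relation_ok (s : seq nat) :=
  let c := nth 0 s in
  [&& c vW \in [:: 1; 2], c vE == 3 - c vW, c vN \in [:: 1; 2], c vS \in [:: 1; 2] &
  [&& c vL \in [:: 1; 2], c vPos == c vW, c vNeg == 3 - c vW,
      [|| c vS == 1, c vN == 1 | c vL == 1] &
  [&& c vZero == 1, c vTop == 1 & c vBot == 1]]].

Lemma gadget_relation : search_all gadget [::] relation_ok.
Proof. by vm_compute. Qed.

Lemma gadget_pieces : has_piece_edges gadget 0.
Proof. by vm_compute. Qed.

Lemma gadget_tight f : tight gadget 0 f -> no_clash gadget_edges f -> relation_ok (mkseq f nverts).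
Proof.
have nil_f : [::] = mkseq f 0 by [].
move=> tight_f nc; have := search_allP nil_f gadget_relation tight_f nc.
by rewrite add0n.
Qed.

(** * Straight-line drawings *)

(** Only one diagonal of each unit square is a step, since the two diagonals of a square would
    cross. *)
Definition lattice_step (p q : nat * nat) :=
  [|| q == (p.1.+1, p.2), q == (p.1, p.2.+1) | q == (p.1.+1, p.2.+1)].

(* Adjacency in the triangular lattice. *)
Definition lattice_adj p q := lattice_step p q || lattice_step q p.

Section LatticePlanar.
Import Order.TTheory GRing.Theory Num.Theory numFieldNormedType.Exports.
Local Open Scope ring_scope.
Variable R : realType.

Definition segment (p q : nat * nat) (t : R) : R * R :=
  ((1 - t) * p.1%:R + t * q.1%:R, (1 - t) * p.2%:R + t * q.2%:R).

Lemma continuous_segment p q : continuous (segment p q).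
Proof.
have cts (a b : R) : continuous (fun t : R => (1 - t) * a + t * b).
  move=> t; apply: cvgD; apply: cvgM; try exact: cvg_cst; last exact: cvg_id.
  by apply: cvgB; [exact: cvg_cst|exact: cvg_id].
by move=> t; exact: (cvg_pair (cts _ _ t) (cts _ _ t)).
Qed.

Lemma segment_rev p q t : segment q p t = segment p q (1 - t).
Proof. by rewrite /segment; congr pair; ring. Qed.

Lemma segment_step p q t : lattice_adj p q -> 0 < t < 1 ->
  exists p0 q0 t0, [/\ lattice_step p0 q0, 0 < t0 < 1, segment p q t = segment p0 q0 t0 &
    (p, q) = (p0, q0) \/ (p, q) = (q0, p0)].
Proof.
move=> /orP[pq|qp] t01; first by exists p, q, t; split=> //; left.
exists q, p, (1 - t); split=> //; last by right.
  by lra.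
by rewrite segment_rev.
Qed.

Lemma nat_frac (a b : nat) (s t : R) : 0 < s < 1 -> 0 <= t < 1 ->
  a%:R + s = b%:R + t -> a = b /\ s = t.
Proof.
move=> s01 t01 eq_st; have eq_ab : a = b; last first.
  by split=> //; move: eq_st; rewrite eq_ab => /addrI.
case: (ltngtP a b) => // lt_ab; exfalso.
  have : (a.+1%:R <= b%:R :> R) by rewrite ler_nat.
  by rewrite -natr1 => {lt_ab}; lra.
have : (b.+1%:R <= a%:R :> R) by rewrite ler_nat.
by rewrite -natr1 => {lt_ab}; lra.
Qed.

Lemma stepE (p q : nat * nat) : lattice_step p q ->
  exists2 d : bool * bool, d.1 || d.2 & q = ((p.1 + d.1)%N, (p.2 + d.2)%N) /\
    forall t, segment p q t = (p.1%:R + d.1%:R * t, p.2%:R + d.2%:R * t).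
Proof.
case: p => a b /or3P[]/eqP->; [exists (true, false)|exists (false, true)|exists (true, true)] => //=;
  rewrite ?addn0 ?addn1; split=> // t; rewrite /segment /= -?natr1; congr pair; ring.
Qed.

(** Inside a step a coordinate is fractional exactly if the step moves in it. So the fractional
    parts of a point give the direction, and the integer parts give the starting point of the
    step. *)
Lemma segment_meet p q p' q' s t : lattice_step p q -> lattice_step p' q' ->
  0 < s < 1 -> 0 < t < 1 -> segment p q s = segment p' q' t -> (p, q) = (p', q').
Proof.
move=> /stepE[d d12 [-> ->]] /stepE[d' d12' [-> ->]] s01 t01.
have s01' : 0 <= s < 1 by lra.
have t01' : 0 <= t < 1 by lra.
have z01 : (0 : R) <= (0 : R) < (1 : R) by rewrite lexx ltr01.
have same (a b : nat) (e e' : bool) : a%:R + e%:R * s = b%:R + e'%:R * t -> a = b /\ e = e'.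
  case: e; case: e'; rewrite ?mul1r ?mul0r ?addr0.
  - by move=> /nat_frac[].
  - by rewrite -[X in _ = X]addr0 => /nat_frac[] // _ s0; move: s01; rewrite s0 ltxx.
  - by move/esym; rewrite -[X in _ = X]addr0 => /nat_frac[] // _ t0; move: t01; rewrite t0 ltxx.
  - by move/eqP; rewrite eqr_nat => /eqP.
move=> [/same[e1 e2] /same[e3 e4]].
by case: p e1 e3 => ? ? /= -> ->; case: d d12 e2 e4 => ? ? /= _ -> ->; case: p'.
Qed.

Lemma segment_off_lattice p q (r : nat * nat) t : lattice_step p q -> 0 < t < 1 ->
  segment p q t <> (r.1%:R, r.2%:R).
Proof.
move=> /stepE[d d12 [_ ->]] t01.
have off (a b : nat) : a%:R + t = b%:R -> False.
  by rewrite -[X in _ = X]addr0 => /nat_frac[] //; [lra|move=> _ t0]; move: t01; rewrite t0 ltxx.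
by move=> [e1 e2]; case/orP: d12 => Hd; move: e1 e2; rewrite Hd mul1r; [move/off|move=> _ /off].
Qed.

Lemma lattice_planar (G : sgraph) (pos : G -> nat * nat) : injective pos ->
  (forall u v, adj u v -> lattice_adj (pos u) (pos v)) -> planar R G.
Proof.
move=> pos_inj pos_adj.
exists (fun u => ((pos u).1%:R, (pos u).2%:R)), (fun u v => segment (pos u) (pos v)); split.
- move=> u v [] /eqP; rewrite eqr_nat => /eqP e1 /eqP; rewrite eqr_nat => /eqP e2.
  by apply: pos_inj; rewrite [pos u]surjective_pairing e1 e2 -surjective_pairing.
- move=> u v /pos_adj uv; split.
  + by apply: continuous_subspaceT; apply: continuous_segment.
  + have step_inj p q : lattice_step p q -> injective (segment p q).
      move=> pq s t; have /stepE[d d12 [_ segE]] := pq.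
      rewrite !segE => -[/addrI e1 /addrI e2].
      by case/orP: d12 => Hd; move: e1 e2; rewrite Hd !mul1r.
    case/orP: uv => [/step_inj inj|/step_inj inj] s t _ _; first exact: inj.
    rewrite segment_rev [RHS]segment_rev => /inj /eqP.
    by rewrite (inj_eq (addrI 1)) eqr_opp => /eqP.
  + by rewrite /segment; split; congr pair; ring.
  + by move=> t _; rewrite segment_rev.
- move=> u v w /pos_adj uv t; rewrite in_itv /= => t01.
  have [p [q [s [pq s01 -> _]]]] := segment_step uv t01.
  exact: segment_off_lattice.
- move=> u v u' v' /pos_adj uv /pos_adj uv' n1 n2 s t.
  rewrite !in_itv /= => s01 t01.
  have [p [q [s0 [pq s001 -> Hpq]]]] := segment_step uv s01.
  have [p' [q' [t0 [pq' t001 -> Hpq']]]] := segment_step uv' t01.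
  move=> /(segment_meet pq pq' s001 t001) [ep eq].
  rewrite -ep -eq in Hpq'.
  case: Hpq Hpq' => -[e1 e2] [] [e1' e2'].
  + by apply: n1; congr pair; apply: pos_inj; rewrite ?e1 ?e2.
  + by apply: n2; congr pair; apply: pos_inj; rewrite ?e1 ?e2.
  + by apply: n2; congr pair; apply: pos_inj; rewrite ?e1 ?e2.
  + by apply: n1; congr pair; apply: pos_inj; rewrite ?e1 ?e2.
Qed.

End LatticePlanar.

(** * The grid of gadgets *)

Definition nat_graph N (e : rel nat) (e_sym : symmetric e) (e_irr : irreflexive e) : sgraph :=
  @SGraph 'I_N (fun u v => e u v) (fun u v => e_sym u v) (fun u => e_irr u).

(* The first edge reads a literal into [vL]: it ends in [vPos], [vNeg] or
   [vZero] for a positive, negative or absent literal. The others force the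
   signal entering from above to be false (in the top row) and the signal
   leaving below to be true (in the bottom row). *)
Definition switches (top bot lp ln : bool) : seq (nat * nat) :=
  (vL, if lp then vPos else if ln then vNeg else vZero) ::
  (if top then [:: (vN, vTop)] else [::]) ++ (if bot then [:: (vS, vBot)] else [::]).

Definition cell_edges top bot lp ln := gadget_edges ++ switches top bot lp ln.

Definition bools := [:: false; true].

Lemma mem_bools b : b \in bools. Proof. by case: b. Qed.

Definition all_switches (P : bool -> bool -> bool -> bool -> bool) :=
  all (fun t => all (fun b => all (fun p => all (P t b p) bools) bools) bools) bools.

Lemma all_switchesP P t b p q : all_switches P -> P t b p q.
Proof.
move=> /allP /(_ t (mem_bools t)) /allP /(_ b (mem_bools b)).
by move=> /allP /(_ p (mem_bools p)) /allP /(_ q (mem_bools q)).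
Qed.

Lemma cell_edges_bound t b p q : all (fun e => [&& e.1 < nverts, e.2 < nverts & e.1 != e.2]) (cell_edges t b p q).
Proof.
apply: (@all_switchesP (fun t b p q =>
  all (fun e => [&& e.1 < nverts, e.2 < nverts & e.1 != e.2]) (cell_edges t b p q))).
by vm_compute.
Qed.

Definition cell_nbrs t b p q a :=
  [seq e.2 | e <- cell_edges t b p q & e.1 == a] ++ [seq e.1 | e <- cell_edges t b p q & e.2 == a].

(** The port terms count the edges to adjacent cells, as if the right, left and lower ones always
    existed. At [vN] the edge from above and the edge to [vTop] exclude each other. All 16 switch
    settings are checked by computation. *)
Lemma cell_degree t b p q a : a < nverts ->
  size (cell_nbrs t b p q a) + ((a == vE) + ((a == vW) + ((a == vS) + ((a == vN) && ~~ t)))) <= 3.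
Proof.
move=> lt_a; have : all_switches (fun t b p q => all (fun a =>
    size (cell_nbrs t b p q a) + ((a == vE) + ((a == vW) + ((a == vS) + ((a == vN) && ~~ t)))) <= 3) (iota 0 nverts)).
  by vm_compute.
by move/(@all_switchesP _ t b p q)/allP; apply; rewrite mem_iota.
Qed.

Definition cell_pos a := nth (0, 0) positions a.
Definition cell_width := 22.
Definition cell_height := 28.

Lemma cell_edges_lattice t b p q :
  all (fun e => lattice_adj (cell_pos e.1) (cell_pos e.2)) (cell_edges t b p q).
Proof.
apply: (@all_switchesP (fun t b p q =>
  all (fun e => lattice_adj (cell_pos e.1) (cell_pos e.2)) (cell_edges t b p q))).
by vm_compute.
Qed.

Lemma positions_uniq : uniq positions.
Proof. by vm_compute. Qed.

Lemma size_positions : size positions = nverts.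
Proof. by vm_compute. Qed.

Lemma positions_bound : all (fun p => (p.1 < cell_width) && (p.2 < cell_height)) positions.
Proof. by vm_compute. Qed.

Lemma lattice_adj_shift a b p q : lattice_adj p q ->
  lattice_adj (a + p.1, b + p.2) (a + q.1, b + q.2).
Proof.
rewrite /lattice_adj /lattice_step !xpair_eqE /= -!addnS !eqn_add2l.
by case: p q => ? ? [? ?]; rewrite !xpair_eqE.
Qed.

Lemma sum_nat_mul k b (F : nat -> nat) :
  \sum_(0 <= u < k * b) F u = \sum_(0 <= i < k) \sum_(0 <= a < b) F (i * b + a).
Proof.
elim: k => [|k IH]; first by rewrite !big_nil.
rewrite mulSnr (@big_cat_nat _ _ _ (k * b)) ?leq_addr //= IH big_nat_recr //=; congr addn.
by rewrite -{1}[k * b]add0n big_addn addKn; apply: eq_bigr => a _; rewrite addnC.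
Qed.

Section Grid.
Variables (n m : nat) (pos neg : nat -> nat -> bool) (free : nat -> bool).
Hypotheses (n_gt0 : 0 < n) (m_gt0 : 0 < m).

Definition idx i j a := (i * m + j) * nverts + a.
Definition row u := u %/ (nverts * m).
Definition col u := (u %/ nverts) %% m.
Definition loc u := u %% nverts.
Definition grid_size := n * m * nverts.

(** A free column has no edge to [vTop], so its signal may enter as true. *)
Definition edges_at i j :=
  cell_edges ((i == 0) && ~~ free j) (i.+1 == n) (pos i j) (neg i j).

Definition arc u v :=
  [|| [&& row u == row v, col u == col v & (loc u, loc v) \in edges_at (row u) (col u)],
      [&& row u == row v, (col u).+1 == col v, loc u == vE & loc v == vW]
    | [&& (row u).+1 == row v, col u == col v, loc u == vS & loc v == vN]].

Definition grid_adj u v := arc u v || arc v u.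

Lemma grid_adj_sym : symmetric grid_adj.
Proof. by move=> u v; rewrite /grid_adj orbC. Qed.

Lemma grid_adj_irr : irreflexive grid_adj.
Proof.
move=> u; rewrite /grid_adj orbb /arc !eqxx !(gtn_eqF (ltnSn _)) /= orbF.
apply/negbTE/negP => /(allP (cell_edges_bound _ _ _ _)).
by rewrite /= eqxx !andbF.
Qed.

Definition grid_graph := nat_graph grid_size grid_adj_sym grid_adj_irr.

Lemma loc_lt u : loc u < nverts. Proof. exact: ltn_pmod. Qed.

Lemma col_lt u : col u < m. Proof. by rewrite ltn_pmod. Qed.

Lemma idxE u : idx (row u) (col u) (loc u) = u.
Proof. by rewrite /idx /row /col /loc divnMA -!divn_eq. Qed.

Lemma row_lt u : u < grid_size -> row u < n.
Proof.
move=> lt_u; rewrite /row ltn_divLR ?muln_gt0 ?m_gt0 //.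
by rewrite [nverts * m]mulnC mulnA.
Qed.

Lemma idxK i j a : j < m -> a < nverts ->
  [/\ row (idx i j a) = i, col (idx i j a) = j & loc (idx i j a) = a].
Proof.
move=> lt_j lt_a.
have dv : idx i j a %/ nverts = i * m + j by rewrite /idx divnMDl // divn_small // addn0.
by rewrite /row divnMA /col dv divnMDl // divn_small // addn0 modnMDl modn_small // /loc /idx modnMDl modn_small.
Qed.

Lemma idx_lt i j a : i < n -> j < m -> a < nverts -> idx i j a < grid_size.
Proof.
rewrite /idx /grid_size => lt_i lt_j lt_a; have lt_ij : i * m + j < n * m by nia.
apply: (@leq_trans ((i * m + j).+1 * nverts)); first by rewrite mulSnr ltn_add2l.
by rewrite leq_mul2r lt_ij orbT.
Qed.

Lemma arc_cell i j a b : j < m -> (a, b) \in edges_at i j -> arc (idx i j a) (idx i j b).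
Proof.
move=> lt_j ab; have /and3P[lt_a lt_b _] := allP (cell_edges_bound _ _ _ _) _ ab.
have [r1 c1 l1] := idxK i lt_j lt_a; have [r2 c2 l2] := idxK i lt_j lt_b.
by rewrite /arc r1 c1 l1 r2 c2 l2 !eqxx ab.
Qed.

Lemma arc_right i j : j.+1 < m -> arc (idx i j vE) (idx i j.+1 vW).
Proof.
move=> lt_j; have [r1 c1 l1] := @idxK i j vE (ltnW lt_j) isT.
have [r2 c2 l2] := @idxK i j.+1 vW lt_j isT.
by rewrite /arc r1 c1 l1 r2 c2 l2 !eqxx /= orbT.
Qed.

Lemma arc_down i j : j < m -> arc (idx i j vS) (idx i.+1 j vN).
Proof.
move=> lt_j; have [r1 c1 l1] := @idxK i j vS lt_j isT.
have [r2 c2 l2] := @idxK i.+1 j vN lt_j isT.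
by rewrite /arc r1 c1 l1 r2 c2 l2 !eqxx /= !orbT.
Qed.

Definition grid_pos u :=
  (col u * cell_width + (cell_pos (loc u)).1, row u * cell_height + (cell_pos (loc u)).2).

Lemma cell_pos_bound a : a < nverts -> (cell_pos a).1 < cell_width /\ (cell_pos a).2 < cell_height.
Proof.
by rewrite -size_positions => lt_a; apply/andP; apply: (allP positions_bound); apply: mem_nth.
Qed.

Lemma grid_pos_inj : injective grid_pos.
Proof.
move=> u v [e1 e2]; rewrite -(idxE u) -(idxE v).
have [x1 y1] := cell_pos_bound (loc_lt u); have [x2 y2] := cell_pos_bound (loc_lt v).
have decomp w a b a' b' : b < w -> b' < w -> a * w + b = a' * w + b' -> a = a' /\ b = b'.
  move=> lt_b lt_b' eq_ab; have w_gt0 : 0 < w by apply: leq_ltn_trans lt_b.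
  split; first by have := congr1 (divn^~ w) eq_ab; rewrite !divnMDl // !divn_small // !addn0.
  by have := congr1 (modn^~ w) eq_ab; rewrite !modnMDl !modn_small.
have [-> ex] := decomp _ _ _ _ _ x1 x2 e1; have [-> ey] := decomp _ _ _ _ _ y1 y2 e2.
congr idx; apply/eqP; rewrite -(nth_uniq (0, 0) _ _ positions_uniq) ?size_positions ?loc_lt //.
by apply/eqP; rewrite -!/(cell_pos _) [LHS]surjective_pairing ex ey -surjective_pairing.
Qed.

Lemma arc_lattice u v : arc u v -> lattice_adj (grid_pos u) (grid_pos v).
Proof.
rewrite /grid_pos => /or3P[/and3P[/eqP<- /eqP<- ]|/and4P[/eqP<- /eqP<- /eqP-> /eqP->]|/and4P[/eqP<- /eqP<- /eqP-> /eqP->]].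
- by move=> /(allP (cell_edges_lattice _ _ _ _)); apply: lattice_adj_shift.
- have [-> ->] : cell_pos vE = (21, 8) /\ cell_pos vW = (0, 8) by [].
  by apply/orP; left; apply/or3P; apply: Or31; rewrite xpair_eqE /= /cell_width; lia.
- have [-> ->] : cell_pos vS = (8, 27) /\ cell_pos vN = (8, 0) by [].
  by apply/orP; left; apply/or3P; apply: Or32; rewrite xpair_eqE /= /cell_height; lia.
Qed.

Lemma grid_planar (R : realType) : planar R grid_graph.
Proof.
apply: (@lattice_planar R grid_graph (fun u => grid_pos u)).
  by move=> u v /grid_pos_inj/val_inj.
move=> u v; rewrite /adj /= => /orP[/arc_lattice//|/arc_lattice].
by rewrite /lattice_adj orbC.
Qed.

Lemma grid_subcubic : subcubic grid_graph.
Proof.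
move=> u; set i := row u; set j := col u; set a := loc u.
set t := (i == 0) && ~~ free j.
(* A list of all possible neighbours. At the border of the grid some entries are no neighbours,
   which is harmless for an upper bound. *)
pose L := [seq idx i j b | b <- cell_nbrs t (i.+1 == n) (pos i j) (neg i j) a] ++
  (nseq (a == vE) (idx i j.+1 vW) ++ (nseq (a == vW) (idx i j.-1 vE) ++
   (nseq (a == vS) (idx i.+1 j vN) ++ nseq ((a == vN) && ~~ t) (idx i.-1 j vS)))).
have sizeL : size L <= 3.
  by rewrite !size_cat size_map !size_nseq; apply: cell_degree; apply: loc_lt.
apply: leq_trans sizeL; rewrite cardE -(size_map val).
apply: uniq_leq_size; first by rewrite map_inj_uniq ?enum_uniq //; apply: val_inj.
move=> _ /mapP[v uv ->]; have {uv} : grid_adj u v by move: uv; rewrite mem_enum.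
rewrite -[X in X \in L](idxE (val v)).
rewrite /L !mem_cat !mem_nseq -/i -/j.
have nseq_in (b : bool) : (0 < b) = b by case: b.
rewrite !nseq_in.
case/orP => /or3P[/and3P[/eqP ei /eqP ej uv]|/and4P[/eqP ei /eqP ej /eqP ea /eqP eb]|/and4P[/eqP ei /eqP ej /eqP ea /eqP eb]].
- apply/orP; left; rewrite -ei -ej; apply: map_f; rewrite mem_cat; apply/orP; left.
  by apply/mapP; exists (a, loc v) => //; rewrite mem_filter /= eqxx.
- by rewrite -ei -ej eb /a ea eqxx /= eqxx ?orbT.
- by rewrite -ei -ej eb /a ea eqxx /= eqxx ?orbT.
- apply/orP; left; rewrite -/i -/j in ei ej; rewrite ei ej in uv *; apply: map_f; rewrite mem_cat; apply/orP; right.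
  by apply/mapP; exists (loc v, a) => //; rewrite mem_filter /= eqxx.
- by rewrite /i /j ei -ej /= ea /a eb eqxx /= eqxx ?orbT.
- by rewrite /t /i /j -ei -ej /= ea /a eb eqxx /= eqxx ?orbT.
Qed.

End Grid.

(** * Colourings of the grid and satisfying assignments *)

Section GridColouring.
Variables (n m : nat) (pos neg : nat -> nat -> bool) (free : nat -> bool).
Hypotheses (n_gt0 : 0 < n) (m_gt0 : 0 < m).
Notation N := (grid_size n m).
Notation adjg := (grid_adj n m pos neg free).
Notation idx := (idx m).

Definition grid_cost := n * m * gadget_cost.

Lemma sum_grid (F : nat -> nat) :
  \sum_(0 <= u < N) F u =
  \sum_(0 <= i < n) \sum_(0 <= j < m) \sum_(0 <= a < nverts) F (idx i j a).
Proof. by rewrite /grid_size !sum_nat_mul. Qed.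

Lemma sum_mkseq (f : nat -> nat) k : sumn (mkseq f k) = \sum_(0 <= a < k) f a.
Proof. by rewrite sumnE big_map /index_iota subn0. Qed.

Lemma sum_grid_const k :
  \sum_(0 <= i < n) \sum_(0 <= j < m) k = n * m * k.
Proof. by rewrite sum_nat_const_nat subn0 sum_nat_const_nat subn0 mulnA. Qed.

Section Complete.
Variable val : nat -> bool.

Definition literal i j := if pos i j then val i else neg i j && ~~ val i.
Definition signal i j := free j || has (literal^~ j) (iota 0 i).

Hypothesis val_sat : forall j, j < m -> signal n j.

Definition cell_colouring i j := gadget_colouring (val i) (signal i j) (literal i j).

Definition grid_colouring u := nth 0 (cell_colouring (row m u) (col m u)) (loc u).

Lemma signalS i j : signal i.+1 j = signal i j || literal i j.
Proof. by rewrite /signal -addn1 iotaD has_cat /= orbF orbA. Qed.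

Lemma arc_colouring u v : u < N -> v < N ->
  arc n m pos neg free u v -> grid_colouring u <> grid_colouring v.
Proof.
move=> lt_u lt_v; rewrite /arc /grid_colouring /cell_colouring.
have lt_col := col_lt m_gt0 u; have lt_row := row_lt m_gt0 lt_u.
move: (col_lt m_gt0 v) (row_lt m_gt0 lt_v) lt_col lt_row.
move: (row m u) (row m v) (col m u) (col m v) (loc u) (loc v) => i i' j j' a a'.
move=> lt_j' lt_i' lt_j lt_i /or3P[|/and4P[/eqP ei _ /eqP-> /eqP->]|/and4P[/eqP<- /eqP<- /eqP-> /eqP->]].
- move=> /and3P[/eqP<- /eqP<-]; rewrite mem_cat.
  have /and5P[_ _ _ /allP edges /and5P[_ _ /eqP cN /eqP cS /and4P[/eqP cL /eqP cP /eqP cM /and3P[/eqP cZ /eqP cT /eqP cB]]]]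
    := gadget_colouringP (val i) (signal i j) (literal i j).
  case/orP => [/edges/eqP //|].
  rewrite inE mem_cat => /or3P[/eqP[-> ->]||].
  + rewrite cL; case p: (pos i j); first by rewrite cP /literal p; case: (val i).
    case q: (neg i j); first by rewrite cM /literal p q; case: (val i).
    by rewrite cZ /literal p q.
  + case: ifP => // /andP[/eqP i0 nfree]; rewrite inE => /eqP[-> ->].
    by rewrite cN cT i0 /signal /= orbF (negbTE nfree).
  + case: ifP => // /eqP def_n; rewrite inE => /eqP[-> ->].
    by rewrite cS cB -signalS def_n val_sat.
- have /and5P[_ _ _ _ /and5P[_ /eqP-> _ _ _]] := gadget_colouringP (val i) (signal i j) (literal i j).
  have /and5P[_ _ _ _ /and5P[/eqP-> _ _ _ _]] := gadget_colouringP (val i') (signal i' j') (literal i' j').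
  by rewrite -ei; case: (val i).
- have /and5P[_ _ _ _ /and5P[_ _ _ /eqP-> _]] := gadget_colouringP (val i) (signal i j) (literal i j).
  have /and5P[_ _ _ _ /and5P[_ _ /eqP-> _ _]] := gadget_colouringP (val i.+1) (signal i.+1 j) (literal i.+1 j).
  by rewrite signalS; case: (_ || _).
Qed.

Lemma grid_colouring_ok :
  [/\ forall u, 0 < grid_colouring u,
      forall u v, u < N -> v < N -> adjg u v -> grid_colouring u <> grid_colouring v &
      \sum_(0 <= u < N) grid_colouring u = grid_cost].
Proof.
have cell_ok i j := gadget_colouringP (val i) (signal i j) (literal i j).
split.
- move=> u; have /and5P[/eqP sz _ /allP gt0 _ _] := cell_ok (row m u) (col m u).
  by apply: gt0; rewrite mem_nth // sz loc_lt.
- by move=> u v lt_u lt_v /orP[/arc_colouring|/arc_colouring /[swap]]; [apply|move=> e; apply=> //; rewrite e].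
- rewrite sum_grid /grid_cost -sum_grid_const; apply: eq_big_nat => i /= lt_i.
  apply: eq_big_nat => j /= lt_j.
  have /and5P[/eqP sz /eqP<- _ _ _] := cell_ok i j.
  rewrite -[in RHS](mkseq_nth 0 (gadget_colouring _ _ _)) sum_mkseq sz.
  apply: eq_big_nat => a /= lt_a; rewrite /grid_colouring.
  by have [-> -> ->] := idxK m_gt0 i lt_j lt_a.
Qed.

End Complete.

Section Sound.
Variable c : nat -> nat.
Hypothesis c3 : forall u, 0 < c u <= 3.
Hypothesis c_ok : forall u v, u < N -> v < N -> adjg u v -> ~~ clash (c u) (c v).
Hypothesis c_cost : \sum_(0 <= u < N) c u <= grid_cost.

Let cell i j a := c (idx i j a).

Lemma cell_no_clash i j : i < n -> j < m -> no_clash (edges_at n pos neg free i j) (cell i j).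
Proof.
move=> lt_i lt_j; apply/allP => -[a b] ab /=.
have /and3P[/= lt_a lt_b _] := allP (cell_edges_bound _ _ _ _) _ ab.
by apply: c_ok; rewrite ?idx_lt // /grid_adj arc_cell.
Qed.

Lemma cell_relation i j : i < n -> j < m -> relation_ok (mkseq (cell i j) nverts).
Proof.
have cost_le i' j' : i' < n -> j' < m ->
    gadget_cost <= sumn (mkseq (cell i' j') nverts) ?= iff tight gadget 0 (cell i' j').
  move=> lt_i' lt_j'; have := cell_no_clash lt_i' lt_j'; rewrite /no_clash /edges_at /cell_edges all_cat => /andP[nc _].
  exact: costs_tight gadget_pieces (fun a => c3 _) nc.
move=> lt_i lt_j.
have /andP[nc _] : no_clash gadget_edges (cell i j) && true.
  by have := cell_no_clash lt_i lt_j; rewrite /no_clash /edges_at /cell_edges all_cat => /andP[-> _].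
apply: (gadget_tight _ nc).
rewrite -(cost_le i j lt_i lt_j) eqn_leq (cost_le i j lt_i lt_j) /=.
have sum_cells : \sum_(i' < n) \sum_(j' < m) sumn (mkseq (cell i' j') nverts) <=
    \sum_(i' < n) \sum_(j' < m) gadget_cost.
  move: c_cost; rewrite sum_grid /grid_cost -sum_grid_const !big_mkord.
  under eq_bigr => i' _ do rewrite big_mkord.
  by under eq_bigr => i' _ do under eq_bigr => j' _ do rewrite -sum_mkseq.
(* A cell above its minimum would push the total above [grid_cost], since no cell lies below its
   minimum. *)
rewrite leqNgt; apply/negP => lt_cost; move: sum_cells; rewrite leqNgt => /negP; apply.
have lt_sum I (r : I) (J : finType) (r0 : J) (F G : J -> nat) :
    (forall k, F k <= G k) -> F r0 < G r0 -> \sum_k F k < \sum_k G k.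
  move=> le_FG lt_FG; rewrite (bigD1 r0) //= [X in _ < X](bigD1 r0) //= -addSn.
  by apply: leq_add => //; apply: leq_sum.
apply: (lt_sum _ tt _ (Ordinal lt_i)) => [i'|] /=.
  by apply: leq_sum => j' _; have [] := cost_le i' j' (ltn_ord _) (ltn_ord _).
apply: (lt_sum _ tt _ (Ordinal lt_j)) => [j'|] //=.
by have [] := cost_le i j' lt_i (ltn_ord _).
Qed.

Lemma two_values a : a \in [:: 1; 2] -> a = 1 \/ a = 2.
Proof. by rewrite !inE => /orP[]/eqP; [left|right]. Qed.

Definition row_value i := cell i 0 vW == 2.

Lemma cell_ports i j : i < n -> j < m ->
  [/\ cell i j vE = 3 - cell i j vW, cell i j vPos = cell i j vW, cell i j vNeg = 3 - cell i j vW,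
      [|| cell i j vS == 1, cell i j vN == 1 | cell i j vL == 1] &
      [/\ cell i j vW \in [:: 1; 2], cell i j vN \in [:: 1; 2], cell i j vS \in [:: 1; 2],
          cell i j vL \in [:: 1; 2] &
          [/\ cell i j vZero = 1, cell i j vTop = 1 & cell i j vBot = 1]]].
Proof.
move=> lt_i lt_j; have := cell_relation lt_i lt_j; rewrite /relation_ok !nth_mkseq //.
case/and5P => pW /eqP pE pN pS /and5P[pL /eqP p1 /eqP p2 p3 /and3P[/eqP q1 /eqP q2 /eqP q3]].
by split.
Qed.

(** Two negations cancel: [vE] has the colour opposite to [vW], and the edge from [vE] forbids this
    colour at the next [vW]. *)
Lemma row_constant i j : i < n -> j < m -> cell i j vW = cell i 0 vW.
Proof.
move=> lt_i; elim: j => // j IH lt_j.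
have [eE _ _ _ [/two_values W1 _ _ _ _]] := cell_ports lt_i (ltnW lt_j).
have [_ _ _ _ [/two_values W2 _ _ _ _]] := cell_ports lt_i lt_j.
rewrite -IH; last exact: ltnW.
have := @c_ok (idx i j vE) (idx i j.+1 vW).
rewrite !idx_lt ?(ltnW lt_j) // /grid_adj arc_right // => /(_ isT isT isT).
by rewrite -!/(cell _ _ _) eE; case: W1 => ->; case: W2 => ->.
Qed.

Lemma cell_literal i j : i < n -> j < m -> cell i j vL = 1 -> literal row_value i j.
Proof.
move=> lt_i lt_j L1; have [_ eP eM _ [/two_values W _ _ _ [eZ _ _]]] := cell_ports lt_i lt_j.
have := cell_no_clash lt_i lt_j; rewrite /no_clash /edges_at /cell_edges all_cat => /andP[_ /= /andP[]] /=.
rewrite L1 /literal /row_value -(row_constant lt_i lt_j) => + _.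
case: (pos i j); first by rewrite eP; case: W => ->.
case: (neg i j) => /=; first by rewrite eM; case: W => ->.
by rewrite eZ.
Qed.

(** A true signal is traced upwards. If the literal of the cell is false, [vN] has colour 1, which
    forces colour 2 on [vS] of the cell above; in the top row of a column that is not free, the edge
    to [vTop] rules this case out. *)
Lemma cell_signal i j : i < n -> j < m -> cell i j vS = 2 -> signal row_value i.+1 j.
Proof.
elim: i => [|i IH] lt_i lt_j S2; rewrite signalS;
  have [_ _ _ p3 [_ /two_values Nv _ _ [_ eT _]]] := cell_ports lt_i lt_j;
  move: p3; rewrite S2 /= => /orP[/eqP N1|/eqP L1]; last by rewrite (cell_literal lt_i lt_j L1) orbT.
- apply/orP; left; rewrite /signal; case f: (free j) => //.
  have := cell_no_clash lt_i lt_j; rewrite /no_clash /edges_at /cell_edges all_cat => /andP[_].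
  by rewrite /switches f /= => /and3P[_ + _]; rewrite N1 eT.
- by rewrite (cell_literal lt_i lt_j L1) orbT.
apply/orP; left; apply: IH => //; first exact: ltnW.
have [_ _ _ _ [_ _ /two_values S1 _ _]] := cell_ports (ltnW lt_i) lt_j.
have := @c_ok (idx i j vS) (idx i.+1 j vN).
rewrite !idx_lt ?(ltnW lt_i) // /grid_adj arc_down // => /(_ isT isT isT).
by rewrite -!/(cell _ _ _) N1; case: S1 => ->.
Qed.

Lemma grid_sound : msat n m pos neg free.
Proof.
exists row_value => j lt_j; rewrite -/(signal row_value n j).
have def_n : n.-1.+1 = n by rewrite prednK.
have lt_n : n.-1 < n by rewrite def_n.
rewrite -def_n; apply: cell_signal => //.
have [_ _ _ _ [_ _ /two_values Sv _ [_ _ eB]]] := cell_ports lt_n lt_j.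
case: Sv => // S1.
have := cell_no_clash lt_n lt_j; rewrite /no_clash /edges_at /cell_edges all_cat => /andP[_].
rewrite /switches def_n eqxx /= all_cat => /and3P[_ _ /andP[+ _]].
by rewrite /= S1 eB.
Qed.

End Sound.

End GridColouring.

(** * Subdivision *)

Lemma infix2P (T : eqType) (d x y : T) (s : seq T) :
  reflect (exists i, [/\ i.+1 < size s, nth d s i = x & nth d s i.+1 = y]) (infix [:: x; y] s).
Proof.
apply: (iffP (@infixP T [:: x; y] s)) => [[s1 [s2 ->]]|[i [lt_i def_x def_y]]].
  exists (size s1); split.
  - by rewrite size_cat /= addnS ltnS addnS ltnS leq_addr.
  - by rewrite nth_cat ltnn subnn.
  - by rewrite nth_cat ltnNge leqnSn /= subSnn.
exists (take i s), (drop i.+2 s).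
by rewrite /= -{1}(cat_take_drop i s) (drop_nth d) 1?ltnW // (drop_nth d) // def_x def_y.
Qed.

(* How much the inner vertices of an edge subdivided evenly often must exceed
   the sum 1 + 2 + 1 + 2 + ... when the ends of the edge have equal colours. *)
Definition penalty a b := if a == b then (if a == 1 then 2 else if a == 2 then 1 else 0) else 0.

Definition differ (a b : nat) := a != b.

(** Strip two inner vertices at a time; being different, they cost at least 3. If [a = b], either
    the second one repeats [a] and the penalty is passed on, or both avoid [a] and the pair already
    pays the penalty. For [l = 0] the ends are adjacent and hence differ. *)
Lemma path_cost l a b s : size s = 2 * l -> 0 < a -> all (fun c => 0 < c) s ->
  path differ a (rcons s b) -> 3 * l + penalty a b <= sumn s.
Proof.
rewrite /differ; elim: l a s => [|l IH] a [|x [|y s]] //=; try lia.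
  by rewrite /penalty => _ _ _ /andP[/negbTE->].
move=> sz a_gt0 /and3P[x_gt0 y_gt0 s_gt0] /and3P[/eqP ax /eqP xy pth].
have := IH y s _ y_gt0 s_gt0 pth; rewrite /penalty.
have -> : size s = 2 * l by lia.
by move=> /(_ erefl); case: (a =P b); case: (y =P b); case: (a =P 1); case: (a =P 2);
  case: (y =P 1); case: (y =P 2); lia.
Qed.

(** If [a] is 2 or [b] is 1, then [a] is not 1 and [b] is not 2, because the ends differ. So one of
    the two alternating patterns always fits. *)
Definition alternate l a b := flatten (nseq l (if (a != 2) && (b != 1) then [:: 2; 1] else [:: 1; 2])).

Lemma alternate_ok l a b : a != b -> 0 < a ->
  [/\ size (alternate l a b) = 2 * l, sumn (alternate l a b) = 3 * l,
      all (fun c => 0 < c) (alternate l a b) & path differ a (rcons (alternate l a b) b)].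
Proof.
rewrite /alternate /differ => ab a_gt0; case: ifP => cond; split.
- by elim: l => //= l ->; rewrite mulnS.
- by elim: l => //= l ->; rewrite mulnS.
- by elim: l.
- move: cond => /andP[a2 b1]; elim: l a ab a_gt0 a2 => [|l IH] a ab a_gt0 a2 /=; first by rewrite ab.
  by rewrite a2 IH // eq_sym.
- by elim: l => //= l ->; rewrite mulnS.
- by elim: l => //= l ->; rewrite mulnS.
- by elim: l.
- have {cond} : (a != 1) && (b != 2) || (l == 0).
    by move: cond ab a_gt0; case: (a =P 2) => [->|_]; case: (b =P 1) => [->|] //=; case: eqP; case: eqP; lia.
  case: l => [|l]; first by rewrite /= ab.
  rewrite orbF => /andP[a1 b2]; elim: l.+1 a ab a_gt0 a1 => [|l' IH] a' ab a_gt0 a1 /=; first by rewrite ab.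
  by rewrite a1 IH // eq_sym.
Qed.

Section SubdivisionSum.
Variables (G : sgraph) (l : nat).
Notation k := (2 * l).
Notation edge := {p : G * G | oriented_edge p}.
Notation S := (subdivision k G).

Lemma sum_sub_vertex (C : S -> nat) :
  \sum_(s : S) C s =
  \sum_(u : G) C (inl u) + \sum_(a : edge) \sum_(i < k) C (inr (a, i)).
Proof. by rewrite big_sumType /=; congr addn; rewrite pair_bigA; apply: eq_bigr => -[]. Qed.

Definition inner (C : S -> nat) (a : edge) : seq nat := [seq C (inr (a, i)) | i <- enum 'I_k].

Lemma sumn_inner C a : sumn (inner C a) = \sum_(i < k) C (inr (a, i)).
Proof. by rewrite sumnE big_map big_enum. Qed.

Lemma size_inner C a : size (inner C a) = k.
Proof. by rewrite size_map size_enum_ord. Qed.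

Lemma map_sub_path (C : S -> nat) a :
  map C (Defs.sub_path k a) = C (inl (val a).1) :: rcons (inner C a) (C (inl (val a).2)).
Proof. by rewrite /= map_rcons -map_comp. Qed.

Lemma path_differP x0 (s : seq nat) : reflect (forall i, i.+1 < size (x0 :: s) ->
  nth 0 (x0 :: s) i != nth 0 (x0 :: s) i.+1) (path differ x0 s).
Proof. exact: pathP. Qed.

Lemma colouring_sub_path (C : S -> nat) : (forall s, 0 < C s) ->
  reflect (colouring C) [forall a : edge, path differ (C (inl (val a).1))
     (rcons (inner C a) (C (inl (val a).2)))].
Proof.
move=> C_gt0; apply: (iffP forallP) => [paths|[_ C_adj] a].
  split=> // s t /existsP[a st].
  have nth_C i : i < size (Defs.sub_path k a) ->
      nth 0 (map C (Defs.sub_path k a)) i = C (nth (inl (val a).1) (Defs.sub_path k a) i).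
    by move=> lt_i; rewrite (nth_map (inl (val a).1)).
  have := paths a => /path_differP; rewrite -map_sub_path => pth.
  case/orP: st => /(infix2P (inl (val a).1))[i [lt_i <- <-]].
    have := pth i; rewrite size_map => /(_ lt_i).
    by rewrite !nth_C ?(ltnW lt_i) // => /eqP.
  have := pth i; rewrite size_map => /(_ lt_i).
  by rewrite !nth_C ?(ltnW lt_i) // => /eqP/nesym.
apply/path_differP => i; rewrite -map_sub_path size_map => lt_i.
rewrite !(nth_map (inl (val a).1)) ?(ltnW lt_i) //; apply/eqP; apply: C_adj.
apply/existsP; exists a; apply/orP; left.
by apply/(infix2P (inl (val a).1)); exists i.
Qed.

Lemma subdivision_colouring (c : G -> nat) : colouring c ->
  exists2 C : S -> nat, colouring C & \sum_s C s = \sum_u c u + 3 * l * #|{: edge}|.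
Proof.
move=> [c_gt0 c_adj].
have ends (a : edge) : c (val a).1 != c (val a).2.
  by case: a => -[u v] /= /andP[uv _]; apply/eqP; apply: c_adj.
pose alt (a : edge) := alternate l (c (val a).1) (c (val a).2).
have alt_ok a := alternate_ok l (ends a) (c_gt0 _).
pose C (s : S) := match s with inl u => c u | inr (a, i) => nth 0 (alt a) i end.
have innerC a : inner C a = alt a.
  have [sz _ _ _] := alt_ok a; apply: (@eq_from_nth _ 0); rewrite size_inner ?sz // => i lt_i.
  by rewrite (nth_map (Ordinal lt_i)) ?size_enum_ord //= nth_enum_ord.
have C_gt0 s : 0 < C s.
  case: s => [u|[a i]] /=; first exact: c_gt0.
  by have [sz _ /allP gt0 _] := alt_ok a; apply: gt0; rewrite mem_nth // sz.
exists C.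
  by apply/(colouring_sub_path C_gt0)/forallP => a; rewrite innerC; have [_ _ _ ->] := alt_ok a.
rewrite sum_sub_vertex; congr addn.
rewrite (eq_bigr (fun=> 3 * l)) => [|a _]; last by rewrite -sumn_inner innerC; have [] := alt_ok a.
by rewrite sum_nat_const mulnC.
Qed.

Lemma subdivision_colouring_cost (C : S -> nat) : colouring C ->
  \sum_u C (inl u) + \sum_(p : G * G | oriented_edge p) penalty (C (inl p.1)) (C (inl p.2)) +
    3 * l * #|{: edge}| <= \sum_s C s.
Proof.
move=> C_col; have [C_gt0 _] := C_col; rewrite sum_sub_vertex -addnA leq_add2l.
rewrite (big_sub (fun p : G * G => oriented_edge p)) [3 * l * _]mulnC -sum_nat_const -big_split /=.
apply: leq_sum => a _; rewrite -sumn_inner addnC.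
apply: path_cost; [exact: size_inner|exact: C_gt0| |].
  by apply/allP => _ /mapP[i _ ->].
by have /(colouring_sub_path C_gt0)/forallP/(_ a) := C_col.
Qed.

End SubdivisionSum.

Section Normalise.
Variables (G : sgraph) (c : G -> nat).
Hypothesis c_gt0 : forall u, 0 < c u.

(* Monochromatic edges are repaired by giving colour 3 to their later ends;
   edges between two vertices of colour 3 are left. *)
Definition raised v := [exists u, oriented_edge (u, v) && clash (c u) (c v)].

Definition normal v := if raised v then 3 else minn (c v) 3.

Lemma normal_bounds v : 0 < normal v <= 3.
Proof. by rewrite /normal; case: ifP => // _; have := c_gt0 v; lia. Qed.

Lemma normal_clash u v : adj u v -> ~~ clash (normal u) (normal v).
Proof.
have oriented x y : oriented_edge (x, y) -> ~~ clash (normal x) (normal y).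
  move=> xy; rewrite /clash; apply/andP => -[/eqP eq_n n12].
  move: n12; rewrite eq_n {1 2}/normal; case: ifP => //= nry n12.
  have cy : c y = 1 \/ c y = 2 by lia.
  have : normal x = c y by rewrite eq_n /normal nry; lia.
  rewrite /normal; case: ifP => _ eq_x; first by lia.
  have : raised y; last by rewrite nry.
  by apply/existsP; exists x; rewrite xy /clash (_ : c x = c y) ?eqxx; lia.
move=> uv; have [lt_uv|lt_vu|eq_uv] := ltngtP (enum_rank u) (enum_rank v).
- by apply: oriented; rewrite /oriented_edge uv.
- rewrite /clash eq_sym; have := @oriented v u; rewrite /clash /oriented_edge /= adj_sym uv lt_vu.
  by move=> /(_ isT); case: eqP => // ->.
- by move: uv; rewrite (enum_rank_inj (val_inj eq_uv)) adj_irrefl.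
Qed.

(** Raising a vertex from colour 1 or 2 to 3 costs exactly the penalty of a monochromatic edge at
    it. Edges are charged at their later ends only, so none pays twice. *)
Lemma normal_sum :
  \sum_u normal u <= \sum_u c u + \sum_(p : G * G | oriented_edge p) penalty (c p.1) (c p.2).
Proof.
have -> : \sum_(p : G * G | oriented_edge p) penalty (c p.1) (c p.2) =
    \sum_(v : G) \sum_(u : G | oriented_edge (u, v)) penalty (c u) (c v).
  by rewrite (exchange_big_dep xpredT) //= pair_big_dep /=; apply: eq_bigl => -[u v].
rewrite -big_split /=; apply: leq_sum => v _; rewrite /normal /raised.
case: existsP => [[u /andP[uv cl]]|_]; last by lia.
rewrite (bigD1 u) //=; apply: leq_trans (_ : c v + penalty (c u) (c v) <= _); last by lia.
by move: cl; rewrite /clash /penalty => /andP[/eqP-> /orP[]/eqP->].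
Qed.

End Normalise.

Lemma isomorphic_chromatic_sum (G H : sgraph) k : isomorphic G H ->
  chromatic_sum H k -> chromatic_sum G k.
Proof.
move=> [f [f_bij f_adj]] [c [[c_gt0 c_adj] le_c]]; exists (c \o f); split.
  by split=> [v|u v uv] /=; [apply: c_gt0|apply: c_adj; rewrite f_adj].
have -> : \sum_(v : G) (c \o f) v = \sum_(v : H) c v; last exact: le_c.
by rewrite [RHS](reindex f) //; apply: onW_bij.
Qed.

Lemma isomorphic_sym (G H : sgraph) : isomorphic G H -> isomorphic H G.
Proof.
move=> [f [[g fK gK] f_adj]]; exists g; split; first by exists f.
by move=> x y; rewrite -f_adj !gK.
Qed.

(** * Numbering the vertices of a subdivision *)

Section SubdivisionIndex.
Variables (N k : nat) (e : rel nat).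
Hypotheses (e_sym : symmetric e) (e_irr : irreflexive e).
Let G := nat_graph N e_sym e_irr.

(* The pair [(u, v)] is coded by [u * N + v]; edges are ranked by their codes. *)
Definition is_edge p := e (p %/ N) (p %% N) && (p %/ N < p %% N).

Definition edge_rank p := \sum_(0 <= q < p) is_edge q.

Definition edge_count := edge_rank (N * N).

(** Place [i] on the subdivided edge with code [p]: the ends are the places 0 and [k.+1], and the
    inner vertices fill the block of [k] numbers that the rank of the edge assigns behind the [N]
    old vertices. *)
Definition edge_point p i :=
  if i == 0 then p %/ N else if i == k.+1 then p %% N else N + edge_rank p * k + i.-1.

Definition sub_arc x y :=
  has (fun p => is_edge p &&
    has (fun i => (x == edge_point p i) && (y == edge_point p i.+1)) (iota 0 k.+1)) (iota 0 (N * N)).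

Definition sub_rel x y := sub_arc x y || sub_arc y x.

Definition sub_size := N + edge_count * k.

Lemma edge_rankS p : edge_rank p.+1 = edge_rank p + is_edge p.
Proof. by rewrite /edge_rank big_nat_recr. Qed.

Lemma edge_rank_le p q : p <= q -> edge_rank p <= edge_rank q.
Proof.
by elim: q => [|q IH]; [rewrite leqn0 => /eqP->|rewrite leq_eqVlt edge_rankS => /orP[/eqP->|/IH]]; rewrite ?edge_rankS //; lia.
Qed.

Lemma edge_rank_lt p q : is_edge p -> p < q -> edge_rank p < edge_rank q.
Proof. by move=> pe /edge_rank_le; rewrite edge_rankS pe addn1. Qed.

Lemma edge_rank_inj p q : is_edge p -> is_edge q -> edge_rank p = edge_rank q -> p = q.
Proof.
move=> pe qe eq_r; case: (ltngtP p q) => // [/(edge_rank_lt pe)|/(edge_rank_lt qe)]; by rewrite eq_r ltnn.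
Qed.

Lemma edge_rank_surj r M : r < edge_rank M -> exists p, [/\ p < M, is_edge p & edge_rank p = r].
Proof.
elim: M => [|M IH]; first by rewrite /edge_rank big_nil.
rewrite edge_rankS; case ME: (is_edge M); last first.
  by rewrite addn0 => /IH[p [lt_p pe eq_r]]; exists p; split=> //; apply: ltnW.
rewrite addn1 ltnS leq_eqVlt => /orP[/eqP->|/IH[p [lt_p pe eq_r]]]; first by exists M.
by exists p; split=> //; apply: ltnW.
Qed.

Lemma code_bound p : p < N * N -> p %/ N < N /\ p %% N < N.
Proof.
move=> lt_p; have N_gt0 : 0 < N by case: (N) lt_p.
by rewrite ltn_divLR // lt_p ltn_pmod.
Qed.

Lemma sub_rel_sym : symmetric sub_rel.
Proof. by move=> x y; rewrite /sub_rel orbC. Qed.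

Lemma sub_rel_irr : irreflexive sub_rel.
Proof.
move=> x; rewrite /sub_rel orbb; apply/negbTE/hasPn => p; rewrite mem_iota add0n => /andP[_ lt_p].
have [lt1 lt2] := code_bound lt_p; apply/negP; case/andP; rewrite /is_edge; case/andP => _ lt12 /hasP[i].
rewrite mem_iota add0n /= => lt_i /andP[/eqP-> /eqP].
rewrite /edge_point eqSS /=; case: (i =P 0); case: (i =P k.+1); case: (i =P k); lia.
Qed.

Definition sub_graph := nat_graph sub_size sub_rel_sym sub_rel_irr.

Notation edge := {p : G * G | oriented_edge p}.
Notation S := (subdivision k G).

Lemma oriented_edgeE (p : G * G) : oriented_edge p = e p.1 p.2 && (p.1 < p.2).
Proof. by rewrite /oriented_edge !enum_rank_ord. Qed.

Definition edge_code (a : edge) : nat := (val a).1 * N + (val a).2.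

Lemma edge_codeK (a : edge) :
  [/\ edge_code a < N * N, edge_code a %/ N = (val a).1 & edge_code a %% N = (val a).2].
Proof.
rewrite /edge_code; case: (val a) => u v /=; have lt_v := ltn_ord v.
have N_gt0 : 0 < N by apply: leq_ltn_trans lt_v.
rewrite divnMDl // divn_small // addn0 modnMDl modn_small //; split=> //.
by have := ltn_ord u; nia.
Qed.

Lemma edge_code_is_edge (a : edge) : is_edge (edge_code a).
Proof.
have [_ d1 d2] := edge_codeK a; rewrite /is_edge d1 d2 -oriented_edgeE.
exact: (valP a).
Qed.

Lemma edge_code_inj : injective edge_code.
Proof.
move=> a b eq_ab; have [_ a1 a2] := edge_codeK a; have [_ b1 b2] := edge_codeK b.
apply: val_inj; rewrite [val a]surjective_pairing [val b]surjective_pairing.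
by congr pair; apply: val_inj; rewrite /= -?a1 -?a2 -?b1 -?b2 eq_ab.
Qed.

Lemma edge_code_surj p : p < N * N -> is_edge p -> exists a : edge, edge_code a = p.
Proof.
move=> lt_p pe; have [lt1 lt2] := code_bound lt_p.
have oe : oriented_edge (Ordinal lt1 : G, Ordinal lt2 : G) by rewrite oriented_edgeE.
exists (exist _ (Ordinal lt1 : G, Ordinal lt2 : G) oe).
by rewrite /edge_code /= -divn_eq.
Qed.

Definition sub_index (s : S) : nat :=
  match s with inl u => val u | inr (a, i) => N + edge_rank (edge_code a) * k + i end.

Lemma mulnD_inj a b i j : i < k -> j < k -> a * k + i = b * k + j -> a = b /\ i = j.
Proof.
move=> lt_i lt_j eq_ab; have k_gt0 : 0 < k by apply: leq_ltn_trans lt_i.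
split; first by have := congr1 (divn^~ k) eq_ab; rewrite !divnMDl // !divn_small // !addn0.
by have := congr1 (modn^~ k) eq_ab; rewrite !modnMDl !modn_small.
Qed.

Lemma sub_index_inj : injective sub_index.
Proof.
move=> [u|[a i]] [v|[b j]] /=.
- by move/val_inj->.
- by have := ltn_ord u; lia.
- by have := ltn_ord v; lia.
rewrite -!addnA => /addnI /mulnD_inj[] // /edge_rank_inj.
by move=> /(_ (edge_code_is_edge a) (edge_code_is_edge b)) /edge_code_inj -> /val_inj ->.
Qed.

Lemma sub_index_lt s : sub_index s < sub_size.
Proof.
rewrite /sub_size; case: s => [u|[a i]] /=; first by have := ltn_ord u; lia.
have [lt_a _ _] := edge_codeK a; have := edge_rank_lt (edge_code_is_edge a) lt_a.
by rewrite -/edge_count => lt_r; have := ltn_ord i; nia.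
Qed.

Lemma sub_index_surj x : x < sub_size -> exists s, sub_index s = x.
Proof.
rewrite /sub_size => lt_x; case: (ltnP x N) => [lt_xN|le_Nx]; first by exists (inl (Ordinal lt_xN)).
have k_gt0 : 0 < k by case: (k) lt_x => // ; rewrite muln0; lia.
have lt_r : (x - N) %/ k < edge_count by rewrite ltn_divLR //; lia.
have [p [lt_p pe eq_r]] := edge_rank_surj lt_r.
have [a def_p] := edge_code_surj lt_p pe.
have lt_i : (x - N) %% k < k by rewrite ltn_pmod.
exists (inr (a, Ordinal lt_i)); rewrite /= def_p eq_r -addnA -divn_eq; lia.
Qed.

Lemma sub_index_path (a : edge) i : i < k.+2 ->
  sub_index (nth (inl (val a).1) (Defs.sub_path k a) i) = edge_point (edge_code a) i.
Proof.
have [_ d1 d2] := edge_codeK a; rewrite /edge_point; case: i => [|i]; first by rewrite d1.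
rewrite ltnS /= nth_rcons size_map size_enum_ord eqSS => lt_i.
case: ltnP => [lt_ik|le_ki].
  rewrite (nth_map (Ordinal lt_ik)) ?size_enum_ord //= nth_enum_ord //.
  by rewrite (ltn_eqF lt_ik).
have -> : i = k by lia.
by rewrite eqxx d2.
Qed.

Lemma sub_index_arc s t : sub_arc (sub_index s) (sub_index t) =
  [exists a : edge, infix [:: s; t] (Defs.sub_path k a)].
Proof.
have size_path (a : edge) : size (Defs.sub_path k a) = k.+2.
  by rewrite /= size_rcons size_map size_enum_ord.
apply/hasP/existsP => [[p]|[a /(infix2P (inl (val a).1))[i []]]].
  rewrite mem_iota add0n => /andP[_ lt_p] /andP[pe /hasP[i]].
  rewrite mem_iota add0n => /andP[_ lt_i] /andP[/eqP es /eqP et].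
  have [a def_p] := edge_code_surj lt_p pe; exists a.
  apply/(infix2P (inl (val a).1)); exists i; rewrite size_path; split=> //.
    by apply: sub_index_inj; rewrite sub_index_path ?def_p // ltnW.
  by apply: sub_index_inj; rewrite sub_index_path ?def_p.
rewrite size_path => lt_i <- <-; exists (edge_code a).
  by rewrite mem_iota; have [] := edge_codeK a.
rewrite edge_code_is_edge andTb; apply/hasP; exists i; first by rewrite mem_iota.
by rewrite !sub_index_path ?eqxx // ltnW.
Qed.

Lemma sub_graph_iso : isomorphic sub_graph S.
Proof.
have surj (x : sub_graph) : exists s, sub_index s == x.
  by have [s eq_s] := sub_index_surj (ltn_ord x); exists s; apply/eqP.
pose f x := xchoose (surj x); have fK x : sub_index (f x) = x by apply/eqP; apply: (xchooseP (surj x)).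
exists f; split.
  exists (fun s => Ordinal (sub_index_lt s)) => [x|s]; first by apply: val_inj; rewrite /= fK.
  by apply: sub_index_inj; rewrite fK.
move=> x y; have -> : adj x y = sub_rel (sub_index (f x)) (sub_index (f y)) by rewrite !fK.
rewrite /sub_rel !sub_index_arc -[LHS]/(sub_adj (f x) (f y)) /sub_adj.
apply/existsP/orP => [[a /orP[]]|[]/existsP[a]] xy; [left|right|exists a|exists a].
- by apply/existsP; exists a.
- by apply/existsP; exists a.
- by rewrite xy.
- by rewrite xy orbT.
Qed.

Lemma card_edge : #|{: edge}| = edge_count.
Proof.
rewrite card_sig /edge_count /edge_rank sum_nat_mul big_mkord.
under eq_bigr => u _ do rewrite big_mkord.
rewrite pair_bigA /= -sum1_card big_mkcond /=; apply: eq_bigr => -[u v] _ /=.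
have lt_v := ltn_ord v; have N_gt0 : 0 < N by apply: leq_ltn_trans lt_v.
rewrite /is_edge divnMDl // divn_small // addn0 modnMDl modn_small //.
by rewrite -topredE /= oriented_edgeE /=; case: (_ && _).
Qed.

End SubdivisionIndex.

(** * The reduction *)

(** [instance_word] rewritten as loops over numbers, which makes it definable. The second
    [[:: false]] is the sign of the threshold. *)
Definition graph_word N (e : nat -> nat -> bool) k : word :=
  [seq true | _ <- iota 0 N] ++ [:: false] ++
  flatten [seq [seq e u v | v <- iota 0 N] | u <- iota 0 N] ++
  [:: false] ++ [seq odd (k %/ 2 ^ i) | i <- iota 0 (up_log 2 k.+1)].

Lemma instance_nat_graph N (e : rel nat) (e_sym : symmetric e) (e_irr : irreflexive e) k :
  instance_word (nat_graph N e_sym e_irr) (Posz k) = graph_word N e k.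
Proof.
rewrite /instance_word /graph_word card_ord; congr (_ ++ _).
  by rewrite -[in LHS](size_iota 0 N); elim: (iota _ _) => //= ? s ->.
congr (_ :: _); congr (_ ++ _); rewrite -val_enum_ord -map_comp; congr flatten.
by apply: eq_map => u /=; rewrite -map_comp.
Qed.

Section DefinableGraphs.
Variables (n m : word -> nat) (pos neg : word -> nat -> nat -> bool) (free : word -> nat -> bool).
Hypotheses (Hn : df0 n) (Hm : df0 m) (Hpos : dfb2 pos) (Hneg : dfb2 neg) (Hfree : dfb1 free).

Lemma mem_pairs (s : seq (nat * nat)) a b : ((a, b) \in s) = has (fun p => (a == p.1) && (b == p.2)) s.
Proof. by elim: s => //= -[x y] s IH; rewrite inE IH xpair_eqE. Qed.

Lemma df_row C (v : view C) f : df v f -> df v (fun c => row (m (v c).1) (f c)).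
Proof. by move=> Hf; apply: df_div => //; apply: df_mul; [apply: df_const|apply: Hm]. Qed.

Lemma df_col C (v : view C) f : df v f -> df v (fun c => col (m (v c).1) (f c)).
Proof. by move=> Hf; apply: df_mod; [apply: df_div => //; apply: df_const|apply: Hm]. Qed.

Lemma df_loc C (v : view C) f : df v f -> df v (fun c => loc (f c)).
Proof. by move=> Hf; apply: df_mod => //; apply: df_const. Qed.

Lemma dfb_edges_at C (v : view C) i j a b : df v i -> df v j -> df v a -> df v b ->
  dfb v (fun c => (a c, b c) \in
    edges_at (n (v c).1) (pos (v c).1) (neg (v c).1) (free (v c).1) (i c) (j c)).
Proof.
move=> Hi Hj Ha Hb.
pose gad c := has (fun p => (a c == p.1) && (b c == p.2)) gadget_edges.
pose lit c := (a c == vL) && (b c == (if pos (v c).1 (i c) (j c) then vPos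
  else if neg (v c).1 (i c) (j c) then vNeg else vZero)).
pose top c := ((i c == 0) && ~~ free (v c).1 (j c)) && ((a c == vN) && (b c == vTop)).
pose bot c := ((i c).+1 == n (v c).1) && ((a c == vS) && (b c == vBot)).
apply: (@df_ext _ _ (fun c => gad c || (lit c || (top c || bot c)))).
  move=> c; congr nat_of_bool; rewrite /edges_at /cell_edges mem_cat mem_pairs -/(gad c); congr orb.
  rewrite /switches inE mem_cat xpair_eqE -/(lit c); congr orb; congr orb.
    by rewrite /top; case: ifP => _ //; rewrite inE xpair_eqE.
  by rewrite /bot; case: ifP => _ //; rewrite inE xpair_eqE.
apply: dfb_or.
  apply: (@dfb_has_seq _ _ _ gadget_edges (fun p c => (a c == p.1) && (b c == p.2))) => p.
  by apply: dfb_and; apply: df_eq => //; apply: df_const.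
apply: dfb_or.
  apply: dfb_and; apply: df_eq => //; first exact: df_const.
  apply: df_if; [exact: Hpos|exact: df_const|].
  by apply: df_if; [exact: Hneg|exact: df_const|exact: df_const].
apply: dfb_or.
  apply: dfb_and.
    apply: dfb_and; first by apply: df_eq => //; apply: df_const.
    by apply: dfb_not; apply: Hfree.
  by apply: dfb_and; apply: df_eq => //; apply: df_const.
apply: dfb_and; first by apply: df_eq; [apply: df_succ|apply: Hn].
by apply: dfb_and; apply: df_eq => //; apply: df_const.
Qed.

Lemma dfb_arc : dfb2 (fun x => arc (n x) (m x) (pos x) (neg x) (free x)).
Proof.
move=> C v f g Hf Hg.
have Hrf := df_row Hf; have Hrg := df_row Hg; have Hcf := df_col Hf; have Hcg := df_col Hg.
have Hlf := df_loc Hf; have Hlg := df_loc Hg.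
apply: dfb_or; [|apply: dfb_or].
- apply: dfb_and; first exact: df_eq.
  by apply: dfb_and; [exact: df_eq|apply: dfb_edges_at].
- apply: dfb_and; first exact: df_eq.
  apply: dfb_and; first by apply: df_eq => //; apply: df_succ.
  by apply: dfb_and; apply: df_eq => //; apply: df_const.
- apply: dfb_and; first by apply: df_eq => //; apply: df_succ.
  apply: dfb_and; first exact: df_eq.
  by apply: dfb_and; apply: df_eq => //; apply: df_const.
Qed.

Lemma dfb_grid_adj : dfb2 (fun x => grid_adj (n x) (m x) (pos x) (neg x) (free x)).
Proof. by move=> C v f g Hf Hg; apply: dfb_or; apply: dfb_arc. Qed.

Lemma df_grid_size : df0 (fun x => grid_size (n x) (m x)).
Proof.
move=> C v; apply: df_mul; last exact: df_const.
by apply: df_mul; [exact: Hn|exact: Hm].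
Qed.

End DefinableGraphs.

Section DefinableSubdivision.
Variables (N : word -> nat) (e : word -> nat -> nat -> bool) (k : nat).
Hypotheses (HN : df0 N) (He : dfb2 e).

Lemma dfb_is_edge : dfb1 (fun x => is_edge (N x) (e x)).
Proof.
move=> C v f Hf.
have Hd : df v (fun c => f c %/ N (v c).1) by apply: df_div => //; apply: HN.
have Hr : df v (fun c => f c %% N (v c).1) by apply: df_mod => //; apply: HN.
by apply: dfb_and; [apply: He|apply: df_ltn].
Qed.

Lemma df_edge_rank C (v : view C) f : df v f ->
  df v (fun c => edge_rank (N (v c).1) (e (v c).1) (f c)).
Proof.
move=> Hf; apply: (@df_sum _ _ f) => //.
by apply: (@dfb_is_edge _ (ext v)); apply: df_var.
Qed.

Lemma df_edge_count : df0 (fun x => edge_count (N x) (e x)).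
Proof. by move=> C v; apply: df_edge_rank; apply: df_mul; apply: HN. Qed.

Lemma df_edge_point C (v : view C) p i : df v p -> df v i ->
  df v (fun c => edge_point (N (v c).1) k (e (v c).1) (p c) (i c)).
Proof.
move=> Hp Hi; apply: df_if.
- by apply: df_eq => //; apply: df_const.
- by apply: df_div => //; apply: HN.
apply: df_if.
- by apply: df_eq => //; apply: df_const.
- by apply: df_mod => //; apply: HN.
apply: df_add; first by apply: df_add; [apply: HN|apply: df_mul; [apply: df_edge_rank|apply: df_const]].
by apply: (@df_ext _ _ (fun c => i c - 1)) => [c|]; [rewrite subn1|apply: df_sub => //; apply: df_const].
Qed.

Lemma dfb_sub_arc : dfb2 (fun x => sub_arc (N x) k (e x)).
Proof.
move=> C v f g Hf Hg.
apply: (@dfb_has _ _ (fun c => N (v c).1 * N (v c).1)); first by apply: df_mul; apply: HN.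
apply: dfb_and; first by apply: (@dfb_is_edge _ (ext v)); apply: df_var.
apply: (@dfb_has _ _ (fun=> k.+1)); first exact: df_const.
apply: dfb_and; apply: df_eq.
- exact: df_weak (df_weak Hf).
- apply: (@df_edge_point _ (ext (ext v))); last exact: df_var.
  by apply: df_weak; exact: df_var.
- exact: df_weak (df_weak Hg).
- apply: (@df_edge_point _ (ext (ext v))); last by apply: df_succ; exact: df_var.
  by apply: df_weak; exact: df_var.
Qed.

Lemma dfb_sub_rel : dfb2 (fun x => sub_rel (N x) k (e x)).
Proof. by move=> C v f g Hf Hg; apply: dfb_or; apply: dfb_sub_arc. Qed.

Lemma df_sub_size : df0 (fun x => sub_size (N x) k (e x)).
Proof.
move=> C v; apply: df_add; first exact: HN.
by apply: df_mul; [exact: df_edge_count|exact: df_const].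
Qed.

End DefinableSubdivision.

Lemma polytime_graph_word (N : word -> nat) (e : word -> nat -> nat -> bool) (K : word -> nat) :
  df0 N -> dfb2 e -> df0 K -> polytime (fun x => graph_word (N x) (e x) (K x)).
Proof.
move=> HN He HK; apply: polytime_dfw.
have HNi := HN _ input_view; have HKi := HK _ input_view.
apply: dfw_cat; first by apply: (@dfw_map _ _ N (fun _ _ => true)) => //; apply: dfb_const.
apply: dfw_cat; first by apply: dfw_bit; apply: dfb_const.
apply: dfw_cat.
  apply: (@dfw_for _ _ N) => //.
  apply: (@dfw_map _ (ext input_view) (fun c => N c.1)); first exact: (HN _ (ext input_view)).
  apply: (@He _ (ext (ext input_view)) (fun c => c.1.2) (fun c => c.2)).
    by apply: df_weak; exact: df_var.
  exact: df_var.
apply: dfw_cat; first by apply: dfw_bit; apply: dfb_const.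
apply: (@dfw_map _ _ (fun x => up_log 2 (K x).+1)); first exact: df_up_log.
apply: (@dfb_digit _ (ext input_view)); last exact: df_var.
exact: (HK _ (ext input_view)).
Qed.

Section GridThreshold.
Variables (n m : nat) (pos neg : nat -> nat -> bool) (free : nat -> bool) (l : nat).
Hypotheses (n_gt0 : 0 < n) (m_gt0 : 0 < m).
Let G := grid_graph n m pos neg free.
Let threshold := grid_cost n m + 3 * l * #|{: {p : G * G | oriented_edge p}}|.

Lemma msat_chromatic_sum : msat n m pos neg free <->
  chromatic_sum (subdivision (2 * l) G) (Posz threshold).
Proof.
split=> [[val val_sat]|[C [C_col le_C]]].
  have [gt0 adj_ok sum_c] := grid_colouring_ok m_gt0 (val_sat : forall j, j < m -> signal pos neg free val n j).
  have [|C C_col sum_C] := @subdivision_colouring G l (fun u : G => grid_colouring m pos neg free val u).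
    by split=> // u v uv; apply: adj_ok; rewrite ?ltn_ord.
  by exists C; split=> //; rewrite sum_C -(big_mkord xpredT) sum_c.
pose c (u : G) := C (inl u).
have c_gt0 u : 0 < c u by have [gt0 _] := C_col; apply: gt0.
(* [grid_sound] wants colours between 1 and 3 on all numbers, hence the default 1 outside the
   grid. *)
pose c' u := if insub u : option 'I_(grid_size n m) is Some o then normal (c : G -> nat) o else 1.
have c'E (u : G) : c' u = normal c u by rewrite /c' valK.
apply: (@grid_sound n m pos neg free n_gt0 m_gt0 c').
- by move=> u; rewrite /c'; case: insubP => // o _ _; apply: normal_bounds.
- move=> u v lt_u lt_v uv; have := @normal_clash G c (Ordinal lt_u) (Ordinal lt_v) uv.
  by rewrite -!c'E.
rewrite big_mkord; under eq_bigr => u _ do rewrite c'E.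
have le1 := @normal_sum G c.
have le2 := subdivision_colouring_cost C_col.
(* Normalising costs at most the penalties, and these are part of the cost of [C]; the constant
   [3 * l] per edge is added on both sides. *)
rewrite -(leq_add2r (3 * l * #|{: {p : G * G | oriented_edge p}}|)).
apply: (@leq_trans (\sum_s C s)); last by rewrite -lez_nat.
by apply: leq_trans le2; rewrite leq_add2r.
Qed.

End GridThreshold.

Lemma NP_hard_subdivision (R : realType) l :
  NP_hard (restricted_problem chromatic_sum (subdivision_class (planar_subcubic R) (2 * l))).
Proof.
move=> L /NP_msat [n [m [pos [neg [free [[Hn Hm Hpos Hneg Hfree] HL]]]]]].
pose N x := grid_size (n x) (m x).
pose e x := grid_adj (n x) (m x) (pos x) (neg x) (free x).
have HN : df0 N := df_grid_size Hn Hm.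
have He : dfb2 e := dfb_grid_adj Hn Hm Hpos Hneg Hfree.
pose K x := grid_cost (n x) (m x) + 3 * l * edge_count (N x) (e x).
exists (fun x => graph_word (sub_size (N x) (2 * l) (e x)) (sub_rel (N x) (2 * l) (e x)) (K x)).
split.
  apply: polytime_graph_word; [exact: df_sub_size|exact: dfb_sub_rel|].
  move=> C v; apply: df_add.
    by apply: df_mul; [apply: df_mul; [exact: Hn|exact: Hm]|exact: df_const].
  by apply: df_mul; [exact: df_const|exact: df_edge_count].
move=> x; have [n_gt0 m_gt0 {}HL] := HL x.
pose G := grid_graph (n x) (m x) (pos x) (neg x) (free x).
have def_K : K x = grid_cost (n x) (m x) + 3 * l * #|{: {p : G * G | oriented_edge p}}|.
  by rewrite /K card_edge.
pose H := sub_graph (N x) (2 * l) (e x).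
have H_iso : isomorphic H (subdivision (2 * l) G) by apply: sub_graph_iso.
have def_f : graph_word (sub_size (N x) (2 * l) (e x)) (sub_rel (N x) (2 * l) (e x)) (K x) =
    instance_word H (Posz (K x)) by rewrite instance_nat_graph.
have prom : promise (restricted_problem chromatic_sum (subdivision_class (planar_subcubic R) (2 * l)))
    (instance_word H (Posz (K x))).
  exists H, (Posz (K x)); split=> //; exists G; split=> //; split; last exact: grid_subcubic.
  exact: grid_planar.
rewrite def_f; split=> //; rewrite HL.
apply: (iff_trans (msat_chromatic_sum (pos x) (neg x) (free x) l n_gt0 m_gt0)); rewrite -def_K.
apply: iff_trans _ (iff_sym (restricted_yes prom)).
split=> [sum_S|/chromatic_sum_word sum_H].
  by apply/chromatic_sum_word; apply: isomorphic_chromatic_sum H_iso sum_S.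
exact: isomorphic_chromatic_sum (isomorphic_sym H_iso) sum_H.
Qed.

Theorem theorem10 (R : realType) :
  (forall l : nat,
     NP_complete_for chromatic_sum
       (subdivision_class (planar_subcubic R) (2 * l)%N)) /\
  NP_complete_under_edge_subdivision chromatic_sum.
Proof.
have hard l := @NP_hard_subdivision R l.
split=> [l|j j_gt0]; first by split; [apply: in_NP_restricted|apply: hard].
exists (2 * j); split=> [|_]; first by lia.
split; first exact: in_NP_restricted.
(* The reduction for planar subcubic graphs also serves the larger class: its outputs keep the
   promise, and the answer depends on the word alone. *)
move=> L /(hard j)[f [poly_f red_f]]; exists f; split=> // x.
have [[H [k [[G [[_ sub_G] iso_H]] def_f]]] yes_f] := red_f x.
by split=> //; exists H, k; split=> //; exists G.
Qed.
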